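(* For $n\in\mathbb N$ let $\mu_n=\sum_{x\in\mathbb Z}\delta_{(n^{-\zeta}x,\;n^{1-\zeta}d(x))}$, a point process on $\mathbb R\times(0,\infty)$. As $n\to\infty$, $\mu_n$ converges in distribution, with respect to the vague topology, to the Poisson point process $\mu$ on $\mathbb R\times(0,\infty)$ with intensity function \[ (x,y)\mapsto q^2p_\kappa\,y^{2\kappa+1},\qquad p_\kappa=2\,\mathfrak B(\kappa+1,\kappa+1), \] where $\mathfrak B$ is the Euler beta function.
   Context: Let $c>0$, $q>0$, $\kappa>-1$. $F=(F(x))_{x\in\mathbb Z}$ is a family of i.i.d. random variables whose common density $\varrho$ is even, continuous, strictly positive on $(-c,c)$, zero outside $(-c,c)$, with $\lim_{x\to c}\varrho(x)/|c-x|^{\kappa}=q$. The discrepancy of the edge $\{x,x+1\}$ is $d(x)=2c-|F(x+1)-F(x)|$. Let $\zeta=\frac{2\kappa+2}{2\kappa+3}$. *)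

(* Defs.v *)
From HB Require Import structures.
From mathcomp Require Import all_boot all_order all_algebra.
From mathcomp Require Import all_classical all_reals all_analysis.
From mathcomp Require Import measurable_realfun.
Set Implicit Arguments. Unset Strict Implicit. Unset Printing Implicit Defensive.
Import Order.TTheory GRing.Theory Num.Theory.
Import numFieldNormedType.Exports.
Local Open Scope classical_set_scope.
Local Open Scope ring_scope.

Section defs.
Context {R : realType}.

Definition Sp : set (R * R) := [set p | 0 < p.2].

Definition measR2 := {measure set (R * R)%type -> \bar R}.

Definition leb2 := ((@lebesgue_measure R) \x (@lebesgue_measure R))%E.

Definition betaR (a b : R) : R :=
  fine (\int[@lebesgue_measure R]_(t in `]0%R, 1%R[) (t `^ (a - 1) * (1 - t) `^ (b - 1))%:E)%E.

Definition p_kappa (k : R) : R := 2 * betaR (k + 1) (k + 1).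

Definition zeta (k : R) : R := (2 * k + 2) / (2 * k + 3).

Definition intensity (q k : R) (p : R * R) : R :=
  if 0 < p.2 then q ^+ 2 * p_kappa k * p.2 `^ (2 * k + 1) else 0.

Definition intensity_measure (q k : R) (A : set (R * R)) : \bar R :=
  (\int[leb2]_(p in A) (intensity q k p)%:E)%E.

(** A bijection nat -> int (0, -1, 1, -2, 2, ...) used to enumerate Z. *)
Definition enum_int (k : nat) : int :=
  if odd k then - ((k.+1)./2)%:Z else (k./2)%:Z.

Definition dir (p : nat -> R * R) : {measure set (R * R)%type -> \bar R}^nat :=
  fun k => \d_(p k).
Definition mu_sum (p : nat -> R * R) : measR2 := mseries (dir p) 0.

(** Compactly supported continuous functions on R x (0,oo)
    (extended by 0 to R x R). *)
Definition CcS (f : R * R -> R) : Prop :=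
  continuous f /\
  exists K : set (R * R), [/\ compact K, K `<=` Sp & forall p, ~ K p -> f p = 0].

Definition radonS (nu : measR2) : Prop :=
  forall K : set (R * R), compact K -> K `<=` Sp -> (nu K < +oo)%E.

Definition vint (nu : measR2) (f : R * R -> R) : R := Rintegral nu Sp f.

(** Continuity at nu for the vague topology on the Radon measures on
    R x (0,oo), i.e. the coarsest topology making all the maps
    nu |-> int f dnu (f in C_c) continuous (basic neighbourhoods). *)
Definition vague_cont_at (Phi : measR2 -> R) (nu : measR2) : Prop :=
  forall e : R, 0 < e ->
  exists (m : nat) (fs : nat -> R * R -> R) (delta : R),
    [/\ 0 < delta, forall i, (i < m)%N -> CcS (fs i) &
      forall nu' : measR2, radonS nu' ->
        (forall i, (i < m)%N -> `|vint nu' (fs i) - vint nu (fs i)| < delta) ->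
        `|Phi nu' - Phi nu| < e].

Definition vague_continuous (Phi : measR2 -> R) : Prop :=
  forall nu, radonS nu -> vague_cont_at Phi nu.

Definition conv_in_distribution {d} {Om : measurableType d} (P : probability Om R)
  (mun : nat -> Om -> measR2) {d'} {Om' : measurableType d'}
  (P' : probability Om' R) (mu : Om' -> measR2) : Prop :=
  forall Phi : measR2 -> R,
    (exists M : R, forall nu, `|Phi nu| <= M) ->
    vague_continuous Phi ->
    (forall n, measurable_fun setT (Phi \o mun n)) ->
    measurable_fun setT (Phi \o mu) ->
    (fun n => Rintegral P setT (Phi \o mun n)) @ \oo --> Rintegral P' setT (Phi \o mu).

Definition is_poisson_process {d'} {Om' : measurableType d'} (P' : probability Om' R)
  (mu : Om' -> measR2) (Lam : set (R * R) -> \bar R) : Prop :=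
  [/\ forall w, mu w (~` Sp) = 0%E,
      forall A, measurable A -> measurable_fun setT (fun w => mu w A) &
      forall (m : nat) (A : nat -> set (R * R)) (k : nat -> nat),
        (forall i, (i < m)%N -> [/\ measurable (A i), A i `<=` Sp & (Lam (A i) < +oo)%E]) ->
        (forall i j, (i < m)%N -> (j < m)%N -> i != j -> A i `&` A j = set0) ->
        P' (\bigcap_(i in `I_m) [set w | mu w (A i) = ((k i)%:R)%:E]) =
        (\prod_(i < m) (expR (- fine (Lam (A i))) * fine (Lam (A i)) ^+ k i
                          / ((k i)`!)%:R)%:E)%E].

Definition iid_with_density {d} {Om : measurableType d} (P : probability Om R)
  (F : int -> Om -> R) (rho : R -> R) : Prop :=
  (forall x, measurable_fun setT (F x)) /\
  forall (s : seq int) (B : int -> set R), uniq s -> (forall i, measurable (B i)) ->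
    P (\bigcap_(i in [set` s]) (F i @^-1` B i)) =
    (\prod_(i <- s) \int[@lebesgue_measure R]_(y in B i) (rho y)%:E)%E.

Definition discrepancy {Om : Type} (c : R) (F : int -> Om -> R) (x : int) (w : Om) : R :=
  2 * c - `|F (x + 1)%R w - F x w|.

Definition mu_n {Om : Type} (c k : R) (F : int -> Om -> R) (n : nat) (w : Om) : measR2 :=
  mu_sum (fun j => ((n%:R `^ (- zeta k)) * (enum_int j)%:~R,
                    (n%:R `^ (1 - zeta k)) * discrepancy c F (enum_int j) w)).

End defs.

(* Main.v *)
Require Import Defs.
From HB Require Import structures.
From mathcomp Require Import all_boot all_order all_algebra.
From mathcomp Require Import all_classical all_reals all_analysis.
From mathcomp Require Import measurable_realfun.
From mathcomp Require Import ring lra zify.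
Import Order.TTheory GRing.Theory Num.Theory.
Import numFieldNormedType.Exports.
Local Open Scope classical_set_scope.
Local Open Scope ring_scope.

(** A vaguely continuous functional of a Radon measure on R x (0,oo) is
    determined, up to epsilon, by the masses of the cells of a fine enough grid
    of half-open squares. Sandwiching the functional between its envelopes with
    prescribed cell masses reduces convergence in distribution to convergence
    of the joint law of finitely many integer cell counts.

    The indicators that site x falls into a given cell are 1-dependent in x, and
    two neighbouring sites are simultaneously in the cells with negligible
    probability, so E prod_x (1 - h x) is close to exp (- sum_x E (h x)); with
    h x = sum_i (1 - s i) 1[x in cell i] this is the convergence of the joint
    generating function of the counts to the Poisson one, whose coefficients
    are then recovered one variable at a time by letting s i tend to 0.

    The intensity comes from P (d x < t) ~ q^2 B(k+1,k+1)/(k+1) t^(2k+2): a small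
    discrepancy forces the two values to opposite ends of ]-c, c[, where the
    density behaves like a power, and the convolution of powers is a beta
    integral; there are about n^zeta sites per unit length. *)

Set Implicit Arguments. Unset Strict Implicit. Unset Printing Implicit Defensive.

(** * Bounded expectations *)

(** Vague continuity comes without a rate and only at one measure at a time, and the envelopes are
    infima over uncountably many measures. What makes the sandwich usable is that [mu_n] and, almost
    surely, the limit give every cell an integer mass: an envelope is then a function of a countable
    variable, hence measurable, and its expectation is a series over count vectors. Once [Phi] is
    shifted to be nonnegative, a finite part of this series is a lower bound, so that convergence of
    each single probability yields a liminf inequality; the same inequality for [- Phi] gives the
    limit.

    The exponent [zeta] is the solution of [(1 - zeta) (2k + 2) = zeta]. Blowing discrepancies up by
    [n^(1 - zeta)] thus makes a site reach a given height range with probability of order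
    [n^(- zeta)], the inverse of the number of sites per unit length. The constant [p_kappa] appears
    by differentiation: [B / (k + 1) y^(2k + 2)] has derivative [2 B y^(2k + 1)]. *)

Lemma cvg_sumr {R : realType} (I : Type) (s : seq I) (Q : pred I)
    (u : nat -> I -> R) (v : I -> R) :
  (forall i, u ^~ i @ \oo --> v i) ->
  (fun n => \sum_(i <- s | Q i) u n i) @ \oo --> \sum_(i <- s | Q i) v i.
Proof.
move=> uv; elim: s => [|i s IH].
  by under eq_fun do rewrite big_nil; rewrite big_nil; exact: cvg_cst.
under eq_fun do rewrite big_cons; rewrite big_cons.
by case: (Q i) => //; apply: cvgD.
Qed.

Lemma indicIE {R : realType} {T : Type} (A B : set T) w :
  \1_(A `&` B) w = \1_A w * \1_B w :> R.
Proof. by rewrite indicI. Qed.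

Section bounded_expectation.
Context {R : realType} {d} {Om : measurableType d}.
Implicit Types (P : probability Om R) (f g : Om -> R) (A : set Om).

(** Stands in for integrability: under a probability it implies it and, unlike it, it is stable
    under products. *)
Definition bounded_mfun f := measurable_fun setT f /\ exists M, forall w, `|f w| <= M.

Definition Ex P f : R := Rintegral P setT f.

Lemma bounded_mfun_integrable P f : bounded_mfun f -> P.-integrable setT (EFin \o f).
Proof.
move=> [mf [M fM]]; apply/measurable_bounded_integrable => //.
  by apply: (le_lt_trans (probability_le1 P measurableT)); rewrite ltry.
by exists M; split => [|N MN w _]; [exact: num_real | exact: le_trans (fM w) (ltW MN)].
Qed.

Lemma bounded_mfun_cst r : bounded_mfun (cst r).
Proof. by split; [exact: measurable_cst | exists `|r|]. Qed.

Lemma bounded_mfun_indic A : measurable A -> bounded_mfun (\1_A).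
Proof.
move=> mA; split; first exact: measurable_indic.
by exists 1 => w; rewrite indicE; case: (_ \in _); rewrite ?normr1 ?normr0.
Qed.

Lemma bounded_mfunD f g : bounded_mfun f -> bounded_mfun g -> bounded_mfun (fun w => f w + g w).
Proof.
move=> [mf [M fM]] [mg [N gN]]; split; first exact: measurable_funD.
by exists (M + N) => w; rewrite (le_trans (ler_normD _ _))// lerD.
Qed.

Lemma bounded_mfunM f g : bounded_mfun f -> bounded_mfun g -> bounded_mfun (fun w => f w * g w).
Proof.
move=> [mf [M fM]] [mg [N gN]]; split; first exact: measurable_funM.
by exists (M * N) => w; rewrite normrM ler_pM.
Qed.

Lemma bounded_mfunN f : bounded_mfun f -> bounded_mfun (fun w => - f w).
Proof.
move=> bf; rewrite (_ : (fun _ => _) = (fun w => cst (-1) w * f w)).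
  by apply: bounded_mfunM => //; exact: bounded_mfun_cst.
by apply/funext => w; rewrite mulN1r.
Qed.

Lemma bounded_mfunB f g : bounded_mfun f -> bounded_mfun g -> bounded_mfun (fun w => f w - g w).
Proof. by move=> bf bg; apply: bounded_mfunD => //; exact: bounded_mfunN. Qed.

Lemma bounded_mfun_sum (I : Type) (s : seq I) (Q : pred I) (h : I -> Om -> R) :
  (forall i, Q i -> bounded_mfun (h i)) -> bounded_mfun (fun w => \sum_(i <- s | Q i) h i w).
Proof.
move=> bh; elim: s => [|i s IH].
  by under eq_fun do rewrite big_nil; exact: bounded_mfun_cst.
under eq_fun do rewrite big_cons.
by case Qi: (Q i) => //; apply: bounded_mfunD => //; exact: bh.
Qed.

Lemma bounded_mfun_prod (I : Type) (s : seq I) (Q : pred I) (h : I -> Om -> R) :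
  (forall i, Q i -> bounded_mfun (h i)) -> bounded_mfun (fun w => \prod_(i <- s | Q i) h i w).
Proof.
move=> bh; elim: s => [|i s IH].
  by under eq_fun do rewrite big_nil; exact: bounded_mfun_cst.
under eq_fun do rewrite big_cons.
by case Qi: (Q i) => //; apply: bounded_mfunM => //; exact: bh.
Qed.

Lemma bounded_mfun_normr f : bounded_mfun f -> bounded_mfun (fun w => `|f w|).
Proof.
move=> [mf [M fM]]; split; first exact: measurableT_comp.
by exists M => w; rewrite normr_id.
Qed.

Lemma ExD P f g : bounded_mfun f -> bounded_mfun g -> Ex P (fun w => f w + g w) = Ex P f + Ex P g.
Proof. by move=> bf bg; rewrite /Ex RintegralD//; exact: bounded_mfun_integrable. Qed.

Lemma ExB P f g : bounded_mfun f -> bounded_mfun g -> Ex P (fun w => f w - g w) = Ex P f - Ex P g.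
Proof. by move=> bf bg; rewrite /Ex RintegralB//; exact: bounded_mfun_integrable. Qed.

Lemma ExZ P r f : bounded_mfun f -> Ex P (fun w => r * f w) = r * Ex P f.
Proof. by move=> bf; rewrite /Ex RintegralZl//; exact: bounded_mfun_integrable. Qed.

Lemma Ex_cst P r : Ex P (cst r) = r.
Proof. rewrite /Ex Rintegral_cst//; transitivity (r * fine (1%:E : \bar R)); last by rewrite /= mulr1.
by congr (r * fine _); exact: probability_setT. Qed.

Lemma Ex_indic P A : measurable A -> Ex P (\1_A) = fine (P A).
Proof. by move=> mA; rewrite /Ex /Rintegral integral_indic// setIT. Qed.

Lemma Ex_le P f g : bounded_mfun f -> bounded_mfun g -> (forall w, f w <= g w) -> Ex P f <= Ex P g.
Proof. by move=> bf bg fg; apply: le_Rintegral => //; exact: bounded_mfun_integrable. Qed.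

Lemma Ex_ge0 P f : (forall w, 0 <= f w) -> 0 <= Ex P f.
Proof. by move=> f0; apply: Rintegral_ge0. Qed.

Lemma Ex_normr P f : bounded_mfun f -> `|Ex P f| <= Ex P (fun w => `|f w|).
Proof. by move=> bf; apply: le_normr_Rintegral => //; exact: bounded_mfun_integrable. Qed.

Lemma Ex_sum P (I : Type) (s : seq I) (Q : pred I) (h : I -> Om -> R) :
  (forall i, Q i -> bounded_mfun (h i)) ->
  Ex P (fun w => \sum_(i <- s | Q i) h i w) = \sum_(i <- s | Q i) Ex P (h i).
Proof.
move=> bh; elim: s => [|i s IH].
  by under eq_fun do rewrite big_nil; rewrite big_nil; exact: Ex_cst.
under eq_fun do rewrite big_cons; rewrite big_cons.
by case Qi: (Q i) => //; rewrite ExD ?IH//; [exact: bh | exact: bounded_mfun_sum].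
Qed.

Lemma Ex_sum_indic P (I : Type) (s : seq I) (Q : pred I) (g : I -> R) (A : I -> set Om) :
  (forall i, measurable (A i)) ->
  Ex P (fun w => \sum_(i <- s | Q i) g i * \1_(A i) w) =
  \sum_(i <- s | Q i) g i * fine (P (A i)).
Proof.
move=> mA; rewrite Ex_sum => [|i _].
  by apply: eq_bigr => i _; rewrite ExZ ?Ex_indic//; exact: bounded_mfun_indic.
by apply: bounded_mfunM; [exact: bounded_mfun_cst | exact: bounded_mfun_indic].
Qed.

Lemma Ex_bounded_cvg P (f_ : nat -> Om -> R) f (M : R) :
  (forall n, measurable_fun setT (f_ n)) -> measurable_fun setT f ->
  (forall n w, `|f_ n w| <= M) ->
  {ae P, forall w, f_ ^~ w @ \oo --> f w} ->
  (fun n => Ex P (f_ n)) @ \oo --> Ex P f.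
Proof.
move=> mf_ mf fM cf.
have := @dominated_convergence _ _ R P setT measurableT (fun n => EFin \o f_ n) (EFin \o f) (cst M%:E).
case.
- by move=> n; apply/measurable_EFinP.
- exact/measurable_EFinP.
- by apply: filterS cf => w cw _; apply: cvg_EFin => //; exact: nearW.
- exact: (@bounded_mfun_integrable P _ (bounded_mfun_cst M)).
- by apply: aeW => w n _; rewrite /= lee_fin fM.
move=> fi _ h.
rewrite /Ex /Rintegral.
apply: fine_cvg; rewrite fineK//; exact: integrable_fin_num fi.
Qed.

Lemma fineP_le P A B : measurable A -> measurable B -> A `<=` B -> fine (P A) <= fine (P B).
Proof.
move=> mA mB AB; apply: fine_le; rewrite ?fin_num_measure//.
by apply: le_measure; rewrite ?inE.
Qed.

End bounded_expectation.

(** * Grids and vague continuity *)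

Section grid.
Context {R : realType}.
Implicit Types (m l : nat) (p : R * R) (f : R * R -> R) (nu : @measR2 R).

Definition rect (a b y z : R) : set (R * R) := `[a, b[ `*` `[y, z[.

Lemma rectE a b y z p : rect a b y z p = (a <= p.1 < b /\ y <= p.2 < z) :> Prop.
Proof. by rewrite /rect /setX/= !in_itv. Qed.

Lemma measurable_rect a b y z : measurable (rect a b y z).
Proof. exact: measurableX. Qed.

(* Cell [l] is the square of side [1/(m+1)] in row [l %% (m+1)^2] and column
   [l %/ (m+1)^2]; the cells with [l < gridn m] tile a region containing [box m]. *)
Definition gridn m : nat := (2 * (m.+1 ^ 2) * m.+1 ^ 2)%N.
Definition grid1 m l : R := ((l %/ m.+1 ^ 2)%:R - (m.+1 ^ 2)%:R) / m.+1%:R.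
Definition grid2 m l : R := ((l %% m.+1 ^ 2)%:R + 1) / m.+1%:R.
Definition grid m l : set (R * R) :=
  rect (grid1 m l) (grid1 m l + m.+1%:R^-1) (grid2 m l) (grid2 m l + m.+1%:R^-1).

Lemma measurable_grid m l : measurable (grid m l).
Proof. exact: measurable_rect. Qed.

(** After multiplication by [m.+1] and a shift, the row and column of a cell are the integer parts
    of the two coordinates. Disjointness and covering thus become uniqueness and existence of
    integer parts. The shift [- 1] keeps the lowest row at distance [1 / m.+1] from the removed
    axis. *)
Lemma gridP m l p : grid m l p <->
  ((l %/ m.+1 ^ 2)%:R <= m.+1%:R * p.1 + (m.+1 ^ 2)%:R < (l %/ m.+1 ^ 2).+1%:R /\
   (l %% m.+1 ^ 2)%:R <= m.+1%:R * p.2 - 1 < (l %% m.+1 ^ 2).+1%:R).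
Proof.
have s0 : 0 < m.+1%:R :> R by rewrite ltr0n.
have s00 : m.+1%:R != 0 :> R by rewrite gt_eqF.
rewrite /grid rectE.
have -> : grid1 m l + m.+1%:R^-1 = ((l %/ m.+1 ^ 2).+1%:R - (m.+1 ^ 2)%:R) / m.+1%:R.
  by rewrite /grid1 -[(l %/ _).+1%:R]natr1; field.
have -> : grid2 m l + m.+1%:R^-1 = ((l %% m.+1 ^ 2).+1%:R + 1) / m.+1%:R.
  by rewrite /grid2 -[(l %% _).+1%:R]natr1; field.
rewrite /grid1 /grid2 !ler_pdivrMr// !ltr_pdivlMr// ![_ * m.+1%:R]mulrC.
by split=> -[/andP[? ?] /andP[? ?]]; split; apply/andP; split; lra.
Qed.

Lemma grid_pos m l : 0 < grid2 m l.
Proof. by rewrite /grid2 divr_gt0// ltr0n. Qed.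

Lemma grid_Sp m l : grid m l `<=` Sp.
Proof.
move=> p; rewrite /grid rectE => -[_ /andP[+ _]].
exact/lt_le_trans/grid_pos.
Qed.

Lemma grid_inj m l l' p : grid m l p -> grid m l' p -> l = l'.
Proof.
move=> /gridP[/andP[a1 a2] /andP[b1 b2]] /gridP[/andP[c1 c2] /andP[d1 d2]].
have E (u v : nat) (x : R) : u%:R <= x -> x < u.+1%:R -> v%:R <= x -> x < v.+1%:R -> u = v.
  move=> h1 h2 h3 h4.
  have := le_lt_trans h1 h4; have := le_lt_trans h3 h2.
  by rewrite !ltr_nat !ltnS => uv vu; apply/eqP; rewrite eqn_leq uv vu.
rewrite (divn_eq l (m.+1 ^ 2)) (divn_eq l' (m.+1 ^ 2)).
by rewrite (E _ _ _ a1 a2 c1 c2) (E _ _ _ b1 b2 d1 d2).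
Qed.

Lemma grid_disj m l l' : l != l' -> grid m l `&` grid m l' = set0.
Proof.
by move=> ll'; rewrite -subset0 => p [h1 h2]; move: ll'; rewrite (grid_inj h1 h2) eqxx.
Qed.

(** An exhaustion of the open half-plane: a compact subset stays bounded and away from the axis,
    hence lies in some [box m]. *)
Definition box m : set (R * R) :=
  rect (- m.+1%:R) m.+1%:R m.+1%:R^-1 m.+1%:R.

Lemma box_grid m p : box m p -> exists2 l, (l < gridn m)%N & grid m l p.
Proof.
rewrite /box rectE => -[/andP[a1 a2] /andP[b1 b2]].
have s0 : 0 < m.+1%:R :> R by rewrite ltr0n.
have h1 : 0 <= m.+1%:R * p.1 + (m.+1 ^ 2)%:R.
  by rewrite natrX expr2 -mulrDr mulr_ge0 ?(ltW s0)// -lerBlDr sub0r.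
have h2 : 0 <= m.+1%:R * p.2 - 1.
  by rewrite subr_ge0 -ler_pdivrMl// mulr1.
have /andP[u1 u2] := truncn_itv h1; have /andP[v1 v2] := truncn_itv h2.
set u := Num.truncn _ in u1 u2; set v := Num.truncn _ in v1 v2.
have ult : (u < 2 * m.+1 ^ 2)%N.
  rewrite -(ltr_nat R); apply: le_lt_trans u1 _.
  rewrite mul2n -addnn natrD ltrD2r natrX expr2 ltr_pM2l//.
have vlt : (v < m.+1 ^ 2)%N.
  rewrite -(ltr_nat R); apply: le_lt_trans v1 _.
  rewrite natrX expr2 ltrBlDr (lt_trans (y := m.+1%:R * m.+1%:R))// ?ltr_pM2l//.
  by rewrite ltrDl.
exists (u * m.+1 ^ 2 + v)%N.
  rewrite /gridn; apply: (@leq_trans ((u.+1) * m.+1 ^ 2)%N).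
    by rewrite mulSn addnC ltn_add2r.
  by rewrite leq_mul2r ult orbT.
apply/gridP; rewrite divnMDl ?expn_gt0// modnMDl (divn_small vlt) (modn_small vlt) addn0.
by rewrite u1 u2 v1 v2.
Qed.

(** The top row ends at height [m.+1 + 1 / m.+1], above [box m]; hence the next box. *)
Lemma grid_box m l : (l < gridn m)%N -> grid m l `<=` box m.+1.
Proof.
move=> lm p; rewrite /grid /box !rectE /grid1 /grid2.
have s0 : 0 < m.+1%:R :> R by rewrite ltr0n.
set q := (m.+1 ^ 2)%N; set u := (l %/ q)%N; set v := (l %% q)%N.
have q0 : (0 < q)%N by rewrite expn_gt0.
have hu : u.+1%:R <= 2 * q%:R :> R.
  by rewrite -natrM ler_nat ltn_divLR// lm.
have hv : v.+1%:R <= q%:R :> R by rewrite ler_nat ltn_mod.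
have qE : q%:R = m.+1%:R * m.+1%:R :> R by rewrite natrX expr2.
move: s0 hu hv qE; rewrite -[u.+1%:R]natr1 -[v.+1%:R]natr1 -[m.+2%:R]natr1.
have uu0 : 0 <= u%:R :> R by []. have vv0 : 0 <= v%:R :> R by [].
have s1 : 1 <= m.+1%:R :> R by rewrite ler1n.
move: (q%:R : R) (u%:R : R) (v%:R : R) (m.+1%:R : R) uu0 vv0 s1 => qq uu vv s uu0 vv0 s1.
move=> s0 hu hv qE [/andP[a1 a2] /andP[b1 b2]].
have E1 : uu / s + s^-1 <= 2 * s.
  rewrite -[X in _ + X]mul1r -mulrDl ler_pdivrMr//; nra.
have E2 : vv / s + s^-1 <= s.
  rewrite -[X in _ + X]mul1r -mulrDl ler_pdivrMr//; nra.
have E3 : (s + 1)^-1 < s^-1 by rewrite ltf_pV2 ?posrE//; lra.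
have E4 : s^-1 <= 1 by rewrite invf_le1.
have E5 : qq / s = s by rewrite qE mulfK// gt_eqF.
have E6 : 0 <= vv / s by rewrite divr_ge0// ltW.
have E7 : 0 <= uu / s by rewrite divr_ge0// ltW.
move: a1 a2 b1 b2; rewrite !mulrDl mulNr E5 mul1r => a1 a2 b1 b2.
by split; apply/andP; split; lra.
Qed.

Lemma ballR2 (p p' : R * R) (e : R) : ball p e p' <->
  (p'.1 - e < p.1 < p'.1 + e /\ p'.2 - e < p.2 < p'.2 + e).
Proof. by rewrite /ball/= /prod_ball /ball/= !ltr_distl. Qed.

Lemma box_near p : 0 < p.2 -> \forall p' \near p & n \near \oo, box n p'.
Proof.
move=> p0; have e0 : 0 < p.2 / 2 by rewrite divr_gt0.
exists (ball p (p.2 / 2), [set n | `|p.1| + p.2 * 2 < n.+1%:R /\ (p.2 / 2)^-1 < n.+1%:R]).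
  split => /=; first exact: nbhsx_ballx.
  exists (Num.truncn (`|p.1| + p.2 * 2) + Num.truncn (p.2 / 2)^-1)%N => // n /= nn.
  by split; apply: lt_le_trans (truncnS_gt _) _; rewrite ler_nat ltnS (leq_trans _ nn)// ?leq_addr ?leq_addl.
move=> [p' n] /= [[b1 b2] [n1 n2]].
move: b1 b2; rewrite /ball/= !ltr_norml => /andP[b1 b2] /andP[b3 b4].
rewrite /box rectE.
have h1 : n.+1%:R^-1 < p.2 / 2.
  by rewrite -[ltRHS]invrK ltf_pV2 ?posrE ?invr_gt0// ltr0n.
have := ler_norm p.1; have := ler_norm (- p.1); rewrite normrN.
by move: h1 n1 b1 b2 b3 b4; move: (n.+1%:R : R) => N *; split; apply/andP; split; lra.
Qed.

Lemma compact_box (K : set (R * R)) : compact K -> K `<=` Sp ->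
  \forall n \near \oo, K `<=` box n.
Proof.
by move=> /compact_near_coveringP cK KS; apply: cK => p /KS; exact: box_near.
Qed.

(** Uniform continuity on the whole plane: pairs that meet [K] are controlled by compactness, after
    a swap if only the second point lies in [K]; for all other pairs both values vanish. *)
Lemma CcS_unif f : CcS f -> forall e : R, 0 < e -> exists2 d : R, 0 < d &
  forall p p', ball p d p' -> `|f p - f p'| < e.
Proof.
move=> [cf [K [/compact_near_coveringP cK KS fK]]] e e0.
have : \forall d \near (0 : R)^'+, K `<=` [set p | forall p', ball p d p' -> `|f p - f p'| < e].
  apply: cK => x Kx.
  have /cvgrPdist_lt /(_ (e / 2)) := cf x; rewrite divr_gt0// => /(_ erefl).
  move=> /nbhs_ballP[r /= r0 rf].
  exists (ball x (r / 2), [set d | d < r / 2]).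
    split; first by apply: nbhsx_ballx; rewrite divr_gt0.
    by apply: nbhs_right_lt; rewrite divr_gt0.
  move=> [y d] /= [xy dr] p' yp'.
  have h1 : `|f x - f y| < e / 2 by apply: rf; apply: le_ball xy; lra.
  have h2 : `|f x - f p'| < e / 2.
    by apply: rf; rewrite [r]splitr; apply: ball_triangle xy _; exact: le_ball (ltW dr) _ yp'.
  rewrite (_ : f y - f p' = (f x - f p') - (f x - f y)); last by ring.
  by rewrite (le_lt_trans (ler_normB _ _))// [e]splitr ltrD.
move=> [d /= d0 dP]; exists (d / 2); first by rewrite divr_gt0.
have {}dP : K `<=` [set p | forall p', ball p (d / 2) p' -> `|f p - f p'| < e].
  by apply: dP => /=; rewrite ?divr_gt0// sub0r normrN gtr0_norm ?divr_gt0//; lra.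
move=> p p' pp'.
have [/dP/(_ p' pp')//|nK] := pselect (K p).
have [/dP/(_ p (ball_sym pp'))|nK'] := pselect (K p'); first by rewrite distrC.
by rewrite !fK// subrr normr0.
Qed.

(** The plane carries the product sigma-algebra, so open sets need an argument: each is the union of
    the half-open squares it contains whose corners are multiples of some [1 / n.+1], and these
    squares are countably many. *)
Lemma measurable_open (A : set (R * R)) : open A -> measurable A.
Proof.
move=> oA.
pose C (x : nat * int * int) : set (R * R) := 
  rect (x.1.2%:~R / x.1.1.+1%:R) ((x.1.2 + 1)%:~R / x.1.1.+1%:R) (x.2%:~R / x.1.1.+1%:R) ((x.2 + 1)%:~R / x.1.1.+1%:R).
have -> : A = \bigcup_(x in [set: nat * int * int]) (if `[< C x `<=` A >] then C x else set0).
  apply/seteqP; split => [p Ap|p [x _]]; last by case: asboolP => // + Cp; exact.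
  have /nbhs_ballP[r /= r0 rA] : nbhs p A by apply: open_nbhs_nbhs.
  pose n := Num.truncn r^-1.
  have s0 : 0 < n.+1%:R :> R by rewrite ltr0n.
  have nr : n.+1%:R^-1 < r.
    rewrite -[ltRHS]invrK ltf_pV2 ?posrE ?invr_gt0//.
    exact: truncnS_gt.
  exists (n, Num.floor (n.+1%:R * p.1), Num.floor (n.+1%:R * p.2)) => //.
  have Cp : C (n, Num.floor (n.+1%:R * p.1), Num.floor (n.+1%:R * p.2)) p.
    rewrite /C rectE/= !ler_pdivrMr// !ltr_pdivlMr// ![_ * n.+1%:R]mulrC.
    by rewrite !floor_itv.
  case: asboolP => // -[] p' Cp'; apply: rA.
  move: Cp Cp' nr; rewrite /C !rectE/= !rmorphD/= !mulrDl !mul1r.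
  move=> h1 h2 h3; apply/ballR2; move: h1 h2 h3.
  move: (n.+1%:R^-1) => w [/andP[? ?] /andP[? ?]] [/andP[? ?] /andP[? ?]] ?.
  by split; apply/andP; split; lra.
apply: countable_bigcupT_measurable; first exact: countableP.
by move=> x; case: ifP => // _; exact: measurable_rect.
Qed.

Lemma hausdorff_R2 : hausdorff_space (R * R)%type.
Proof.
rewrite ball_hausdorff => -[a1 a2] [b1 b2] ab.
have d0 : 0 < Num.max `|a1 - b1| `|a2 - b2|.
  rewrite lt_max !normr_gt0 !subr_eq0 -negb_and; apply: contra ab.
  by move=> /andP[/eqP-> /eqP->].
have e0 : 0 < Num.max `|a1 - b1| `|a2 - b2| / 2 by rewrite divr_gt0.
exists (PosNum e0, PosNum e0); apply/eqP; rewrite -subset0 => -[x1 x2] /=.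
rewrite /ball/= /prod_ball/= /ball/= => -[[h1 h2] [h3 h4]].
have : Num.max `|a1 - b1| `|a2 - b2| < Num.max `|a1 - b1| `|a2 - b2|.
  rewrite {1}gt_max; apply/andP; split.
    rewrite [ltLHS](_ : _ = `|(a1 - x1) - (b1 - x1)|); last by congr `|_|; ring.
    by rewrite (le_lt_trans (ler_normB _ _))// [ltRHS]splitr ltrD.
  rewrite [ltLHS](_ : _ = `|(a2 - x2) - (b2 - x2)|); last by congr `|_|; ring.
  by rewrite (le_lt_trans (ler_normB _ _))// [ltRHS]splitr ltrD.
by rewrite ltxx.
Qed.

Lemma measurable_compact (K : set (R * R)) : compact K -> measurable K.
Proof.
move=> cK; rewrite -[K]setCK; apply: measurableC; apply: measurable_open.
apply: closed_openC; apply: compact_closed cK; exact: hausdorff_R2.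
Qed.

Lemma measurable_continuous f : continuous f -> measurable_fun setT f.
Proof.
move=> cf; apply: (measurability _ (RGenOpens.measurableE R)).
move=> _ [_ [x [y ->]] <-]; rewrite setTI; apply: measurable_open.
by apply: open_comp => [z _|]; [exact: cf | exact: interval_open].
Qed.

Lemma Rintegral_near_cst nu (A : set (R * R)) f (c e : R) :
  measurable A -> measurable_fun A f -> (nu A < +oo)%E ->
  (forall p, A p -> `|f p - c| <= e) ->
  nu.-integrable A (EFin \o f) /\
  `|Rintegral nu A f - c * fine (nu A)| <= e * fine (nu A).
Proof.
move=> mA mf Aoo fce.
have icst (r : R) : nu.-integrable A (EFin \o cst r).
  by apply/measurable_bounded_integrable => //; apply: bounded_cst.
have fi : nu.-integrable A (EFin \o f).
  apply/measurable_bounded_integrable => //.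
  exists (`|c| + e); split; first exact: num_real.
  move=> M M1 p Ap /=; rewrite (le_trans _ (ltW M1))//.
  rewrite [f p](_ : _ = c + (f p - c)); last by ring.
  by rewrite (le_trans (ler_normD _ _))// lerD2l fce.
split => //.
rewrite -[c * _](Rintegral_cst nu mA) -RintegralB//; last exact: icst.
apply: (le_trans (le_normr_Rintegral mA _)).
  by have := integrableB mA fi (icst c); apply: eq_integrable.
rewrite -[leRHS](Rintegral_cst nu mA); apply: le_Rintegral => //; last exact: icst.
by have := integrable_norm (integrableB mA fi (icst c)); apply: eq_integrable.
Qed.

Lemma radonS_box nu m : radonS nu -> (nu (box m) < +oo)%E.
Proof.
move=> rnu; have s0 : 0 < m.+1%:R :> R by rewrite ltr0n.
set K := `[- m.+1%:R, m.+1%:R] `*` `[m.+1%:R^-1, m.+1%:R] : set (R * R).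
apply: (@le_lt_trans _ _ (nu K)).
  apply: le_measure; rewrite ?inE; [exact: measurable_rect|exact: measurableX|].
  by move=> p; rewrite /box rectE /K/= !in_itv/= => -[/andP[-> /ltW->] /andP[-> /ltW->]].
apply: rnu; first by apply: compact_setX; exact: segment_compact.
move=> p [_] /=; rewrite in_itv/= => /andP[+ _]; apply: lt_le_trans.
by rewrite invr_gt0.
Qed.

Lemma radonS_grid nu m l : radonS nu -> (l < gridn m)%N -> (nu (grid m l) < +oo)%E.
Proof.
move=> rnu lm; apply: le_lt_trans (radonS_box m.+1 rnu).
by apply: le_measure; rewrite ?inE; [exact: measurable_grid|exact: measurable_rect|exact: grid_box].
Qed.

Lemma trivIset_grid m (D : set nat) : trivIset D (grid m).
Proof. by move=> i j _ _ [p [h1 h2]]; exact: grid_inj h1 h2. Qed.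

Lemma sum_grid_le nu m n (Q : pred nat) (B : set (R * R)) : radonS nu ->
  (n <= gridn m)%N -> measurable B -> (nu B < +oo)%E ->
  (forall l, (l < n)%N -> Q l -> grid m l `<=` B) ->
  \sum_(l < n | Q l) fine (nu (grid m l)) <= fine (nu B).
Proof.
move=> rnu nm mB Boo QB.
rewrite -lee_fin fineK ?ge0_fin_numE// -sumEFin.
rewrite (eq_bigr (fun l : 'I_n => nu (grid m l))); last first.
  move=> l _; rewrite fineK// ge0_fin_numE// radonS_grid//.
  exact: leq_trans (ltn_ord l) nm.
rewrite -(measure_bigsetU_ord_cond nu); last 2 first.
- by move=> *; exact: measurable_grid.
- by move=> i j _ _ [p [h1 h2]]; apply/val_inj; exact: grid_inj h1 h2.
apply: le_measure; rewrite ?inE//.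
  by apply: bigsetU_measurable => *; exact: measurable_grid.
by elim/big_ind: _ => // [A1 A2 h1 h2 p [/h1|/h2]//|l Ql]; exact: QB.
Qed.

(** The support lies in [box m], which the cells cover, so the integral splits exactly. The
    constants [c l] and [e] bound [f] on each cell and thereby give integrability there. *)
Lemma vint_grid nu f m (c : nat -> R) (e : R) (K : set (R * R)) :
  radonS nu -> continuous f -> (forall p, ~ K p -> f p = 0) -> K `<=` box m ->
  (forall l p, (l < gridn m)%N -> grid m l p -> `|f p - c l| <= e) ->
  vint nu f = \sum_(l < gridn m) Rintegral nu (grid m l) f.
Proof.
move=> rnu cf fK Km fc.
have mf D : measurable_fun D f by apply: measurable_funTS; exact: measurable_continuous.
rewrite /vint /Rintegral.
have -> : (\int[nu]_(p in Sp) (f p)%:E = \int[nu]_(p in \big[setU/set0]_(l <- iota 0 (gridn m)) grid m l) (f p)%:E)%E.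
  rewrite integral_mkcond [RHS]integral_mkcond; apply: eq_integral => p _.
  rewrite /patch; case: ifPn => [|] pS; case: ifPn => [|] pU //.
  - rewrite fK// => /Km/box_grid[l lm lp]; move/negP: pU; apply; rewrite inE.
    by rewrite -bigcup_seq; exists l; rewrite // /mkset mem_iota add0n.
  - move: pS; rewrite notin_setE => pS; exfalso; apply: pS.
    move: pU; rewrite inE -bigcup_seq => -[l _]; exact: grid_Sp.
rewrite integral_bigsetU_EFin//; last 4 first.
- by move=> *; exact: measurable_grid.
- exact: iota_uniq.
- exact: trivIset_grid.
- by apply/measurable_EFinP.
rewrite -(big_mkord xpredT (fun l => fine (\int[nu]_(x in grid m l) (f x)%:E)%E)) /index_iota subn0.
rewrite big_seq [RHS]big_seq sum_fine// => l; rewrite mem_iota => /= lm.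
apply: integrable_fin_num; first exact: measurable_grid.
by have [] := @Rintegral_near_cst nu (grid m l) f (c l) e (measurable_grid m l) (mf _) (radonS_grid rnu lm) (fun p => @fc l p lm).
Qed.

(** On each cell both integrals are close to a value of [f] times the same mass. The total error is
    twice the oscillation of [f] times the [nu]-mass of the cells that meet the support; this mass
    is bounded independently of [m], so [m] can be chosen before [nu']. *)
Lemma vague_grid nu f : radonS nu -> CcS f -> forall e : R, 0 < e -> \forall m \near \oo,
  forall nu', radonS nu' ->
    (forall l, (l < gridn m)%N -> nu' (grid m l) = nu (grid m l)) ->
    `|vint nu' f - vint nu f| < e.
Proof.
move=> rnu Cf e e0; have [cf [K [cK KS fK]]] := Cf.
have [L _ /(_ L (leqnn _)) KL] := compact_box cK KS.
set B := fine (nu (box L.+1)).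
have B0 : 0 <= B by exact: fine_ge0.
(* The oscillation allowed per cell: [2 * h * B < e], the added 1 giving strictness and covering
   [B = 0]. *)
pose h : R := e / (2 * (B + 1)).
have h0 : 0 < h by rewrite divr_gt0// mulr_gt0//; lra.
have [d d0 fd] := CcS_unif Cf h0.
near=> m => nu' rnu' nn'.
have Km : K `<=` box m.
  by near: m; exact: compact_box.
have md : m.+1%:R^-1 < d by near: m; exact: near_infty_natSinv_lt (PosNum d0).
(* A cell of side at most [1 / (L+2)^2] that meets [box L] stays in [box L.+1]; the binding margin
   is the one towards the axis, [1 / (L+1) - 1 / (L+2)]. *)
have mL : (L.+2 * L.+2 <= m)%N by near: m; exact: nbhs_infty_ge.
have s0 : 0 < m.+1%:R :> R by rewrite ltr0n.
pose co l : R * R := (grid1 m l, grid2 m l).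
have gco l p : grid m l p -> ball (co l) m.+1%:R^-1 p.
  move=> lp; apply/ballR2; move: lp s0; rewrite /grid rectE /co/= -invr_gt0.
  move: (m.+1%:R^-1) => w [/andP[? ?] /andP[? ?]] ?; split; apply/andP; split; lra.
have gcl l : grid m l (co l).
  by rewrite /grid rectE/= !lexx !ltrDl invr_gt0 s0.
have fc l p : (l < gridn m)%N -> grid m l p -> `|f p - f (co l)| <= h.
  move=> _ /gco/(le_ball (ltW md))/fd; rewrite distrC; exact: ltW.
have mf D : measurable_fun D f by apply: measurable_funTS; exact: measurable_continuous.
rewrite (vint_grid rnu cf fK Km fc) (vint_grid rnu' cf fK Km fc) -sumrB.
(* Restricting to cells that meet [K] keeps the total mass below [B]; the mass of the whole grid may
   grow with [m]. *)
pose Q l := `[< exists2 p, grid m l p & K p >].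
apply: (@le_lt_trans _ _ (\sum_(l < gridn m | Q l) (2 * h) * fine (nu (grid m l)))).
  rewrite [leRHS]big_mkcond/=; apply: (le_trans (ler_norm_sum _ _ _)); apply: ler_sum => l _.
  have [_ n1] := @Rintegral_near_cst nu _ f (f (co l)) h (measurable_grid m l) (mf _) (radonS_grid rnu (ltn_ord l)) (fun p => @fc l p (ltn_ord l)).
  have [_ n2] := @Rintegral_near_cst nu' _ f (f (co l)) h (measurable_grid m l) (mf _) (radonS_grid rnu' (ltn_ord l)) (fun p => @fc l p (ltn_ord l)).
  move: n2; rewrite nn'// => n2.
  case: ifPn => Ql.
    set u := Rintegral nu' _ _ in n2 *; set v := Rintegral nu _ _ in n1 *; set w := f _ * _ in n1 n2 *.
    rewrite (_ : u - v = (u - w) - (v - w)); last by ring.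
    by rewrite (le_trans (ler_normB _ _))// -mulrA mulr_natl mulr2n lerD.
  have f0 p : grid m l p -> f p = 0.
    move=> lp; apply: fK => Kp; move/asboolP: Ql; apply; by exists p.
  rewrite {1}/Rintegral {1}/Rintegral !integral0_eq ?subrr ?normr0// => p /f0 -> //.
rewrite -mulr_sumr.
have := @sum_grid_le nu m (gridn m) Q (box L.+1) rnu (leqnn _) (measurable_rect _ _ _ _) (radonS_box L.+1 rnu).
have QB l : (l < gridn m)%N -> Q l -> grid m l `<=` box L.+1.
  move=> lm /asboolP[p' lp' /KL Bp'] p lp; move: lp lp' Bp'; rewrite /grid /box !rectE.
  have l0 : 0 < L.+1%:R :> R by rewrite ltr0n.
  have m1 : m.+1%:R^-1 <= (L.+2%:R * L.+2%:R)^-1 :> R.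
    by rewrite lef_pV2 ?posrE// ?mulr_gt0// -natrM ler_nat ltnW.
  have l1 : L.+2%:R^-1 + (L.+2%:R * L.+2%:R)^-1 <= L.+1%:R^-1 :> R.
    rewrite -[L.+2%:R]natr1; move: (L.+1%:R : R) l0 => u u0.
    rewrite -subr_ge0 (_ : _ - _ = (u * (u + 1) ^+ 2)^-1).
      by rewrite invr_ge0 mulr_ge0 ?sqr_ge0// ltW.
    by field; rewrite !gt_eqF//; lra.
  have m2 : m.+1%:R^-1 <= 1 :> R by rewrite invf_le1// ler1n.
  move: l1 m1 m2; rewrite -[L.+2%:R]natr1; move: (m.+1%:R^-1 : R) (L.+1%:R : R) l0 => v u u0.
  move: (u^-1) ((u + 1)^-1) ((_ * _)^-1) => iu iu1 iuu l1 m1 m2.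
  by move=> [/andP[? ?] /andP[? ?]] [/andP[? ?] /andP[? ?]] [/andP[? ?] /andP[? ?]]; split; apply/andP; split; lra.
move=> /(_ QB); rewrite -/B => sB.
have -> : e = 2 * h * (B + 1) by rewrite /h; field; rewrite gt_eqF//; lra.
have hh : 0 < 2 * h by rewrite mulr_gt0.
by rewrite (ltr_pM2l hh); apply: (le_lt_trans sB); rewrite ltrDl.
Unshelve. all: by end_near. Qed.

End grid.

(** * Reduction to cell counts *)

Section reduction.
Context {R : realType}.
Implicit Types (Phi : @measR2 R -> R) (nu : @measR2 R) (m : nat).

(* The infimum ranges over a nonempty set only for realizable masses; it is the
   junk value [0] otherwise. *)
Definition lower_env Phi m (c : nat -> \bar R) : R :=
  inf [set Phi nu' | nu' in [set nu' | radonS nu' /\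
    forall l, (l < gridn m)%N -> nu' (grid m l) = c l]].

Lemma lower_env_le Phi (B : R) m nu : (forall nu', `|Phi nu'| <= B) -> radonS nu ->
  lower_env Phi m (fun l => nu (grid m l)) <= Phi nu.
Proof.
move=> PB rnu; apply: ge_inf; last by exists nu.
by exists (- B) => _ [nu' _ <-]; have := PB nu'; rewrite ler_norml => /andP[].
Qed.

Lemma lower_env_bound Phi (B : R) m c : 0 <= B -> (forall nu', `|Phi nu'| <= B) ->
  `|lower_env Phi m c| <= B.
Proof.
move=> B0 PB; rewrite /lower_env; set S := [set _ | _ in _].
have [/nonemptyPn->|] := pselect (~ (S !=set0)); first by rewrite inf0 normr0.
move=> /contrapT S0; have hS : has_inf S.
  split=> //; exists (- B) => _ [nu' _ <-]; have := PB nu'; rewrite ler_norml => /andP[] //.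
rewrite ler_norml; apply/andP; split.
  by apply: lb_le_inf => // _ [nu' _ <-]; have := PB nu'; rewrite ler_norml => /andP[].
have [x [nu' h xE]] := S0; apply: (@le_trans _ _ x).
  by apply: ge_inf; [case: hS | exists nu'].
by rewrite -xE; have := PB nu'; rewrite ler_norml => /andP[].
Qed.

Lemma eq_lower_env Phi m c c' : (forall l, (l < gridn m)%N -> c l = c' l) ->
  lower_env Phi m c = lower_env Phi m c'.
Proof.
move=> E; congr (inf _); apply/seteqP; split => _ [x [rx hx] <-]; exists x => //; split => // l lm.
  by rewrite hx// E.
by rewrite hx// E.
Qed.

(** Continuity at [nu] involves finitely many test functions, and a fine grid controls all of them
    at once. Every competitor in the infimum then has a value of [Phi] within [e] of [Phi nu]. *)
Lemma lower_env_cvg Phi nu : vague_continuous Phi -> radonS nu ->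
  (forall m, lower_env Phi m (fun l => nu (grid m l)) <= Phi nu) ->
  (fun m => lower_env Phi m (fun l => nu (grid m l))) @ \oo --> Phi nu.
Proof.
move=> cPhi rnu h1; apply/cvgrPdist_le => e e0.
have [N [fs [delta [d0 Cfs H]]]] := cPhi nu rnu e e0.
have near_fs : \forall m \near \oo, forall i : 'I_N, forall nu', radonS nu' ->
    (forall l, (l < gridn m)%N -> nu' (grid m l) = nu (grid m l)) ->
    `|vint nu' (fs i) - vint nu (fs i)| < delta.
  by apply: filter_forall => i; apply: vague_grid => //; exact: Cfs.
apply: filterS near_fs => m Hm.
rewrite ger0_norm ?subr_ge0// lerBlDr -lerBlDl.
apply: lb_le_inf; first by exists (Phi nu); exists nu.
move=> _ [nu' [rnu' E] <-].
have : `|Phi nu' - Phi nu| < e.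
  by apply: H => // i iN; exact: (Hm (Ordinal iN)).
by rewrite ltr_norml => /andP[+ _]; lra.
Qed.

Definition matches m nu (ka : nat -> nat) :=
  forall l, (l < gridn m)%N -> nu (grid m l) = (ka l)%:R%:E.

(** Count vectors with entries below [b] form a finite type, over which sums are finite; this reads
    such a vector as a function on all indices. *)
Definition extn n b (ka : {ffun 'I_n -> 'I_b}) (l : nat) : nat :=
  if insub l is Some i then ka i : nat else 0%N.

(** Written as the same intersection as in [is_poisson_process], which therefore applies to it
    literally. *)
Definition cyl {d} {Om : measurableType d} (nu : Om -> @measR2 R) m (ka : nat -> nat) : set Om :=
  \bigcap_(i in `I_(gridn m)) [set w | nu w (grid m i) = ((ka i)%:R)%:E].

Lemma cylE {d} {Om : measurableType d} (nu : Om -> @measR2 R) m ka w :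
  cyl nu m ka w <-> matches m (nu w) ka.
Proof. by split => h l; exact: h. Qed.

Lemma measurable_cyl {d} {Om : measurableType d} (nu : Om -> @measR2 R) m ka :
  (forall l, measurable_fun setT (fun w => nu w (grid m l))) -> measurable (cyl nu m ka).
Proof.
move=> mnu; apply: fin_bigcap_measurable => // i _.
have := mnu i measurableT _ (emeasurable_set1 ((ka i)%:R%:E)).
by rewrite setTI.
Qed.

Lemma extn_inj m nu b (ka ka' : {ffun 'I_(gridn m) -> 'I_b}) :
  matches m nu (extn ka) -> matches m nu (extn ka') -> ka = ka'.
Proof.
move=> h h'; apply/ffunP => i; have := h _ (ltn_ord i); rewrite (h' _ (ltn_ord i)).
rewrite /extn valK => -[] /eqP; rewrite eqr_nat => /eqP E; exact/val_inj/esym.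
Qed.

Lemma extn_ex m nu b ka : matches m nu ka -> (forall l, (l < gridn m)%N -> (ka l < b)%N) ->
  exists ka' : {ffun 'I_(gridn m) -> 'I_b}, matches m nu (extn ka').
Proof.
move=> h kb; exists [ffun i : 'I_(gridn m) => Ordinal (kb _ (ltn_ord i))].
by move=> l lm; rewrite h// /extn insubT ffunE.
Qed.

Lemma sum_matches m b (g : {ffun 'I_(gridn m) -> 'I_b} -> R) {d} {Om : measurableType d}
   (nu : Om -> @measR2 R) w ka :
  matches m (nu w) (extn ka) ->
  \sum_k g k * \1_(cyl nu m (extn k)) w = g ka.
Proof.
move=> h; rewrite (bigD1 ka)//= big1 ?addr0 => [|k kka].
  by rewrite indicE mem_set ?mulr1//; exact/cylE.
rewrite indicE memNset ?mulr0// => /cylE h'.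
by move: kka; rewrite (extn_inj h' h) eqxx.
Qed.

Lemma sum_matches0 m b (g : {ffun 'I_(gridn m) -> 'I_b} -> R) {d} {Om : measurableType d}
   (nu : Om -> @measR2 R) w :
  (forall ka : {ffun 'I_(gridn m) -> 'I_b}, ~ matches m (nu w) (extn ka)) ->
  \sum_k g k * \1_(cyl nu m (extn k)) w = 0.
Proof.
by move=> h; rewrite big1 // => k _; rewrite indicE memNset ?mulr0// => /cylE /h.
Qed.

Definition integral_counts m nu := exists ka, matches m nu ka.

Section convergence.
Context {d} {Om : measurableType d} (P : probability Om R).
Context {d'} {Om' : measurableType d'} (P' : probability Om' R).
Variables (mun : nat -> Om -> @measR2 R) (mu : Om' -> @measR2 R).
Hypothesis rmun : forall n w, (0 < n)%N -> radonS (mun n w).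
Hypothesis mmun : forall n m l, measurable_fun setT (fun w => mun n w (grid m l)).
Hypothesis mmu : forall m l, measurable_fun setT (fun w => mu w (grid m l)).
Hypothesis good_mu : {ae P', forall w, radonS (mu w) /\ forall m, integral_counts m (mu w)}.
Hypothesis cvg_cyl : forall m ka,
  (fun n => fine (P (cyl (mun n) m ka))) @ \oo --> fine (P' (cyl mu m ka)).

Variables (Phi : @measR2 R -> R) (B : R).
Hypothesis PB : forall nu, `|Phi nu| <= B.
Hypothesis cPhi : vague_continuous Phi.
Hypothesis mPhin : forall n, measurable_fun setT (Phi \o mun n).
Hypothesis mPhi : measurable_fun setT (Phi \o mu).

Let B0 : 0 <= B. Proof. exact: le_trans (normr_ge0 _) (PB (mun 0%N point)). Qed.

(** The shift by [B] makes these values nonnegative, so dropping the count vectors that are not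
    below [b] can only decrease a sum. *)
Let env m b (k : {ffun 'I_(gridn m) -> 'I_b}) : R :=
  lower_env Phi m (fun l => (extn k l)%:R%:E) + B.

Let T m b := \sum_(k : {ffun 'I_(gridn m) -> 'I_b}) env k * fine (P' (cyl mu m (extn k))).

Let envE m b nu (k : {ffun 'I_(gridn m) -> 'I_b}) : matches m nu (extn k) ->
  env k = lower_env Phi m (fun l => nu (grid m l)) + B.
Proof. by move=> h; congr (_ + _); apply: eq_lower_env => l lm; rewrite h. Qed.

Let bPhi (dX : measure_display) (X : measurableType dX) (f : X -> @measR2 R) :
  measurable_fun setT (Phi \o f) -> bounded_mfun (Phi \o f).
Proof. by move=> mf; split => //; exists B => w; exact: PB. Qed.

(** At most one indicator is nonzero at each point. If one is, the envelope is below [Phi]; if none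
    is, the sum is 0 and [Phi + B] is nonnegative. *)
Let step1 m b n : (0 < n)%N ->
  \sum_(k : {ffun 'I_(gridn m) -> 'I_b}) env k * fine (P (cyl (mun n) m (extn k)))
  <= Ex P (Phi \o mun n) + B.
Proof.
move=> n0; rewrite -(@Ex_sum_indic _ _ _ P) => [|k]; last exact: measurable_cyl.
rewrite -(Ex_cst P B) -ExD//; [|exact: bPhi|exact: bounded_mfun_cst].
apply: Ex_le => [||w].
- by apply: bounded_mfun_sum => k _; apply: bounded_mfunM; [exact: bounded_mfun_cst|apply/bounded_mfun_indic/measurable_cyl].
- by apply: bounded_mfunD; [exact: bPhi|exact: bounded_mfun_cst].
have [[k hk]|/forallNP h] := pselect (exists k : {ffun 'I_(gridn m) -> 'I_b}, matches m (mun n w) (extn k)).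
  rewrite (sum_matches _ hk) (envE hk) lerD2r.
  by apply: lower_env_le => //; exact: rmun.
rewrite sum_matches0//=; have := PB (mun n w).
by rewrite ler_norml => /andP[+ _]; lra.
Qed.

Let S m w : R := if `[< integral_counts m (mu w) >] then
   lower_env Phi m (fun l => mu w (grid m l)) + B else 0.

Let S_cvg m w : (fun b => \sum_(k : {ffun 'I_(gridn m) -> 'I_b}) env k * \1_(cyl mu m (extn k)) w)
   @ \oo --> S m w.
Proof.
rewrite /S; case: asboolP => [[ka h]|h].
  apply: cvg_near_cst.
  exists (\sum_(l < gridn m) ka l).+1%N => // b /= hb.
  have [k hk] : exists k : {ffun 'I_(gridn m) -> 'I_b}, matches m (mu w) (extn k).
    apply: (extn_ex h) => l lm; apply: leq_trans hb; rewrite ltnS.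
    by rewrite (bigD1 (Ordinal lm))//= leq_addr.
  by rewrite (sum_matches _ hk) (envE hk).
apply: cvg_near_cst; apply: nearW => b.
by rewrite sum_matches0// => k hk; apply: h; exists (extn k).
Qed.

Let bS b m : bounded_mfun (fun w => \sum_(k : {ffun 'I_(gridn m) -> 'I_b}) env k * \1_(cyl mu m (extn k)) w).
Proof.
by apply: bounded_mfun_sum => k _; apply: bounded_mfunM; [exact: bounded_mfun_cst|apply/bounded_mfun_indic/measurable_cyl].
Qed.

(** An infimum over measures has no evident measurability; here it is a pointwise limit of finite
    combinations of indicators of count events. *)
Let mS m : measurable_fun setT (S m).
Proof.
apply: (@measurable_fun_cvg _ _ _ setT 
  (fun b w => \sum_(k : {ffun 'I_(gridn m) -> 'I_b}) env k * \1_(cyl mu m (extn k)) w)) => [b|w _].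
  by have [] := bS b m.
exact: S_cvg.
Qed.

Let T_cvg m : (fun b => T m b) @ \oo --> Ex P' (S m).
Proof.
rewrite (_ : T m = fun b => Ex P' (fun w => \sum_(k : {ffun 'I_(gridn m) -> 'I_b}) env k * \1_(cyl mu m (extn k)) w)); last first.
  by apply/funext => b; rewrite Ex_sum_indic// => k; exact: measurable_cyl.
apply: (@Ex_bounded_cvg _ _ _ P' _ _ (B + B)) => [b|//|b w|].
- by have [] := bS b m.
- have [[k hk]|/forallNP h] := pselect (exists k : {ffun 'I_(gridn m) -> 'I_b}, matches m (mu w) (extn k)).
    rewrite (sum_matches _ hk); have := lower_env_bound m (fun l => (extn k l)%:R%:E) B0 PB.
    by rewrite /env !ler_norml => /andP[? ?]; apply/andP; split; lra.
  by rewrite sum_matches0// normr0 addr_ge0.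
- by apply: aeW => w; exact: S_cvg.
Qed.

Let S_int_cvg : (fun m => Ex P' (S m)) @ \oo --> Ex P' (Phi \o mu) + B.
Proof.
rewrite -(Ex_cst P' B) -ExD//; [|exact: bPhi|exact: bounded_mfun_cst].
apply: (@Ex_bounded_cvg _ _ _ P' _ _ (B + B)) => [n| | |].
- exact: mS.
- by have [] := bounded_mfunD (bPhi mPhi) (bounded_mfun_cst B).
- move=> m w; rewrite /S; case: ifP => _; last by rewrite normr0 addr_ge0.
  have := lower_env_bound m (fun l => mu w (grid m l)) B0 PB.
  by rewrite !ler_norml => /andP[? ?]; apply/andP; split; lra.
- apply: filterS good_mu => w [rw iw].
  under eq_fun => m do rewrite /S asboolT//.
  apply: cvgD; last exact: cvg_cst.
  by apply: lower_env_cvg => // m; apply: lower_env_le.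
Qed.

(** The order of choice matters: first the grid [m], then the truncation [b], and only then [n],
    since the convergence of [cvg_cyl] is for fixed count vectors. Each choice costs [e / 3]. *)
Lemma liminf_Ex (e : R) : 0 < e -> \forall n \near \oo,
  Ex P' (Phi \o mu) - e <= Ex P (Phi \o mun n).
Proof.
move=> e0.
have e3 : 0 < e / 3 by rewrite divr_gt0.
move/cvgrPdist_lt: S_int_cvg => /(_ _ e3) [m _ /(_ m (leqnn _)) hm].
move/cvgrPdist_lt: (@T_cvg m) => /(_ _ e3) [b _ /(_ b (leqnn _)) hb].
have Tn : (fun n => \sum_(k : {ffun 'I_(gridn m) -> 'I_b}) env k * fine (P (cyl (mun n) m (extn k))))
   @ \oo --> T m b.
  by apply: cvg_sumr => k; apply: cvgM; [exact: cvg_cst|exact: cvg_cyl].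
move/cvgrPdist_lt: Tn => /(_ _ e3); apply: filterS2 (nbhs_infty_ge 1) => n n0 hn.
move: hm hb hn; have /(_ m b) := step1 _ _ n0.
by rewrite /= !ltr_norml => ? /andP[? ?] /andP[? ?] /andP[? ?]; lra.
Qed.
End convergence.

Lemma cvg_in_distribution_counts {d} {Om : measurableType d} (P : probability Om R)
    {d'} {Om' : measurableType d'} (P' : probability Om' R)
    (mun : nat -> Om -> @measR2 R) (mu : Om' -> @measR2 R) :
  (forall n w, (0 < n)%N -> radonS (mun n w)) ->
  (forall n m l, measurable_fun setT (fun w => mun n w (grid m l))) ->
  (forall m l, measurable_fun setT (fun w => mu w (grid m l))) ->
  {ae P', forall w, radonS (mu w) /\ forall m, integral_counts m (mu w)} ->
  (forall m ka,
    (fun n => fine (P (cyl (mun n) m ka))) @ \oo --> fine (P' (cyl mu m ka))) ->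
  conv_in_distribution P mun P' mu.
Proof.
move=> rmun mmun mmu gmu cv Phi [B PB] cPhi mPhin mPhi.
apply/cvgrPdist_le => e e0.
have NPhi nu : `|(- Phi nu)| <= B by rewrite normrN.
have cNPhi : vague_continuous (fun nu => - Phi nu).
  move=> nu rnu a a0; have [m [fs [dl [dl0 Cfs H]]]] := cPhi nu rnu a a0.
  exists m, fs, dl; split => // nu' rnu' h.
  by rewrite -opprD normrN; exact: H.
have mN dX (X : measurableType dX) (f : X -> R) : measurable_fun setT f -> measurable_fun setT (fun w => - f w).
  by move=> mf; exact: measurableT_comp.
have h1 := @liminf_Ex _ _ P _ _ P' _ _ rmun mmun mmu gmu cv _ _ PB cPhi mPhin mPhi _ e0.
(* The upper bound is the lower bound for [- Phi], which is again bounded and vaguely continuous. *)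
have h2 := @liminf_Ex _ _ P _ _ P' _ _ rmun mmun mmu gmu cv _ _ NPhi cNPhi (fun n => mN _ _ _ (mPhin n)) (mN _ _ _ mPhi) _ e0.
apply: filterS2 h1 h2 => n.
have bP (dX : measure_display) (X : measurableType dX) (f : X -> @measR2 R) :
    measurable_fun setT (Phi \o f) -> bounded_mfun (Phi \o f).
  by move=> mf; split => //; exists B => w; exact: PB.
have EN (dX : measure_display) (X : measurableType dX) (Q : probability X R) (f : X -> @measR2 R) :
    measurable_fun setT (Phi \o f) -> Ex Q (fun w => - Phi (f w)) = - Ex Q (Phi \o f).
  move=> mf; under [in LHS]eq_fun do rewrite -mulN1r.
  by rewrite (ExZ Q (-1) (bP _ _ _ mf)) mulN1r.
rewrite (EN _ _ P')// (EN _ _ P)// -/(Ex P _) -/(Ex P' _) => ? ?.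
by rewrite ler_norml; apply/andP; split; lra.
Qed.

End reduction.

(** * Poisson approximation for 1-dependent sequences *)

Section numeric.
Context {R : realType}.

Lemma prod_dist_le (a b : nat -> R) N :
  (forall i, 0 <= a i <= 1) -> (forall i, 0 <= b i <= 1) ->
  `|\prod_(i < N) a i - \prod_(i < N) b i| <= \sum_(i < N) `|a i - b i|.
Proof.
move=> ha hb; elim: N => [|N IH]; first by rewrite !big_ord0 subrr normr0.
rewrite !big_ord_recr/=.
have b1 : `|\prod_(i < N) b i| <= 1.
  rewrite normr_prod; apply: prodr_ile1 => i _; rewrite normr_ge0/=.
  by have /andP[h1 h2] := hb i; rewrite ger0_norm.
have /andP[a1 a2] := ha N.
set A := \prod_(_ < _) a _ in IH *; set C := \prod_(_ < _) b _ in IH b1 *.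
rewrite (_ : _ - _ = (A - C) * a N + C * (a N - b N)); last by ring.
apply: (le_trans (ler_normD _ _)); apply: lerD.
  by rewrite normrM (ger0_norm a1) (le_trans _ IH)// ler_piMr.
by rewrite normrM ler_piMl.
Qed.

(** Both sides come from [1 + x <= expR x]: directly at [- p], and at [p] through
    [expR (- p) <= 1 / (1 + p) <= 1 - p + p^2]. *)
Lemma expRN_dist (p : R) : 0 <= p <= 1 -> `|1 - p - expR (- p)| <= p ^+ 2.
Proof.
move=> /andP[p0 p1].
have h1 := @expR_ge1Dx R (- p).
have h2 := @expR_ge1Dx R p.
have h3 : expR p * expR (- p) = 1 by rewrite -expRD subrr expR0.
have h4 := @expR_gt0 R (- p).
rewrite ler_norml; apply/andP; split; last by nra.
have : (1 + p) * expR (- p) <= 1 by rewrite -[leRHS]h3 ler_pM2r.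
nra.
Qed.

Lemma prod_exp_le (p : nat -> R) N : (forall i, 0 <= p i <= 1) ->
  `|\prod_(i < N) (1 - p i) - expR (- \sum_(i < N) p i)| <= \sum_(i < N) p i ^+ 2.
Proof.
move=> hp.
have -> : expR (- \sum_(i < N) p i) = \prod_(i < N) expR (- p i).
  by rewrite -sumrN expR_sum.
apply: (@le_trans _ _ (\sum_(i < N) `|1 - p i - expR (- p i)|)).
  apply: (@prod_dist_le (fun i => 1 - p i) (fun i => expR (- p i))) => i.
    by have /andP[? ?] := hp i; apply/andP; split; lra.
  by rewrite expR_ge0 -expR0 ler_expR oppr_le0; have /andP[] := hp i.
by apply: ler_sum => i _; apply: expRN_dist.
Qed.

(* Coefficients are extracted in increasing order: by the tail bounds, for small
   fixed [s] the k-th one is [s ^- k] times the remainder, up to [D * s]. *)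
Lemma coef_cvg (G_ : nat -> R -> R) (G : R -> R) (p_ : nat -> nat -> R) (p : nat -> R) (D : R) :
  (forall n k s, 0 < s < 1 -> `|G_ n s - \sum_(j < k.+1) s ^+ j * p_ n j| <= D * s ^+ k.+1) ->
  (forall k s, 0 < s < 1 -> `|G s - \sum_(j < k.+1) s ^+ j * p j| <= D * s ^+ k.+1) ->
  (forall s, 0 < s < 1 -> G_ ^~ s @ \oo --> G s) ->
  forall k, p_ ^~ k @ \oo --> p k.
Proof.
move=> H_ H cG; apply: ltn_ind => k IH.
apply/cvgrPdist_le => e e0.
have D0 : 0 <= D.
  have h : 0 < (1 / 2 : R) < 1 by apply/andP; split; lra.
  have := le_trans (normr_ge0 _) (H 0%N _ h); rewrite expr1; lra.
(* Four errors are each at most [e / 4 * s ^+ k]: the two tails, by [D * s <= e / 4], the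
   lower-order coefficients, and the generating functions themselves. Dividing by [s ^+ k] leaves
   [e]. *)
pose s := Num.min (1 / 2) (e / (4 * (D + 1))).
have sD : s * D <= e / 4.
  have : s <= e / (4 * (D + 1)) by rewrite ge_min lexx orbT.
  rewrite ler_pdivlMr; last by lra.
  have s0 : 0 <= s by rewrite le_min; apply/andP; split; [lra|rewrite divr_ge0//; lra].
  nra.
have s0 : 0 < s by rewrite lt_min; apply/andP; split; [lra|rewrite divr_gt0//; lra].
have s1 : s < 1 by rewrite gt_min; apply/orP; left; lra.
have s01 : 0 < s < 1 by rewrite s0.
have sk0 : 0 < s ^+ k by rewrite exprn_gt0.
have e4 : 0 < e / 4 * s ^+ k by rewrite mulr_gt0// divr_gt0.
have cS : (fun n => \sum_(j < k) s ^+ j * p_ n j) @ \oo --> \sum_(j < k) s ^+ j * p j.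
  by apply: cvg_sumr => j; apply: cvgM; [exact: cvg_cst | exact: IH].
move/cvgrPdist_le: cS => /(_ _ e4) h1.
move/cvgrPdist_le: (cG s s01) => /(_ _ e4) h2.
apply: filterS2 h1 h2 => n h1 h2.
have h3 := H_ n k s s01; have h4 := H k s s01.
move: h3 h4; rewrite !big_ord_recr/= exprS !opprD !addrA.
move: h1 h2; set A := \sum_(_ < _) _ * p _; set A' := \sum_(_ < _) _; move=> h1 h2 h3 h4.
rewrite -(ler_pM2r sk0) -[X in _ * X <= _]gtr0_norm// -normrM mulrC mulrBr.
have h5 : D * (s * s ^+ k) <= e / 4 * s ^+ k by rewrite mulrA ler_pM2r// mulrC.
move: h1 h2 h3 h4 h5; rewrite mulrAC; move: (s ^+ k * p k) (s ^+ k * p_ n k) (D * _) => a b c.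
rewrite (_ : e * s ^+ k = e / 4 * s ^+ k *+ 4); last by rewrite -mulr_natr; field.
move: (_ / _ * _) => x; rewrite !ler_norml.
by move=> /andP[? ?] /andP[? ?] /andP[? ?] /andP[? ?] ?; apply/andP; split; lra.
Qed.

(** In the remainder of the series [s ^+ i <= s ^+ k.+1] factors out; what is left is a part of the
    series of [expR la]. *)
Lemma exp_tail (la s : R) k : 0 <= la -> 0 < s < 1 ->
  `|expR (la * s) - \sum_(j < k.+1) s ^+ j * (la ^+ j / j`!%:R)| <= expR la * s ^+ k.+1.
Proof.
move=> la0 /andP[s0 s1].
have cE (x : R) : series (exp_coeff x) @ \oo --> expR x by exact: is_cvg_series_exp_coeff.
have mono (x : R) n : 0 <= x -> series (exp_coeff x) n <= expR x.
  move=> x0; apply: limr_ge; first exact: is_cvg_series_exp_coeff.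
  exists n => // i /= ni; apply: (@nondecreasing_series _ _ xpredT 0) => // j _ _.
  by rewrite /exp_coeff/= divr_ge0// exprn_ge0.
have Ek : \sum_(j < k.+1) s ^+ j * (la ^+ j / j`!%:R) = series (exp_coeff (la * s)) k.+1.
  rewrite /series/= big_mkord; apply: eq_bigr => j _.
  by rewrite /exp_coeff/= exprMn; ring.
have ls0 : 0 <= la * s by rewrite mulr_ge0// ltW.
rewrite Ek ger0_norm ?subr_ge0 ?mono// lerBlDr.
apply: limr_le; first exact: is_cvg_series_exp_coeff.
exists k.+1 => // n /= kn.
rewrite -lerBlDr /series/= -(subnKC kn) (@big_cat_nat _ _ _ k.+1)//= ?leq_addr// addrAC subrr add0r.
rewrite (le_trans (y := s ^+ k.+1 * \sum_(k.+1 <= i < k.+1 + (n - k.+1)) exp_coeff la i))//.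
  rewrite mulr_sumr big_nat [leRHS]big_nat; apply: ler_sum => i /andP[ki _].
  rewrite /exp_coeff/= exprMn mulrA [s ^+ _ * _]mulrC.
  rewrite -!mulrA ler_wpM2l ?exprn_ge0// ler_wpM2r ?invr_ge0//.
  by rewrite ler_wiXn2l// ?ltW.
rewrite mulrC ler_wpM2r ?exprn_ge0 ?(ltW s0)//.
apply: le_trans (mono _ (k.+1 + (n - k.+1))%N la0).
rewrite /series/= [leRHS](@big_cat_nat _ _ _ k.+1)//= ?leq_addr// lerDr sumr_ge0// => i _.
by rewrite /exp_coeff/= divr_ge0// exprn_ge0.
Qed.

End numeric.

(** * Products over 1-dependent sequences *)

Section one_dependent.
Context {R : realType} {d} {Om : measurableType d} (P : probability Om R).

(** With [A n] the expected product of the first [n] factors, [A n.+2 - A n.+1] is minus the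
    expectation of [h n.+1] times the first [n.+1] factors. Removing factor [n] costs at most
    [E (h n * h n.+1)] and decouples the rest by independence; putting it back in [A n] costs
    [E (h n) * E (h n.+1)]. The recursion then contracts, as [1 - E (h n.+1)] is at most 1. *)
Lemma one_dependent_prod (h : nat -> Om -> R) N :
  (forall x, bounded_mfun (h x)) -> (forall x w, 0 <= h x w <= 1) ->
  (forall x, Ex P (fun w => h x.+1 w * \prod_(y < x) (1 - h y w)) =
             Ex P (h x.+1) * Ex P (fun w => \prod_(y < x) (1 - h y w))) ->
  `|Ex P (fun w => \prod_(y < N.+1) (1 - h y w)) - \prod_(y < N.+1) (1 - Ex P (h y))| <=
  \sum_(y < N) (Ex P (fun w => h y w * h y.+1 w) + Ex P (h y) * Ex P (h y.+1)).
Proof.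
move=> bh h01 ind.
have bP n : bounded_mfun (fun w => \prod_(y < n) (1 - h y w)).
  by apply: bounded_mfun_prod => i _; apply: bounded_mfunB => //; exact: bounded_mfun_cst.
have P01 n w : 0 <= \prod_(y < n) (1 - h y w) <= 1.
  rewrite prodr_ge0/= => [|i _]; last by rewrite subr_ge0; have /andP[] := h01 i w.
  by apply: prodr_ile1 => i _; have /andP[? ?] := h01 i w; apply/andP; split; lra.
have E01 x : 0 <= Ex P (h x) <= 1.
  rewrite Ex_ge0/= => [|w]; last by have /andP[] := h01 x w.
  by rewrite -(Ex_cst P 1); apply: Ex_le => // [|w]; [exact: bounded_mfun_cst | have /andP[] := h01 x w].
elim: N => [|N IH].
  rewrite !big_ord0 !big_ord_recr !big_ord0/=.
  under eq_fun do rewrite big_ord_recr big_ord0/= mul1r.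
  by rewrite mul1r ExB// ?Ex_cst ?subrr ?normr0//; exact: bounded_mfun_cst.
rewrite big_ord_recr/= [X in _ <= X]big_ord_recr/=.
set A := fun n => Ex P (fun w => \prod_(y < n) (1 - h y w)).
rewrite -/(A _).
have AS n : A n.+1 = A n - Ex P (fun w => h n w * \prod_(y < n) (1 - h y w)).
  rewrite /A -ExB//; last exact: bounded_mfunM.
  by congr Ex; apply/funext => w; rewrite big_ord_recr/=; ring.
have key : `|A N.+2 - (1 - Ex P (h N.+1)) * A N.+1| <=
   Ex P (fun w => h N w * h N.+1 w) + Ex P (h N) * Ex P (h N.+1).
  have -> : A N.+2 - (1 - Ex P (h N.+1)) * A N.+1 =
     (Ex P (fun w => h N.+1 w * \prod_(y < N) (1 - h y w)) - Ex P (fun w => h N.+1 w * \prod_(y < N.+1) (1 - h y w)))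
     - Ex P (h N.+1) * (A N - A N.+1).
    rewrite (AS N.+1) ind -/(A N); ring.
  apply: (le_trans (ler_normB _ _)); apply: lerD.
    rewrite -ExB; [|exact: bounded_mfunM|exact: bounded_mfunM].
    apply: (le_trans (Ex_normr _ _)); first by apply: bounded_mfunB; exact: bounded_mfunM.
    apply: Ex_le => [| |w]; [apply/bounded_mfun_normr/bounded_mfunB; exact: bounded_mfunM|exact: bounded_mfunM|].
    rewrite big_ord_recr/= -mulrBr (_ : \prod_(y < N) (1 - h y w) - _ = \prod_(y < N) (1 - h y w) * h N w); last by ring.
    have /andP[? ?] := P01 N w; have /andP[? ?] := h01 N w; have /andP[? ?] := h01 N.+1 w.
    rewrite ger0_norm ?mulr_ge0// mulrC -mulrA ler_piMl// mulr_ge0//.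
  have /andP[e0 e1] := E01 N.+1; have /andP[e2 e3] := E01 N.
  rewrite normrM (ger0_norm e0) mulrC ler_wpM2r//.
  rewrite AS opprB addrC subrK ger0_norm ?Ex_ge0// => [|w]; last first.
    by have /andP[? ?] := P01 N w; have /andP[? ?] := h01 N w; rewrite mulr_ge0.
  apply: Ex_le => // [|w]; first exact: bounded_mfunM.
  by have /andP[? ?] := P01 N w; have /andP[? ?] := h01 N w; rewrite ler_piMr.
have /andP[e0 e1] := E01 N.+1.
move: IH; set C := \prod_(_ < N.+1) _; rewrite -/(A _) => IH.
rewrite (_ : _ - _ = (A N.+1 - C) * (1 - Ex P (h N.+1)) + (A N.+2 - (1 - Ex P (h N.+1)) * A N.+1)); last by ring.
apply: (le_trans (ler_normD _ _)); apply: lerD => //.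
rewrite normrM (le_trans _ IH)// ler_piMr// ger0_norm; lra.
Qed.

End one_dependent.

(** * From generating functions to joint point probabilities *)

Section pgf.
Context {R : realType} {d} {Om : measurableType d} (P : probability Om R).

Definition poisson_mass (la : R) k : R := expR (- la) * la ^+ k / k`!%:R.

Lemma bounded_mfun_nat (N : Om -> nat) (g : nat -> R) : measurable_fun setT N ->
  (forall j, 0 <= g j <= 1) -> bounded_mfun (fun w => g (N w)).
Proof.
move=> mN g01; split.
  by apply: (@measurableT_comp _ _ _ _ _ _ g) => // _ Y mY.
by exists 1 => w; have /andP[? ?] := g01 (N w); rewrite ger0_norm.
Qed.

Lemma pgf_counts_cvg M (la : nat -> R) (N : nat -> nat -> Om -> nat) (k : nat -> nat) :
  (forall i, 0 <= la i) -> (forall n i, measurable_fun setT (N n i)) ->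
  (forall s : nat -> R, (forall i, 0 < s i < 1) ->
    (fun n => Ex P (fun w => \prod_(i < M) s i ^+ N n i w)) @ \oo -->
      \prod_(i < M) expR (- ((1 - s i) * la i))) ->
  (fun n => fine (P (\bigcap_(i in `I_M) [set w | N n i w = k i]))) @ \oo -->
    \prod_(i < M) poisson_mass (la i) (k i).
Proof.
move=> la0 mN pgf.
have b01 (b : bool) : 0 <= (b%:R : R) <= 1 by case: b; rewrite ?lexx ?ler01.
have x01 (t : R) j : 0 < t < 1 -> 0 <= t ^+ j <= 1.
  by move=> /andP[/ltW t0 /ltW t1]; rewrite exprn_ge0// exprn_ile1.
(* Hybrid weights: the first [l] generating variables are already replaced by
   indicators of the prescribed counts. *)
pose wf l (s : nat -> R) (n i : nat) (w : Om) : R :=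
  if (i < l)%N then (N n i w == k i)%:R else s i ^+ N n i w.
pose wl l (s : nat -> R) i := if (i < l)%N then poisson_mass (la i) (k i) else expR (- ((1 - s i) * la i)).
have wf01 l (s : nat -> R) n i w : (forall i, 0 < s i < 1) -> 0 <= wf l s n i w <= 1.
  by move=> hs; rewrite /wf; case: ifP => // _; exact: x01.
have bwf l (s : nat -> R) n i : (forall i, 0 < s i < 1) -> bounded_mfun (wf l s n i).
  move=> hs; rewrite /wf; case: (i < l)%N.
    by apply: (@bounded_mfun_nat _ (fun j => (j == k i)%:R)).
  by apply: (@bounded_mfun_nat _ (fun j => s i ^+ j)) => // j; exact: x01.
have main l : (l <= M)%N -> forall s : nat -> R, (forall i, 0 < s i < 1) ->
    (fun n => Ex P (fun w => \prod_(i < M) wf l s n i w)) @ \oo --> \prod_(i < M) wl l s i.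
  elim: l => [_ s hs|l IH lM s hs]; first exact: pgf.
  pose L := Ordinal lM.
  pose W n w := \prod_(i < M | i != L) wf l s n i w.
  pose C := \prod_(i < M | i != L) wl l s i.
  have bW n : bounded_mfun (W n) by apply: bounded_mfun_prod => i _; exact: bwf.
  have W01 n w : 0 <= W n w <= 1.
    rewrite prodr_ge0/= => [|i _]; last by have /andP[] := @wf01 l s n i w hs.
    by apply: prodr_ile1 => i _; exact: wf01.
  have btN n (t : R) : 0 < t < 1 -> bounded_mfun (fun w => t ^+ N n l w).
    by move=> ht; apply: (@bounded_mfun_nat _ (fun j => t ^+ j)) => // j; exact: x01.
  have bNj n (j : nat) : bounded_mfun (fun w => (N n l w == j)%:R : R).
    by apply: (@bounded_mfun_nat _ (fun i => (i == j)%:R : R)).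
  have split_l l' s' n w : (forall i : 'I_M, i != L -> wf l' s' n i w = wf l s n i w) ->
    \prod_(i < M) wf l' s' n i w = wf l' s' n l w * W n w.
    by move=> E; rewrite (bigD1 L)//=; congr (_ * _); apply: eq_bigr.
  have neqL (i : 'I_M) : i != L -> (i < l.+1)%N = (i < l)%N.
    by rewrite ltnS leq_eqVlt -val_eqE/= => /negbTE ->.
  have -> : \prod_(i < M) wl l.+1 s i = C * poisson_mass (la l) (k l).
    rewrite (bigD1 L)//= mulrC /wl ltnSn; congr (_ * _); apply: eq_bigr => i iL.
    by rewrite neqL.
  have -> : (fun n => Ex P (fun w => \prod_(i < M) wf l.+1 s n i w)) =
            (fun n => Ex P (fun w => (N n l w == k l)%:R * W n w)).
    apply/funext => n; congr Ex; apply/funext => w.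
    rewrite (split_l l.+1 s) => [|i iL]; last by rewrite /wf neqL.
    by rewrite /wf ltnSn.
  (* One constant has to serve both tails: the summand 1 bounds the tail of the counts, because [W]
     is at most 1, and the other summand is what [exp_tail] gives for the Poisson side. *)
  apply: (@coef_cvg _ (fun n t => Ex P (fun w => t ^+ N n l w * W n w))
     (fun t => C * expR (- ((1 - t) * la l)))
     (fun n j => Ex P (fun w => (N n l w == j)%:R * W n w))
     (fun j => C * poisson_mass (la l) j) (1 + `|C| * expR (- la l) * expR (la l))).
  - move=> n m t ht.
    have -> : \sum_(j < m.+1) t ^+ j * Ex P (fun w => (N n l w == j)%:R * W n w) =
       Ex P (fun w => \sum_(j < m.+1) t ^+ j * ((N n l w == j)%:R * W n w)).
      rewrite Ex_sum => [|j _]; last by apply: bounded_mfunM; [exact: bounded_mfun_cst | exact: bounded_mfunM].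
      by apply: eq_bigr => j _; rewrite ExZ//; exact: bounded_mfunM.
    have bs : bounded_mfun (fun w => \sum_(j < m.+1) t ^+ j * ((N n l w == j)%:R * W n w)).
      by apply: bounded_mfun_sum => j _; apply: bounded_mfunM; [exact: bounded_mfun_cst | exact: bounded_mfunM].
    have bt : bounded_mfun (fun w => t ^+ N n l w * W n w) by apply: bounded_mfunM => //; exact: btN.
    rewrite -ExB//; apply: le_trans (Ex_normr _ (bounded_mfunB bt bs)) _.
    apply: (@le_trans _ _ (t ^+ m.+1)); last first.
      have /andP[t0 _] := x01 t m.+1 ht.
      by rewrite mulrDl mul1r lerDl !mulr_ge0// expR_ge0.
    rewrite -(Ex_cst P (t ^+ m.+1)); apply: Ex_le => [||w]; [exact/bounded_mfun_normr/bounded_mfunB|exact: bounded_mfun_cst|].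
    have /andP[w0 w1] := W01 n w.
    have -> : \sum_(j < m.+1) t ^+ j * ((N n l w == j)%:R * W n w) =
      (if (N n l w < m.+1)%N then t ^+ N n l w * W n w else 0).
      case: ifPn => h.
        rewrite (bigD1 (Ordinal h))//= eqxx mul1r big1 ?addr0// => j jn.
        rewrite eq_sym; move: jn; rewrite -val_eqE/= => /negbTE ->; by rewrite mul0r mulr0.
      rewrite big1// => j _; case: eqP => [E|]; last by rewrite mul0r mulr0.
      by move: h; rewrite E ltn_ord.
    rewrite /cst; have /andP[t0 t1] := x01 t m.+1 ht.
    case: ifPn => h; first by rewrite subrr normr0.
    have /andP[t2 t3] := x01 t (N n l w) ht.
    rewrite subr0 ger0_norm ?mulr_ge0// (@le_trans _ _ (t ^+ N n l w))// ?ler_piMr//.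
    by have /andP[/ltW ? /ltW ?] := ht; rewrite ler_wiXn2l// leqNgt.
  - move=> m t ht.
    have -> : C * expR (- ((1 - t) * la l)) - \sum_(j < m.+1) t ^+ j * (C * poisson_mass (la l) j)
      = C * expR (- la l) * (expR (la l * t) - \sum_(j < m.+1) t ^+ j * (la l ^+ j / j`!%:R)).
      rewrite mulrBr -mulrA -expRD; congr (_ * expR _ - _); first by ring.
      by rewrite mulr_sumr; apply: eq_bigr => j _; rewrite /poisson_mass; ring.
    rewrite normrM [`|C * _|]normrM [`|expR _|]ger0_norm ?expR_ge0//.
    have /andP[t0 t1] := x01 t m.+1 ht.
    apply: (@le_trans _ _ (`|C| * expR (- la l) * (expR (la l) * t ^+ m.+1))).
      by rewrite ler_wpM2l ?mulr_ge0 ?expR_ge0//; apply: exp_tail.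
    by rewrite mulrDl mul1r mulrA lerDr.
  - move=> t ht.
    pose s' i := if i == l then t else s i.
    have hs' i : 0 < s' i < 1 by rewrite /s'; case: ifP.
    have := IH (ltnW lM) s' hs'.
    have E (i : 'I_M) : i != L -> s' i = s i by rewrite /s' -val_eqE/= => /negbTE ->.
    have -> : \prod_(i < M) wl l s' i = C * expR (- ((1 - t) * la l)).
      rewrite (bigD1 L)//= mulrC {2}/wl ltnn /s' eqxx; congr (_ * _); apply: eq_bigr => i iL.
      by rewrite /wl; case: ifP => // _; rewrite -/(s' i) E.
    have -> // : (fun n => Ex P (fun w => \prod_(i < M) wf l s' n i w)) =
            (fun n => Ex P (fun w => t ^+ N n l w * W n w)).
    apply/funext => n; congr Ex; apply/funext => w.
    rewrite (split_l l s') => [|i iL]; last by rewrite /wf E.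
    by rewrite /wf ltnn /s' eqxx.
(* At stage [M] every variable has been replaced, so the value of the parameters is arbitrary. *)
have h2 (i : nat) : 0 < (1 / 2 : R) < 1 by apply/andP; split; lra.
have := main M (leqnn _) (fun=> 1 / 2) h2.
have -> : \prod_(i < M) wl M (fun=> 1 / 2) i = \prod_(i < M) poisson_mass (la i) (k i).
  by apply: eq_bigr => i _; rewrite /wl ltn_ord.
have -> // : (fun n => Ex P (fun w => \prod_(i < M) wf M (fun=> 1 / 2) n i w)) =
  (fun n => fine (P (\bigcap_(i in `I_M) [set w | N n i w = k i]))).
apply/funext => n; rewrite -(Ex_indic P); last first.
  apply: fin_bigcap_measurable => // i _.
  by have := mN n i measurableT [set k i] I; rewrite setTI.
congr Ex; apply/funext => w; rewrite indicE.
have [h|h] := boolP (w \in _).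
  rewrite big1// => i _; rewrite /wf ltn_ord; move: h; rewrite inE => /(_ i (ltn_ord i))/= ->.
  by rewrite eqxx.
have /existsNP[i /not_implyP[iM ni]] : ~ forall i, `I_M i -> N n i w = k i.
  by move=> H; move: h; rewrite notin_setE; apply; exact: H.
by rewrite (bigD1 (Ordinal iM))//= /wf iM; move/eqP/negbTE: ni => ->; rewrite mul0r.
Qed.

End pgf.

(** * Independence *)

Section product_of_independent_factors.
Context {R : realType} {d} {Om : measurableType d} (P : probability Om R).

(** The induction carries a spare factor [\1_X] with [X] in the pi-system: expanding the last factor
    of the product merely replaces [X] by its intersections with the [e n i], so independence of [E]
    from single events is enough. *)
Lemma indep_indic_prod (A : set (set Om)) M (c : 'I_M -> R) (e : nat -> 'I_M -> set Om) N E :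
  A `<=` measurable -> setI_closed A -> A setT ->
  (forall y i, (y < N)%N -> A (e y i)) -> measurable E ->
  (forall X, A X -> P (E `&` X) = (P E * P X)%E) ->
  Ex P (fun w => \1_E w * \prod_(y < N) (1 - \sum_i c i * \1_(e y i) w)) =
  fine (P E) * Ex P (fun w => \prod_(y < N) (1 - \sum_i c i * \1_(e y i) w)).
Proof.
move=> Am AI AT Ae mE EA.
have bh y : (y < N)%N -> bounded_mfun (fun w => 1 - \sum_i c i * \1_(e y i) w).
  move=> yN; apply: bounded_mfunB; first exact: bounded_mfun_cst.
  by apply: bounded_mfun_sum => i _; apply: bounded_mfunM; [exact: bounded_mfun_cst|apply/bounded_mfun_indic/Am/Ae].
have bP n : (n <= N)%N -> bounded_mfun (fun w => \prod_(y < n) (1 - \sum_i c i * \1_(e y i) w)).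
  by move=> nN; apply: bounded_mfun_prod => y _; apply: bh; exact: leq_trans (ltn_ord y) nN.
have main n : (n <= N)%N -> forall X, A X ->
    Ex P (fun w => \1_E w * (\1_X w * \prod_(y < n) (1 - \sum_i c i * \1_(e y i) w))) =
    fine (P E) * Ex P (fun w => \1_X w * \prod_(y < n) (1 - \sum_i c i * \1_(e y i) w)).
  elim: n => [_ X AX|n IH nN X AX].
    under eq_fun do rewrite big_ord0 mulr1 -indicIE.
    under [in RHS]eq_fun do rewrite big_ord0 mulr1.
    rewrite (Ex_indic _ (measurableI _ _ mE (Am _ AX))) EA//.
    rewrite fineM ?fin_num_measure//; last exact: Am.
    by congr (_ * _); rewrite -(Ex_indic P (Am _ AX)).
  set Q := fun w => \prod_(y < n) (1 - \sum_i c i * \1_(e y i) w).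
  have bQ : bounded_mfun Q by apply: bP; exact: ltnW.
  have bX Y : A Y -> bounded_mfun (fun w => \1_Y w * Q w) by move=> AY; apply: bounded_mfunM => //; apply/bounded_mfun_indic/Am.
  have bE Y : A Y -> bounded_mfun (fun w => \1_E w * (\1_Y w * Q w)).
    by move=> AY; apply: bounded_mfunM; [exact: bounded_mfun_indic|exact: bX].
  have IHq Y : A Y -> Ex P (fun w => \1_E w * (\1_Y w * Q w)) = fine (P E) * Ex P (fun w => \1_Y w * Q w).
    exact: IH (ltnW nN) Y.
  have AXe i : A (X `&` e n i) by apply: AI => //; exact: Ae.
  have step (U : Om -> R) w : U w * (\1_X w * \prod_(y < n.+1) (1 - \sum_i c i * \1_(e y i) w)) =
    U w * (\1_X w * Q w) - \sum_i c i * (U w * (\1_(X `&` e n i) w * Q w)).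
    rewrite big_ord_recr/= -/(Q w) mulrBr mulr1 !mulrBr; congr (_ - _).
    rewrite !mulr_sumr; apply: eq_bigr => i _; rewrite indicIE; ring.
  have -> : Ex P (fun w => \1_E w * (\1_X w * \prod_(y < n.+1) (1 - \sum_i c i * \1_(e y i) w))) =
     Ex P (fun w => \1_E w * (\1_X w * Q w)) -
     \sum_i c i * Ex P (fun w => \1_E w * (\1_(X `&` e n i) w * Q w)).
    under eq_fun do rewrite step.
    rewrite ExB; [|exact: bE|by apply: bounded_mfun_sum => i _; apply: bounded_mfunM; [exact: bounded_mfun_cst|exact: bE]].
    congr (_ - _); rewrite Ex_sum => [|i _]; last by apply: bounded_mfunM; [exact: bounded_mfun_cst|exact: bE].
    by apply: eq_bigr => i _; rewrite ExZ//; exact: bE.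
  have -> : Ex P (fun w => \1_X w * \prod_(y < n.+1) (1 - \sum_i c i * \1_(e y i) w)) =
     Ex P (fun w => \1_X w * Q w) -
     \sum_i c i * Ex P (fun w => \1_(X `&` e n i) w * Q w).
    have step1 w : \1_X w * \prod_(y < n.+1) (1 - \sum_i c i * \1_(e y i) w) =
      \1_X w * Q w - \sum_i c i * (\1_(X `&` e n i) w * Q w).
      have := step (cst 1) w; rewrite /cst !mul1r => ->; congr (_ - _).
      by apply: eq_bigr => i _; rewrite mul1r.
    under eq_fun do rewrite step1.
    rewrite ExB; [|exact: bX|by apply: bounded_mfun_sum => i _; apply: bounded_mfunM; [exact: bounded_mfun_cst|exact: bX]].
    congr (_ - _); rewrite Ex_sum => [|i _]; last by apply: bounded_mfunM; [exact: bounded_mfun_cst|exact: bX].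
    by apply: eq_bigr => i _; rewrite ExZ//; exact: bX.
  rewrite (IHq _ AX) mulrBr; congr (_ - _); rewrite mulr_sumr; apply: eq_bigr => i _.
  by rewrite (IHq _ (AXe i)) mulrCA.
have := main N (leqnn _) setT AT.
by under eq_fun do rewrite indicT mul1r; under [in X in _ = _ * X]eq_fun do rewrite indicT mul1r.
Qed.

End product_of_independent_factors.

Section independence.
Context {R : realType} {d} {Om : measurableType d} (P : probability Om R).
Variables (F : int -> Om -> R) (rho : R -> R).
Hypothesis iid : iid_with_density P F rho.

Let mF x : measurable_fun setT (F x). Proof. by case: iid. Qed.

Definition cylinders (s : seq int) : set (set Om) :=
  [set A | exists2 B : int -> set R, forall i, measurable (B i) &
           A = \bigcap_(i in [set` s]) (F i @^-1` B i)].

Lemma measurable_cylinders s : cylinders s `<=` measurable.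
Proof.
move=> _ [B mB ->]; apply: fin_bigcap_measurable => // i _.
by rewrite -[X in measurable X]setTI; exact: mF.
Qed.

Lemma cylinders_setI s : setI_closed (cylinders s).
Proof.
move=> _ _ [B mB ->] [C mC ->]; exists (fun i => B i `&` C i).
  by move=> i; exact: measurableI.
by rewrite -bigcapI.
Qed.

Lemma cylinders_setT s : cylinders s setT.
Proof. by exists (fun=> setT) => //; apply/seteqP; split. Qed.

Lemma cylinders_preimage s i B : i \in s -> measurable B -> cylinders s (F i @^-1` B).
Proof.
move=> si mB; exists (fun j => if j == i then B else setT).
  by move=> j; case: ifP.
apply/seteqP; split => [w Bw j _ /=|w /(_ i si)/=]; last by rewrite eqxx.
by case: eqP => // ->.
Qed.

Lemma cylinders_indep s s' A A' : uniq (s ++ s') -> cylinders s A -> cylinders s' A' ->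
  P (A `&` A') = (P A * P A')%E.
Proof.
rewrite cat_uniq => /and3P[us ss' us'] [B mB ->] [B' mB' ->].
pose C i := if i \in s then B i else B' i.
have mC i : measurable (C i) by rewrite /C; case: ifP.
have nin i : i \in s' -> (i \in s) = false.
  move=> is'; apply/negbTE/negP => is_; move/negP: ss'; apply; apply/hasP.
  by exists i.
have -> : \bigcap_(i in [set` s]) F i @^-1` B i `&` \bigcap_(i in [set` s']) F i @^-1` B' i
    = \bigcap_(i in [set` s ++ s']) F i @^-1` C i.
  apply/seteqP; split => [w [h h'] i /=|w h].
    rewrite mem_cat /C => /orP[is_|is']; first by rewrite is_; exact: h.
    by rewrite nin//; exact: h'.
  split => i /= is_.
    by have := h i; rewrite /= mem_cat is_ /C is_; apply.
  by have := h i; rewrite /= mem_cat is_ orbT /C nin//; apply.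
rewrite iid.2 ?cat_uniq ?us ?ss' ?us'//; rewrite !iid.2// big_cat/=; congr (_ * _)%E.
  by rewrite big_seq [RHS]big_seq; apply: eq_bigr => i is_; rewrite /C is_.
by rewrite big_seq [RHS]big_seq; apply: eq_bigr => i is_; rewrite /C nin.
Qed.

(** The sigma-algebra of the variables [F i] with [i] in [s]. Its generators are the pi-system of
    events to which the i.i.d. hypothesis directly assigns a probability. *)
Definition sigma_of s : set (set Om) := <<s cylinders s >>.

Lemma sigma_of_measurable s : sigma_of s `<=` measurable.
Proof.
apply: smallest_sub; last exact: measurable_cylinders.
by split => //; [move=> A mA; rewrite setTD; exact: measurableC|exact: bigcupT_measurable].
Qed.

Lemma sigma_of_setI s : setI_closed (sigma_of s).
Proof.
move=> A B hA hB; have := @measurableI _ (g_sigma_algebraType (cylinders s)) A B.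
exact.
Qed.

Lemma sigma_of_setT s : sigma_of s setT.
Proof. by apply: sub_gen_smallest; exact: cylinders_setT. Qed.

Lemma sigma_of_sub s s' : {subset s <= s'} -> sigma_of s `<=` sigma_of s'.
Proof.
move=> ss'; apply: smallest_sub; first exact: smallest_sigma_algebra.
move=> _ [B mB ->]; apply: sub_gen_smallest.
exists (fun i => if i \in s then B i else setT); first by move=> i; case: ifP.
apply/seteqP; split => w h i /= is_.
  by case: ifPn => // ii; exact: h.
by have := h i (ss' _ is_); rewrite /= is_.
Qed.

(** For fixed [E], [P] restricted to [E] and [P E] times [P] are finite measures that agree on a
    pi-system, hence on the sigma-algebra it generates. *)
Lemma indep_ext (G : set (set Om)) E : G `<=` measurable -> setI_closed G -> G setT ->
  measurable E -> (forall X, G X -> P (X `&` E) = (P X * P E)%E) ->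
  forall X, <<s G >> X -> P (X `&` E) = (P X * P E)%E.
Proof.
move=> Gm GI GT mE GE X GX.
have PE0 : 0 <= fine (P E) by rewrite fine_ge0.
have sE Y : mscale (NngNum PE0) P Y = ((fine (P E))%:E * P Y)%E by [].
have H : mrestr P mE X = mscale (NngNum PE0) P X.
  apply: (@g_sigma_algebra_measure_unique _ _ _ G Gm (fun=> setT) (fun=> GT) _ _ _ GI _ _ X GX).
  - by apply/seteqP; split => // w _; exists 0%N.
  - by move=> Y GY; rewrite /= sE /mrestr fineK ?fin_num_measure// GE// muleC.
  - move=> _; rewrite /= /mrestr setTI; apply: (le_lt_trans (probability_le1 P mE)); by rewrite ltry.
by move: H; rewrite sE /mrestr fineK ?fin_num_measure// muleC.
Qed.

(** The extension from cylinders is made on one side at a time, the other event being held fixed. *)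
Lemma sigma_of_indep s s' E E' : uniq (s ++ s') -> sigma_of s E -> sigma_of s' E' ->
  P (E `&` E') = (P E * P E')%E.
Proof.
move=> u sE sE'; apply: (indep_ext (G := cylinders s)) sE.
- exact: measurable_cylinders.
- exact: cylinders_setI.
- exact: cylinders_setT.
- exact: sigma_of_measurable sE'.
- move=> X sX; rewrite setIC muleC; apply: (indep_ext (G := cylinders s')) sE'.
  + exact: measurable_cylinders.
  + exact: cylinders_setI.
  + exact: cylinders_setT.
  + exact: measurable_cylinders sX.
  + by move=> Y sY; rewrite setIC muleC; exact: cylinders_indep u sX sY.
Qed.

Lemma sigma_of_pair s i j (D : set (R * R)) : i \in s -> j \in s -> measurable D ->
  sigma_of s [set w | D (F i w, F j w)].
Proof.
move=> si sj mD.
have mf k : k \in s -> @measurable_fun _ _ (g_sigma_algebraType (cylinders s)) _ setT (F k).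
  move=> sk _ Y mY; rewrite setTI; apply: sub_gen_smallest; exact: cylinders_preimage.
have := measurable_fun_pair (mf _ si) (mf _ sj) measurableT mD.
by rewrite setTI.
Qed.

End independence.

(** * Beta integrals *)

Section lebesgue_affine.
Context {R : realType}.
Notation leb := (@lebesgue_measure R).

Let aff (a b : R) : R -> measurableTypeR R := fun x => a * x + b.

Let measurable_aff a b : measurable_fun setT (aff a b).
Proof. by apply: measurable_funD => //; exact: measurable_funM. Qed.

Let push (a b : R) : {measure set (measurableTypeR R) -> \bar R} :=
  measure_function_pushforward__canonical__measure_function_Measure leb (measurable_aff a b).

Let lebesgue_itv_affine (a b u v : R) : a != 0 ->
  leb `]u, v] = (`|a|%:E * leb ((fun x => (a * x + b)%R) @^-1` `]u, v]))%E.
Proof.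
move=> a0.
have na0 : `|a| != 0 by rewrite normr_eq0.
rewrite lebesgue_measure_itv/= lte_fin.
have [alt|agt|a00] := ltgtP a 0; last by rewrite a00 eqxx in a0.
- have -> : (fun x => a * x + b) @^-1` `]u, v] = `[(v - b) / a, (u - b) / a[%classic.
    apply/seteqP; split => x /=; rewrite !in_itv/= ler_ndivrMr// ltr_ndivlMr//;
      by move=> /andP[? ?]; apply/andP; split; lra.
  rewrite lebesgue_measure_itv/= lte_fin ltr_ndivrMr// divfK// ltrD2r.
  case: ifPn => uv; last by rewrite mule0.
  rewrite -!EFinB -EFinM ltr0_norm//; congr EFin; field.
  by rewrite lt_eqF.
- have -> : (fun x => a * x + b) @^-1` `]u, v] = `](u - b) / a, (v - b) / a]%classic.
    apply/seteqP; split => x /=; rewrite !in_itv/= ltr_pdivrMr// ler_pdivlMr//;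
      by move=> /andP[? ?]; apply/andP; split; lra.
  rewrite lebesgue_measure_itv/= lte_fin ltr_pdivrMr// divfK// ltrD2r.
  case: ifPn => uv; last by rewrite mule0.
  rewrite -!EFinB -EFinM gtr0_norm//; congr EFin; field.
  by rewrite gt_eqF.
Qed.

(** [|a|] times the push-forward of Lebesgue measure gives half-open intervals their length, which
    characterises Lebesgue measure. *)
Lemma lebesgue_measure_affine (a b : R) (A : set R) : a != 0 -> measurable A ->
  leb A = (`|a|%:E * leb ((fun x => (a * x + b)%R) @^-1` A))%E.
Proof.
move=> a0 mA.
have := @lebesgue_measure_unique R (mscale (NngNum (normr_ge0 a)) (push a b)).
apply; last exact: mA.
by move=> _ [[u v] _ <-]; exact: lebesgue_itv_affine.
Qed.

Lemma lebesgue_integral_affine (a b : R) (f : R -> \bar R) (D : set R) : a != 0 ->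
  measurable D -> measurable_fun D f -> (forall x, D x -> (0 <= f x)%E) ->
  (\int[leb]_(x in D) f x =
   `|a|%:E * \int[leb]_(x in (fun x => a * x + b)%R @^-1` D) f (a * x + b)%R)%E.
Proof.
move=> a0 mD mf f0.
rewrite (eq_measure_integral (mscale (NngNum (normr_ge0 a)) (push a b))); last first.
  by move=> A mA _; exact: lebesgue_measure_affine.
rewrite ge0_integral_mscale//; congr (_ * _)%E.
rewrite ge0_integral_pushforward//; first exact: measurable_aff.
by move=> y; rewrite inE; exact: f0.
Qed.

End lebesgue_affine.

(** * Integrals of powers and of beta type *)

Section power_integrals.
Context {R : realType}.
Notation leb := (@lebesgue_measure R).

Lemma integral_powR_segment (a y z : R) : a + 1 != 0 -> 0 < y -> y < z ->
  (\int[leb]_(u in `[y, z]) (u `^ a)%:E = ((z `^ (a + 1) - y `^ (a + 1)) / (a + 1))%:E)%E.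
Proof.
move=> a1 y0 yz.
have d (x : R) : 0 < x -> is_derive x 1 (fun u : R => u `^ (a + 1) / (a + 1)) (x `^ a).
  move=> x0; have h := is_derive1_powR (a + 1) x0.
  have := @is_deriveZ _ _ _ (fun u : R => u `^ (a + 1)) ((a + 1)^-1) x 1 _ h.
  rewrite addrK /GRing.scale/= mulrA mulVf// mul1r.
  by rewrite (_ : _ \*: _ = (fun u : R => u `^ (a + 1) / (a + 1)))//; apply/funext => u /=; rewrite /GRing.scale/= mulrC.
have pos x : x \in `[y, z] -> 0 < x.
  by rewrite in_itv/= => /andP[+ _]; exact: lt_le_trans.
have co b x : 0 < x -> {for x, continuous (fun u : R => u `^ b)}.
  move=> x0; apply: differentiable_continuous; apply/derivable1_diffP.
  by apply: derivable_powR; rewrite in_itv/= x0.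
rewrite (@continuous_FTC2 _ _ (fun u : R => u `^ (a + 1) / (a + 1)))//.
- by rewrite -EFinB -mulrBl.
- apply: derivable_within_continuous => x /pos x0.
  by apply: derivable_powR; rewrite in_itv/= x0.
- split.
  + move=> x /subset_itv_oo_cc/pos x0; by have [] := d x x0.
  + apply: cvgM; last exact: cvg_cst.
    by apply: cvg_at_right_filter; exact: co.
  + apply: cvgM; last exact: cvg_cst.
    by apply: cvg_at_left_filter; apply: co; exact: lt_trans yz.
- move=> x /subset_itv_oo_cc/pos x0; rewrite derive1E; have := d x x0 => dx.
  exact: derive_val.
Qed.

Lemma integral_powR (a t : R) : 0 < a + 1 -> 0 < t ->
  (\int[leb]_(u in `]0%R, t[) (u `^ a)%:E = (t `^ (a + 1) / (a + 1))%:E)%E.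
Proof.
move=> a1 t0.
have mp D : measurable_fun D (fun u : R => (u `^ a)%:E).
  by apply/measurable_EFinP/measurable_funTS; exact: measurable_powR.
rewrite integral_itv_bndo_bndc//.
(* For [a < 0] the power is unbounded at 0, so the interval is exhausted from the right; the
   denominator [n.+2] keeps the left end strictly below [t] already for [n = 0]. *)
pose de n : R := t / n.+2%:R.
have de0 n : 0 < de n by rewrite divr_gt0// ltr0n.
have det n : de n < t by rewrite ltr_pdivrMr ?ltr0n// ltr_pMr// ltr1n.
have -> : `]0, t]%classic = \bigcup_n `[de n, t]%classic.
  apply/seteqP; split => x /=; last first.
    by move=> [n _] /=; rewrite !in_itv/= => /andP[h ->]; rewrite andbT (lt_le_trans _ h).
  rewrite in_itv/= => /andP[x0 xt]; exists (Num.truncn (t / x)) => //=.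
  rewrite in_itv/= xt andbT /de ler_pdivrMr ?ltr0n// mulrC -ler_pdivrMr//.
  apply: (le_trans (ltW (truncnS_gt _))); by rewrite ler_nat.
have c1 : (\int[leb]_(x in `[de i, t]) (x `^ a)%:E)%E @[i --> \oo] -->
   (\int[leb]_(x in \bigcup_i `[de i, t]%classic) (x `^ a)%:E)%E.
  apply: ge0_nondecreasing_set_cvg_integral => //.
  - move=> n m nm; apply/subsetPset => x /=; rewrite !in_itv/= => /andP[h ->]; rewrite andbT.
    apply: le_trans h; rewrite /de ler_pM2l// lef_pV2 ?posrE ?ltr0n// ler_nat.
    by rewrite !ltnS.
  - by move=> i; exact: mp.
  - by move=> i x _; rewrite lee_fin powR_ge0.
have c2 : (\int[leb]_(x in `[de i, t]) (x `^ a)%:E)%E @[i --> \oo] --> (t `^ (a + 1) / (a + 1))%:E.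
  under eq_fun do rewrite integral_powR_segment ?gt_eqF//.
  apply: cvg_EFin; first exact: nearW.
  rewrite [X in _ --> X](_ : _ = (t `^ (a + 1) - 0) / (a + 1)); last by rewrite subr0.
  apply: cvgM; last exact: cvg_cst.
  apply: cvgB; first exact: cvg_cst.
  have /cvg_at_rightP := powR_cvg0 a1; apply; split => //.
  rewrite [X in _ --> X](_ : _ = t * 0); last by rewrite mulr0.
  apply: cvgM; first exact: cvg_cst.
  have := @cvg_harmonic R; rewrite -(cvg_shiftn 1); apply: cvg_trans; apply: near_eq_cvg.
  by apply: nearW => n /=; rewrite /harmonic addn1.
exact: cvg_unique c1 c2.
Qed.

(* By the symmetry [t -> 1 - t], since [t + (1 - t) = 1]. *)
Lemma integral_beta_half (k : R) : 0 < k + 1 ->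
  (\int[leb]_(t in `]0%R, 1%R[) (t `^ k * (1 - t) `^ (k + 1))%:E = (betaR (k + 1) (k + 1) / 2)%:E)%E.
Proof.
move=> k1.
have k11 : k + 1 != 0 by rewrite gt_eqF.
have mp (b : R) D : measurable_fun D (fun u : R => u `^ b).
  by apply/measurable_funTS; exact: measurable_powR.
have mq (b : R) D : measurable_fun D (fun u : R => (1 - u) `^ b).
  apply/measurable_funTS; apply: (measurableT_comp (measurable_powR b)).
  exact: measurable_funB.
have mpq (b b' : R) D : measurable_fun D (fun u : R => (u `^ b * (1 - u) `^ b')%:E).
  by apply/measurable_EFinP; apply: measurable_funM.
have ge0 (b b' u : R) : (0 <= (u `^ b * (1 - u) `^ b')%:E)%E.
  by rewrite lee_fin mulr_ge0 ?powR_ge0.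
set J := (\int[leb]_(t in _) _)%E.
have J2 : J = (\int[leb]_(t in `]0%R, 1%R[) (t `^ (k + 1) * (1 - t) `^ k)%:E)%E.
  have h1 : (-1 : R) != 0 by rewrite oppr_eq0 oner_eq0.
  rewrite /J (@lebesgue_integral_affine _ (-1) 1 _ `]0, 1[%classic h1)//.
  rewrite normrN1 mul1e.
  have -> : (fun x : R => -1 * x + 1) @^-1` `]0, 1[ = `]0, 1[%classic :> set R.
    by apply/seteqP; split => x /=; rewrite !in_itv/= => /andP[? ?]; apply/andP; split; lra.
  apply: eq_integral => x _; rewrite mulN1r addrC opprB addrCA subrr addr0.
  by rewrite mulrC.
have JJ : (\int[leb]_(t in `]0%R, 1%R[) (t `^ k * (1 - t) `^ k)%:E = J + J)%E.
  transitivity (\int[leb]_(t in `]0%R, 1%R[) ((t `^ k * (1 - t) `^ (k + 1))%:E + (t `^ (k + 1) * (1 - t) `^ k)%:E))%E; last first.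
    rewrite {2}J2 /J; apply: ge0_integralD; [by []|by move=> x _; exact: ge0|exact: mpq|
      by move=> x _; exact: ge0|exact: mpq].
  apply: eq_integral => x.
  rewrite inE/= in_itv/= => /andP[x0 x1].
  rewrite -EFinD; congr EFin.
  have E (y : R) : 0 < y -> y `^ (k + 1) = y `^ k * y.
    by move=> y0; rewrite powRD ?(negbTE k11)// powRr1// ltW.
  by rewrite !E ?subr_gt0//; ring.
have J0 : (0 <= J)%E by apply: integral_ge0 => x _; exact: ge0.
have Joo : (J < +oo)%E.
  apply: (@le_lt_trans _ _ (\int[leb]_(t in `]0%R, 1%R[) (t `^ k)%:E)%E); last first.
    by rewrite integral_powR// ltry.
  apply: ge0_le_integral => //.
  - exact: mpq.
  - by apply/measurable_EFinP; exact: mp.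
  - move=> x; rewrite /= in_itv/= => /andP[x0 x1]; rewrite lee_fin ler_piMr ?powR_ge0//.
    apply: (@le_trans _ _ (1 `^ (k + 1))); last by rewrite powR1.
    by apply: ge0_ler_powR; rewrite ?nnegrE; lra.
have Jf : J \is a fin_num by rewrite ge0_fin_numE.
have -> : betaR (k + 1) (k + 1) = fine J + fine J.
  by rewrite -fineD// -JJ /betaR addrK.
by rewrite (_ : (_ + _) / 2 = fine J) ?fineK//; field.
Qed.

(** This is the convolution of a density [u^k] with a tail of order [k + 1]. Substituting [u = e x]
    collects the power [1 + k + (k + 1)] of [e]. *)
Lemma integral_beta_scaled (k e : R) : 0 < k + 1 -> 0 < e ->
  (\int[leb]_(u in `]0%R, e[) (u `^ k * (e - u) `^ (k + 1))%:E =
   (e `^ (2 * k + 2) * (betaR (k + 1) (k + 1) / 2))%:E)%E.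
Proof.
move=> k1 e0; have e00 : e != 0 by rewrite gt_eqF.
have mf D : measurable_fun D (fun u : R => (u `^ k * (e - u) `^ (k + 1))%:E).
  apply/measurable_EFinP/measurable_funTS; apply: measurable_funM; first exact: measurable_powR.
  by apply: (measurableT_comp (measurable_powR (k + 1))); exact: measurable_funB.
have mf1 D : measurable_fun D (fun u : R => (u `^ k * (1 - u) `^ (k + 1))%:E).
  apply/measurable_EFinP/measurable_funTS; apply: measurable_funM; first exact: measurable_powR.
  by apply: (measurableT_comp (measurable_powR (k + 1))); exact: measurable_funB.
rewrite (@lebesgue_integral_affine _ e 0 _ _ e00)//; last first.
  by move=> x _; rewrite lee_fin mulr_ge0 ?powR_ge0.
rewrite gtr0_norm//.
have -> : (fun x : R => e * x + 0) @^-1` `]0, e[ = `]0, 1[%classic :> set R.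
  apply/seteqP; split => x /=; rewrite !in_itv/= addr0 pmulr_rgt0// gtr_pMr//.
transitivity (e%:E * \int[leb]_(x in `]0%R, 1%R[) ((e `^ (2 * k + 1))%:E * (x `^ k * (1 - x) `^ (k + 1))%:E))%E.
  congr (_ * _)%E; apply: eq_integral => x; rewrite inE/= in_itv/= => /andP[x0 x1]; rewrite -EFinM addr0; congr EFin.
  rewrite powRM ?ltW// (_ : e - e * x = e * (1 - x)); last by ring.
  rewrite powRM ?ltW ?subr_gt0//.
  rewrite (_ : 2 * k + 1 = k + (k + 1)); last by ring.
  by rewrite [e `^ (_ + (_ + _))]powRD ?e00 ?implybT//; ring.
have h1 (x : R) : `]0, 1[%classic x -> (0 <= (x `^ k * (1 - x) `^ (k + 1))%:E)%E.
  by move=> _; rewrite lee_fin mulr_ge0 ?powR_ge0.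
have h2 : (0 <= (e `^ (2 * k + 1))%:E)%E by rewrite lee_fin powR_ge0.
rewrite ge0_integralZl//; last exact: mf1.
rewrite integral_beta_half// -!EFinM mulrA; congr (_ * _)%:E.
rewrite (_ : 2 * k + 2 = 1 + (2 * k + 1)); last by ring.
by rewrite [RHS]powRD ?e00 ?implybT// powRr1 ?ltW.
Qed.

End power_integrals.

(** * Tail of the discrepancy *)

Section density.
Import HBNNSimple.
Context {d} {T : measurableType d} {R : realType}.
Variables (mu nu : {measure set T -> \bar R}) (rho : T -> R).
Hypothesis rho0 : forall x, 0 <= rho x.
Hypothesis mrho : measurable_fun setT rho.
Hypothesis nuE : forall B, measurable B -> nu B = (\int[mu]_(x in B) (rho x)%:E)%E.

Lemma integral_density_nnsfun (h : {nnsfun T >-> R}) :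
  (\int[nu]_x (h x)%:E = \int[mu]_x ((h x)%:E * (rho x)%:E))%E.
Proof.
rewrite integralT_nnsfun sintegralE.
transitivity (\int[mu]_x \sum_(y \in range h) ((y * \1_(h @^-1` [set y]) x)%:E * (rho x)%:E))%E; last first.
  apply: eq_integral => x _; rewrite [in RHS](fimfunE h) -fsumEFin// ge0_mule_fsuml// => y.
  exact: nnfun_muleindic_ge0.
rewrite ge0_integral_fsum//; last 2 first.
- move=> y; apply: emeasurable_funM; apply/measurable_EFinP => //.
  by apply: measurable_funM => //; exact: measurable_indic.
- by move=> y x _; rewrite mule_ge0 ?nnfun_muleindic_ge0// lee_fin.
apply: eq_fsbigr => y; rewrite inE => -[x _ xy].
have y0 : 0 <= y by rewrite -xy.
have my : measurable (h @^-1` [set y]) by exact: measurable_sfunP.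
rewrite nuE// -ge0_integralZl//; last 2 first.
- by apply: measurable_funTS; exact/measurable_EFinP.
- by move=> ? _; rewrite lee_fin.
rewrite integral_mkcond; apply: eq_integral => z _.
rewrite /patch indicE; case: ifPn => zy; first by rewrite mulr1.
by rewrite mulr0 mul0e.
Qed.

Lemma integral_density (f : T -> \bar R) : measurable_fun setT f -> (forall x, (0 <= f x)%E) ->
  (\int[nu]_x f x = \int[mu]_x (f x * (rho x)%:E))%E.
Proof.
move=> mf f0; pose h := nnsfun_approx measurableT mf.
have mh n : measurable_fun setT (EFin \o h n) by exact/measurable_EFinP.
have hf x : (h n x)%:E @[n --> \oo] --> f x by apply: cvg_nnsfun_approx.
have hm x : {homo (fun n => h n x) : a b / (a <= b)%N >-> a <= b}.
  by move=> a b ab; exact/lefP/nd_nnsfun_approx.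
have -> : (\int[nu]_x f x)%E = limn (fun n => (\int[nu]_x (h n x)%:E)%E).
  rewrite -monotone_convergence//.
  - by apply: eq_integral => x _; apply/esym/cvg_lim.
  - by move=> n x _; rewrite lee_fin.
  - by move=> x _ a b ab; rewrite lee_fin; exact: hm.
under eq_fun do rewrite integral_density_nnsfun.
rewrite -monotone_convergence//.
- apply: eq_integral => x _; apply/cvg_lim => //; apply: cvgeZr => //.
- by move=> n; apply: emeasurable_funM => //; exact/measurable_EFinP.
- by move=> n x _; rewrite mule_ge0 ?lee_fin.
- by move=> x _ a b ab; rewrite lee_wpmul2r ?lee_fin//; exact: hm.
Qed.

End density.

(** * The joint law of two sites *)

Section pair_law.
Context {R : realType} {d} {Om : measurableType d} (P : probability Om R).
Variables (F : int -> Om -> R) (rho : R -> R).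
Hypothesis iid : iid_with_density P F rho.
Notation leb := (@lebesgue_measure R).

Lemma iid_measurable x : measurable_fun setT (F x). Proof. by case: iid. Qed.

Let F0 : Om -> measurableTypeR R := F 0.

Let mF0 : measurable_fun setT F0.
Proof. exact: iid_measurable. Qed.

Let X0 : {mfun Om >-> measurableTypeR R} :=
  HB.pack F0 (@isMeasurableFun.Build _ _ Om (measurableTypeR R) F0 mF0).

Definition law : probability (measurableTypeR R) R := distribution P X0.

Lemma lawE i B : measurable B -> P (F i @^-1` B) = (\int[leb]_(x in B) (rho x)%:E)%E.
Proof.
move=> mB; have := iid.2 [:: i] (fun=> B) isT (fun=> mB).
rewrite big_seq1 => <-; congr (P _); apply/seteqP; split => [w h j /=|w h].
  by rewrite inE => /eqP ->.
by apply: h; rewrite /= inE.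
Qed.

Lemma law_density B : measurable B -> law B = (\int[leb]_(x in B) (rho x)%:E)%E.
Proof. exact: lawE. Qed.

(** The i.i.d. hypothesis at two sites makes the joint law agree with [law \x law] on rectangles,
    hence everywhere; the value of the product measure is by definition the integral of the masses
    of sections. *)
Lemma pair_lawE i j (D : set (R * R)) : i != j -> measurable D ->
  P [set w | D (F i w, F j w)] = (\int[law]_x law (xsection D x))%E.
Proof.
move=> ij mD.
pose fp (w : Om) : (measurableTypeR R * measurableTypeR R)%type := (F i w, F j w).
have mp : measurable_fun setT fp by apply: measurable_fun_pair; exact: iid_measurable.
pose Xp : {mfun Om >-> (measurableTypeR R * measurableTypeR R)%type} :=
  HB.pack fp (@isMeasurableFun.Build _ _ Om (measurableTypeR R * measurableTypeR R)%type fp mp).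
suff H : (law \x law)%E D = distribution P Xp D by rewrite -[RHS]/((law \x law)%E D) H.
apply: product_measure_unique => // A B mA mB.
have := iid.2 [:: i; j] (fun l => if l == i then A else B).
rewrite /= inE ij !big_cons big_nil mule1 eqxx eq_sym (negbTE ij) => /(_ isT).
rewrite -!law_density// => <-; last by move=> l; case: ifP.
congr (P _); apply/seteqP; split => [w [/= wA wB] l /=|w h].
  rewrite !inE => /orP[/eqP->|/eqP->]; first by rewrite eqxx.
  by rewrite eq_sym (negbTE ij).
split => /=; first by have := h i; rewrite /= inE eqxx; apply.
by have := h j; rewrite /= !inE eqxx orbT eq_sym (negbTE ij); apply.
Qed.

End pair_law.

Lemma powRn_large {R : realType} (s M : R) : 0 < s -> \forall n \near \oo, M < n%:R `^ s.
Proof.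
move=> s0; exists (Num.truncn ((`|M| + 1) `^ s^-1)).+1 => // n /= nn.
have M0 : 0 <= `|M| + 1 by rewrite addr_ge0.
have h : (`|M| + 1) `^ s^-1 <= n%:R.
  by apply: (le_trans (ltW (truncnS_gt _))); rewrite ler_nat.
apply: (@lt_le_trans _ _ (((`|M| + 1) `^ s^-1) `^ s)).
  rewrite -powRrM mulVf ?gt_eqF// powRr1//.
  by apply: (le_lt_trans (ler_norm _)); rewrite ltrDl.
by apply: ge0_ler_powR; rewrite ?nnegrE ?powR_ge0// ltW.
Qed.

(** * Asymptotics near the ends of the support *)

Section discrepancy_tail.
Context {R : realType} {d} {Om : measurableType d} (P : probability Om R).
Variables (c q k : R) (rho : R -> R) (F : int -> Om -> R).
Hypotheses (c0 : 0 < c) (q0 : 0 < q) (k1 : -1 < k).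
Hypothesis rho_even : forall x, rho (- x) = rho x.
Hypothesis rho_cont : {in `]- c, c[, continuous rho}.
Hypothesis rho_pos : forall x, - c < x < c -> 0 < rho x.
Hypothesis rho_out : forall x, c <= `|x| -> rho x = 0.
Hypothesis rho_lim : (fun x => rho x / (c - x) `^ k) @ c^'- --> q.
Hypothesis iid : iid_with_density P F rho.
Notation leb := (@lebesgue_measure R).

Let kp : 0 < k + 1. Proof. by rewrite -ltrBlDr sub0r. Qed.

Lemma rho_ge0 x : 0 <= rho x.
Proof.
have [h|h] := ltP `|x| c; last by rewrite rho_out.
by apply/ltW/rho_pos; rewrite -ltr_norml.
Qed.

Lemma measurable_rho : measurable_fun setT rho.
Proof.
have -> : rho = rho \_ `]- c, c[%classic.
  apply/funext => x; rewrite /patch; case: ifPn => // /negP nx.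
  apply: rho_out; rewrite leNgt; apply/negP => h; apply: nx.
  by rewrite inE/= in_itv/= -ltr_norml.
apply/(measurable_restrictT rho (measurable_itv _)); apply: open_continuous_measurable_fun.
  exact: interval_open.
by move=> x; rewrite inE/=; exact: rho_cont.
Qed.

Let mrho_aff (D : set R) (a b : R) : measurable_fun D (fun u : R => (rho (a * u + b))%:E).
Proof.
apply/measurable_EFinP/measurable_funTS; apply: (measurableT_comp measurable_rho).
by apply: measurable_funD => //; exact: measurable_funM.
Qed.

Lemma rho_near_c (e : R) : 0 < e -> exists2 D : R, 0 < D &
  forall u, 0 < u < D -> (q - e) * u `^ k <= rho (c - u) <= (q + e) * u `^ k.
Proof.
move=> e0; move/cvgrPdist_lt: rho_lim => /(_ _ e0) [D /= D0 HD].
exists D => // u /andP[u0 uD].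
have : `|q - rho (c - u) / (c - (c - u)) `^ k| < e.
  apply: HD => /=; last lra.
  by rewrite opprB addrCA subrr addr0 gtr0_norm.
rewrite opprB addrCA subrr addr0 ltr_norml.
have uk : 0 < u `^ k by exact: powR_gt0.
move=> /andP[h1 h2]; apply/andP; split.
  by rewrite -ler_pdivlMr//; lra.
by rewrite -ler_pdivrMr//; lra.
Qed.

Lemma law_tail0 a : c <= a -> law iid `]a, +oo[%classic = 0%E.
Proof.
move=> ca; rewrite law_density// integral0_eq// => x; rewrite /= in_itv/= andbT => ax.
rewrite rho_out//; apply: le_trans (ler_norm _); exact/ltW/(le_lt_trans ca).
Qed.

Lemma law_tailE t : (law iid `](c - t)%R, +oo[%classic = \int[leb]_(u in `]0%R, t[) (rho (c - u))%:E)%E.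
Proof.
rewrite law_density//.
transitivity (\int[leb]_(x in `](c - t)%R, c[) (rho x)%:E)%E.
  rewrite integral_mkcond [RHS]integral_mkcond; apply: eq_integral => x _.
  rewrite /patch !mem_setE !in_itv/= andbT; case: (c - t < x) => //=.
  case: ltP => // cx; rewrite rho_out//; exact: le_trans (ler_norm _).
have h1 : (-1 : R) != 0 by rewrite oppr_eq0 oner_eq0.
rewrite (@lebesgue_integral_affine _ (-1) c _ _ h1)//; last 2 first.
- by apply/measurable_EFinP/measurable_funTS; exact: measurable_rho.
- by move=> x _; rewrite lee_fin rho_ge0.
rewrite normrN1 mul1e.
have -> : (fun x : R => -1 * x + c) @^-1` `](c - t), c[ = `]0, t[%classic :> set R.
  by apply/seteqP; split => x /=; rewrite !in_itv/= => /andP[? ?]; apply/andP; split; lra.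
by apply: eq_integral => x _; rewrite mulN1r addrC.
Qed.

Lemma law_tail_bounds (e D t : R) : 0 < e < q ->
  (forall u, 0 < u < D -> (q - e) * u `^ k <= rho (c - u) <= (q + e) * u `^ k) ->
  0 < t < D ->
  (((q - e) / (k + 1) * t `^ (k + 1))%:E <= law iid `](c - t)%R, +oo[%classic <=
   ((q + e) / (k + 1) * t `^ (k + 1))%:E)%E.
Proof.
move=> /andP[e0 eq] H /andP[t0 tD]; rewrite law_tailE.
have mp (b : R) : measurable_fun `]0, t[ (fun u : R => (b * u `^ k)%:E).
  by apply/measurable_EFinP/measurable_funTS; apply: measurable_funM.
have I (b : R) : 0 <= b -> (\int[leb]_(u in `]0%R, t[) (b * u `^ k)%:E = (b / (k + 1) * t `^ (k + 1))%:E)%E.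
  move=> b0; under eq_integral do rewrite EFinM.
  rewrite ge0_integralZl//; last 2 first.
  - by apply/measurable_EFinP/measurable_funTS; exact: measurable_powR.
  - by move=> x _; rewrite lee_fin powR_ge0.
  by rewrite integral_powR// -EFinM; congr EFin; ring.
have mr : measurable_fun `]0, t[ (fun u : R => (rho (c - u))%:E).
  have := @mrho_aff `]0, t[%classic (-1) c; apply: eq_measurable_fun => x _.
  by rewrite mulN1r addrC.
have b1 : 0 <= q - e by lra.
have b2 : 0 <= q + e by lra.
have Hu x : `]0, t[%classic x -> (q - e) * x `^ k <= rho (c - x) <= (q + e) * x `^ k.
  by rewrite /= in_itv/= => /andP[x0 xt]; apply: H; rewrite x0 (lt_trans xt).
rewrite -(I _ b1) -(I _ b2); apply/andP; split.
- apply: ge0_le_integral; [exact: measurable_itv| |exact: mp|exact: mr|].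
  + by move=> x _; rewrite lee_fin mulr_ge0 ?powR_ge0.
  + by move=> x /Hu /andP[h _]; rewrite lee_fin.
- apply: ge0_le_integral; [exact: measurable_itv| |exact: mr|exact: mp|].
  + by move=> x _; rewrite lee_fin rho_ge0.
  + by move=> x /Hu /andP[_ h]; rewrite lee_fin.
Qed.

(** Here [u] is the distance of [F i] from the lower end [- c]. The event forces [u < e] and puts
    [F j] within [e - u] of the upper end; evenness of [rho] turns the density at [u - c] into that
    at [c - u]. *)
Lemma pair_tailE i j (e : R) : i != j ->
  (P [set w | (2 * c - e < F j w - F i w)%R] =
   \int[leb]_(u in `]0%R, e[) (law iid `](c - (e - u))%R, +oo[%classic * (rho (c - u))%:E))%E.
Proof.
move=> ij; pose A := [set p : R * R | 2 * c - e < p.2 - p.1].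
have mA : measurable A.
  have mf : measurable_fun setT (fun p : R * R => p.2 - p.1) by exact: measurable_funB.
  have := mf measurableT `]2 * c - e, +oo[%classic (measurable_itv _).
  rewrite setTI; congr measurable; apply/seteqP; split => p; by rewrite /A/= in_itv/= andbT.
rewrite (pair_lawE iid ij mA).
rewrite (@integral_density _ (measurableTypeR R) _ lebesgue_measure (law iid) _ rho_ge0 measurable_rho (law_density iid)); last 2 first.
- exact: measurable_fun_xsection.
- by move=> x; exact: measure_ge0.
have xA x : xsection A x = `](x + 2 * c - e)%R, +oo[%classic.
  apply/seteqP; split => y; rewrite /xsection/= inE /A/= in_itv/= andbT => h; lra.
transitivity (\int[leb]_(x in `](- c)%R, (e - c)%R[) (law iid `](x + 2 * c - e)%R, +oo[%classic * (rho x)%:E))%E.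
  rewrite [RHS]integral_mkcond; apply: eq_integral => x _.
  rewrite /patch xA; case: ifPn => //; rewrite notin_setE/= in_itv/= => /negP; rewrite negb_and -!leNgt.
  case/orP => h.
    by rewrite rho_out ?mule0// -normrN; apply: le_trans (ler_norm _); lra.
  by rewrite law_tail0 ?mul0e//; lra.
have h1 : (1 : R) != 0 by rewrite oner_eq0.
have mlaw : measurable_fun setT (fun x : R => law iid `](x + 2 * c - e)%R, +oo[%classic).
  have := measurable_fun_xsection (law iid) mA; apply: eq_measurable_fun => x _.
  by rewrite /= xA.
rewrite (@lebesgue_integral_affine _ 1 (- c) _ _ h1)//; last 2 first.
- apply: emeasurable_funM; apply: measurable_funTS => //.
  by apply/measurable_EFinP; exact: measurable_rho.
- by move=> x _; rewrite mule_ge0 ?lee_fin ?rho_ge0//; exact: measure_ge0.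
rewrite normr1 mul1e.
have -> : (fun x : R => 1 * x + - c) @^-1` `](- c), (e - c)[ = `]0, e[%classic :> set R.
  by apply/seteqP; split => x /=; rewrite !in_itv/= => /andP[? ?]; apply/andP; split; lra.
apply: eq_integral => x _; rewrite mul1r.
rewrite (_ : x - c + 2 * c - e = c - (e - x)); last by ring.
congr (_ * _%:E)%E; rewrite -[LHS]rho_even; congr rho; ring.
Qed.

Let beta := betaR (k + 1) (k + 1).

(** The bounds [u^k] for the density and [(t - u)^(k + 1) / (k + 1)] for the tail multiply to a beta
    integral, whose half value accounts for the denominator [2 * (k + 1)]. The assumption [e < q]
    keeps the lower bounds nonnegative, so that they may be multiplied. *)
Lemma pair_tail_bounds (e : R) : 0 < e < q -> exists2 D : R, 0 < D &
  forall i j t, i != j -> 0 < t < D ->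
  (((q - e) ^+ 2 * (beta / (2 * (k + 1))) * t `^ (2 * k + 2))%:E <=
    P [set w | (2 * c - t < F j w - F i w)%R] <=
   ((q + e) ^+ 2 * (beta / (2 * (k + 1))) * t `^ (2 * k + 2))%:E)%E.
Proof.
move=> /andP[e0 eq]; have [D D0 H] := rho_near_c e0; exists D => // i j t ij /andP[t0 tD].
rewrite pair_tailE//.
have mp (b : R) : measurable_fun `]0, t[ (fun u : R => (b * (u `^ k * (t - u) `^ (k + 1)))%:E).
  apply/measurable_EFinP/measurable_funTS; apply: measurable_funM => //.
  apply: measurable_funM; first exact: measurable_powR.
  by apply: (measurableT_comp (measurable_powR (k + 1))); exact: measurable_funB.
have I (b : R) : 0 <= b -> (\int[leb]_(u in `]0%R, t[) (b ^+ 2 / (k + 1) * (u `^ k * (t - u) `^ (k + 1)))%:E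
   = (b ^+ 2 * (beta / (2 * (k + 1))) * t `^ (2 * k + 2))%:E)%E.
  move=> b0; under eq_integral do rewrite EFinM.
  rewrite ge0_integralZl//; last 3 first.
  - by have := mp 1; apply: eq_measurable_fun => x _; rewrite mul1r.
  - by move=> x _; rewrite lee_fin mulr_ge0 ?powR_ge0.
  - by rewrite lee_fin divr_ge0 ?sqr_ge0// ltW.
  rewrite integral_beta_scaled// -EFinM -/beta; congr EFin; field.
  by rewrite gt_eqF.
have mr : measurable_fun `]0, t[ (fun u : R => (rho (c - u))%:E).
  have := @mrho_aff `]0, t[%classic (-1) c; apply: eq_measurable_fun => x _.
  by rewrite mulN1r addrC.
have ml : measurable_fun `]0, t[ (fun u : R => law iid `](c - (t - u))%R, +oo[%classic).
  have mA : measurable [set p : R * R | c - (t - p.1) < p.2].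
    have mf : measurable_fun setT (fun p : R * R => p.2 - (c - (t - p.1))).
      apply: measurable_funB => //; apply: measurable_funB => //; exact: measurable_funB.
    have := mf measurableT `]0, +oo[%classic (measurable_itv _).
    by rewrite setTI; congr measurable; apply/seteqP; split => p; rewrite /= in_itv/= andbT subr_gt0.
  apply: measurable_funTS; have := measurable_fun_xsection (law iid) mA; apply: eq_measurable_fun => x _.
  congr (law iid _); apply/seteqP; split => y; by rewrite /xsection/= inE/= in_itv/= andbT.
have b1 : 0 <= q - e by lra.
have b2 : 0 <= q + e by lra.
have Hu x : `]0, t[%classic x -> ((q - e) * x `^ k <= rho (c - x) <= (q + e) * x `^ k) /\
   (((q - e) / (k + 1) * (t - x) `^ (k + 1))%:E <= law iid `](c - (t - x))%R, +oo[%classic <=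
   ((q + e) / (k + 1) * (t - x) `^ (k + 1))%:E)%E.
  rewrite /= in_itv/= => /andP[x0 xt]; split; first by apply: H; rewrite x0 (lt_trans xt).
  by apply: (law_tail_bounds _ H); [rewrite e0|apply/andP; split; lra].
have split_b (b : R) x : ((b ^+ 2 / (k + 1) * (x `^ k * (t - x) `^ (k + 1)))%:E =
   (b / (k + 1) * (t - x) `^ (k + 1))%:E * (b * x `^ k)%:E)%E.
  by rewrite -EFinM; congr EFin; field; rewrite gt_eqF.
rewrite -(I _ b1) -(I _ b2); apply/andP; split.
- apply: ge0_le_integral; [exact: measurable_itv| |exact: mp|exact: emeasurable_funM|].
  + by move=> x _; rewrite lee_fin !mulr_ge0 ?powR_ge0 ?invr_ge0 ?sqr_ge0// ltW.
  + move=> x /Hu [/andP[h1 _] /andP[h2 _]]; rewrite split_b lee_pmul ?lee_fin//.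
    * by rewrite !mulr_ge0 ?powR_ge0 ?invr_ge0// ltW.
    * by rewrite mulr_ge0 ?powR_ge0.
- apply: ge0_le_integral; [exact: measurable_itv| |exact: emeasurable_funM|exact: mp|].
  + by move=> x _; rewrite mule_ge0 ?lee_fin ?rho_ge0//; exact: measure_ge0.
  + move=> x /Hu [/andP[_ h1] /andP[_ h2]]; by rewrite split_b lee_pmul ?lee_fin ?rho_ge0.
Qed.

Lemma discrepancy_ltE x (e : R) w : 0 < e -> e < 2 * c -> discrepancy c F x w < e <->
  (2 * c - e < F (x + 1) w - F x w \/ 2 * c - e < F x w - F (x + 1) w).
Proof.
move=> e0 ec; rewrite /discrepancy; set u := F (x + 1) w; set v := F x w.
split.
  move=> h; have : 2 * c - e < `|u - v| by lra.
  by rewrite ltr_normr opprB => /orP.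
move=> h; have : 2 * c - e < `|u - v| by rewrite ltr_normr opprB; apply/orP.
lra.
Qed.

Lemma measurable_lt_diff (a : R) i j : measurable [set w | a < F j w - F i w].
Proof.
have mf : measurable_fun setT (fun w => F j w - F i w).
  by apply: measurable_funB; exact: iid_measurable iid _.
have := mf measurableT `]a, +oo[%classic (measurable_itv _).
by rewrite setTI; congr measurable; apply/seteqP; split => p; rewrite /= in_itv/= andbT.
Qed.

(** For [e < 2c] the two signs of the difference exclude each other. Both terms obey the same
    bounds, whence the factor 2 between [beta / (2 * (k + 1))] and the constant of the discrepancy
    tail. *)
Lemma discrepancy_lt_measure x (e : R) : 0 < e -> e < 2 * c ->
  (P [set w | (discrepancy c F x w < e)%R] =
   P [set w | (2 * c - e < F (x + 1)%R w - F x w)%R] +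
   P [set w | (2 * c - e < F x w - F (x + 1)%R w)%R])%E.
Proof.
move=> e0 ec.
rewrite -measureU; [|exact: measurable_lt_diff|exact: measurable_lt_diff|].
  congr (P _); apply/seteqP; split => w.
    by move=> /(discrepancy_ltE _ _ e0 ec).
  by move=> h; exact/(discrepancy_ltE _ _ e0 ec).
by rewrite -subset0 => w /= [h1 h2]; lra.
Qed.

Lemma discrepancy_tail_cvg (th : R) : 0 < th -> exists2 D : R, 0 < D &
  forall x t, 0 < t < D ->
  `|fine (P [set w | discrepancy c F x w < t]) -
    q ^+ 2 * (beta / (k + 1)) * t `^ (2 * k + 2)| <= th * t `^ (2 * k + 2).
Proof.
move=> th0.
have b0 : 0 <= beta by apply: fine_ge0; apply: integral_ge0 => u _; rewrite lee_fin mulr_ge0 ?powR_ge0.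
pose K := beta / (k + 1).
have K0 : 0 <= K by rewrite divr_ge0// ltW.
(* For [e <= q] the squares of [q + e] and [q - e] differ from [q ^+ 2] by at most [3 * q * e], so
   the error is at most [3 * q * e * K], and this is at most [th]; the added 1 avoids a division by
   0. *)
pose e := Num.min (q / 2) (th / (3 * q * K + 1)).
have qK : 0 < 3 * q * K + 1 by have := mulr_ge0 (ltW q0) K0; lra.
have e0 : 0 < e by rewrite lt_min divr_gt0//= divr_gt0.
have eq2 : e <= q / 2 by rewrite ge_min lexx.
have eq : e < q by lra.
have eth : e * (3 * q * K + 1) <= th by rewrite -ler_pdivlMr// ge_min lexx orbT.
have [|D D0 H] := @pair_tail_bounds e; first by rewrite e0.
exists (Num.min D (2 * c)); first by rewrite lt_min D0/= mulr_gt0.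
move=> x t /andP[t0]; rewrite lt_min => /andP[tD tc].
have x1 : x + 1 != x by rewrite -subr_eq0 addrAC subrr add0r oner_eq0.
have tD' : 0 < t < D by rewrite t0.
have x1' : x != x + 1 by rewrite eq_sym.
have := H _ _ t x1 tD'; have := H _ _ t x1' tD'.
rewrite discrepancy_lt_measure//.
have Pf i j : P [set w | 2 * c - t < F j w - F i w] \is a fin_num.
  by apply: fin_num_measure; apply: measurable_lt_diff.
rewrite fineD//; rewrite -(fineK (Pf x (x + 1))) -(fineK (Pf (x + 1) x)) !lee_fin/=.
set A := fine _; set B := fine _ => /andP[h1 h2] /andP[h3 h4].
have Kb : beta / (2 * (k + 1)) = K / 2 by rewrite /K; field; rewrite gt_eqF.
move: h1 h2 h3 h4; rewrite Kb.
have : 0 <= t `^ (2 * k + 2) by exact: powR_ge0.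
move: (t `^ _) => y y0 h1 h2 h3 h4.
rewrite -/K.
have Ky : 0 <= K * y by exact: mulr_ge0.
have e2 : (q + e) ^+ 2 - q ^+ 2 <= 3 * q * e by nra.
have e3 : q ^+ 2 - (q - e) ^+ 2 <= 3 * q * e by nra.
have e4 : 3 * q * e * (K * y) <= th * y.
  have : e * (3 * q * K) * y <= th * y by apply: ler_wpM2r => //; lra.
  by rewrite (_ : e * (3 * q * K) * y = 3 * q * e * (K * y)); last ring.
have e5 := ler_wpM2r Ky e2; have e6 := ler_wpM2r Ky e3.
rewrite ler_norml; apply/andP; split; nra.
Qed.

Lemma measurable_normF (a : R) i : measurable [set w | a < `|F i w|].
Proof.
have mf : measurable_fun setT (fun w => `|F i w|).
  by apply: measurableT_comp => //; exact: iid_measurable iid _.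
have := mf measurableT `]a, +oo[%classic (measurable_itv _).
by rewrite setTI; congr measurable; apply/seteqP; split => p; rewrite /= in_itv/= andbT.
Qed.

Lemma law_far_cvg (th : R) : 0 < th -> exists2 D : R, 0 < D &
  forall i t, 0 < t < D -> fine (P [set w | c - t < `|F i w|]) <= th.
Proof.
move=> th0; have q0' := q0; have e2 : 0 < q / 2 < q by apply/andP; split; lra.
have /andP[e20 _] := e2; have [D D0 H] := rho_near_c e20.
pose C := (q + q / 2) / (k + 1).
have C0 : 0 < C by rewrite divr_gt0//; lra.
have C2 : 0 < 2 * C by lra.
have : \forall t \near 0^'+, `|0 - t `^ (k + 1)| < th / (2 * C).
  by move/cvgrPdist_lt: (powR_cvg0 kp); apply; rewrite divr_gt0.
move=> [D2 /= D20 H2].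
exists (Num.min D (Num.min D2 c)); first by rewrite !lt_min D0 D20.
move=> i t; rewrite !lt_min => /andP[t0 /and3P[tD tD2 tc]].
have tD' : 0 < t < D by rewrite t0.
have h2 : t `^ (k + 1) < th / (2 * C).
  have := H2 t; rewrite /= !sub0r !normrN (gtr0_norm t0) => /(_ tD2 t0).
  by rewrite ger0_norm ?powR_ge0.
have hl : (P [set w | (c - t < F i w)%R] <= (C * t `^ (k + 1))%:E)%E.
  have -> : [set w | c - t < F i w] = F i @^-1` `]c - t, +oo[.
    by apply/seteqP; split => w; rewrite /= in_itv/= andbT.
  rewrite (lawE iid)// -(law_density iid)//.
  by have /andP[] := law_tail_bounds e2 H tD'.
have hr : (P [set w | (F i w < t - c)%R] <= (C * t `^ (k + 1))%:E)%E.
  have -> : [set w | F i w < t - c] = F i @^-1` `]-oo, t - c[.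
    by apply/seteqP; split => w; rewrite /= in_itv/=.
  rewrite (lawE iid)//.
  (* Reflection and evenness of [rho] reduce the left tail to the right one. *)
  have h1 : (-1 : R) != 0 by rewrite oppr_eq0 oner_eq0.
  rewrite (@lebesgue_integral_affine _ (-1) 0 _ _ h1)//; last 2 first.
  - by apply/measurable_EFinP/measurable_funTS; exact: measurable_rho.
  - by move=> x _; rewrite lee_fin rho_ge0.
  rewrite normrN1 mul1e.
  have -> : (fun x : R => -1 * x + 0) @^-1` `]-oo, (t - c)[ = `]c - t, +oo[%classic :> set R.
    by apply/seteqP; split => x /=; rewrite !in_itv/= andbT => ?; lra.
  under eq_integral do rewrite mulN1r addr0 rho_even.
  rewrite -(law_density iid)//.
  by have /andP[] := law_tail_bounds e2 H tD'.
have mi (a : R) : measurable [set w | a < F i w].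
  have := iid_measurable iid i measurableT (measurable_itv `]a, +oo[).
  by rewrite setTI; congr measurable; apply/seteqP; split => p; rewrite /= in_itv/= andbT.
have mi' (a : R) : measurable [set w | F i w < a].
  have := iid_measurable iid i measurableT (measurable_itv `]-oo, a[).
  by rewrite setTI; congr measurable; apply/seteqP; split => p; rewrite /= in_itv/=.
have -> : [set w | c - t < `|F i w|] = [set w | c - t < F i w] `|` [set w | F i w < t - c].
  apply/seteqP; split => w /=; rewrite ltr_normr.
    by move=> /orP[|h]; [left|right; lra].
  by move=> [->//|h]; apply/orP; right; lra.
rewrite -lee_fin fineK ?fin_num_measure//; last exact: measurableU.
apply: (le_trans (measureU2 _ _ _)) => //.
apply: (le_trans (leeD hl hr)); rewrite -EFinD lee_fin.
have := ltW h2; rewrite ler_pdivlMr//.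
lra.
Qed.

(* If both discrepancies at [x] and [x + 1] are below [t] then [|F (x + 2)| > c - t]
   almost surely, and this event is independent of the first discrepancy. *)
Lemma adjacent_cvg (th : R) : 0 < th -> exists2 D : R, 0 < D &
  forall x (t : R), 0 < t < D ->
  fine (P ([set w | discrepancy c F x w < t] `&` [set w | discrepancy c F (x + 1) w < t])) <=
  th * fine (P [set w | discrepancy c F x w < t]).
Proof.
move=> th0; have [D D0 H] := law_far_cvg th0; exists D => // x t tD.
set E1 := [set w | discrepancy c F x w < t].
set E2 := [set w | discrepancy c F (x + 1) w < t].
set G := [set w | c - t < `|F (x + 1 + 1) w|].
have mdisc : measurable [set p : R * R | 2 * c - `|p.2 - p.1| < t].
  have mf : measurable_fun setT (fun p : R * R => 2 * c - `|p.2 - p.1|).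
    apply: measurable_funB => //; apply: measurableT_comp => //; exact: measurable_funB.
  have := mf measurableT `]-oo, t[%classic (measurable_itv _).
  by rewrite setTI; congr measurable; apply/seteqP; split => p; rewrite /= in_itv/=.
have mnorm : measurable [set p : R * R | c - t < `|p.1|].
  have mf : measurable_fun setT (fun p : R * R => `|p.1|).
    by apply: measurableT_comp => //; exact: measurable_fst.
  have := mf measurableT `]c - t, +oo[%classic (measurable_itv _).
  by rewrite setTI; congr measurable; apply/seteqP; split => p; rewrite /= in_itv/= andbT.
have s1 (y : int) : sigma_of F [:: y; y + 1] [set w | discrepancy c F y w < t].
  have h1 : y \in [:: y; y + 1] by rewrite inE eqxx.
  have h2 : y + 1 \in [:: y; y + 1] by rewrite !inE eqxx orbT.
  exact: (@sigma_of_pair _ _ _ F _ _ _ _ h1 h2 mdisc).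
have s2 : sigma_of F [:: x + 1 + 1] G.
  have h1 : x + 1 + 1 \in [:: x + 1 + 1] by rewrite inE.
  exact: (@sigma_of_pair _ _ _ F _ _ _ _ h1 h1 mnorm).
have mE1 : measurable E1 by exact: (sigma_of_measurable iid (s1 x)).
have mE2 : measurable E2 by exact: (sigma_of_measurable iid (s1 (x + 1))).
have mG : measurable G by exact: measurable_normF.
have mZ : measurable [set w | c <= `|F (x + 1) w|].
  have mf : measurable_fun setT (fun w => `|F (x + 1) w|).
    by apply: measurableT_comp => //; exact: iid_measurable iid _.
  have := mf measurableT `[c, +oo[%classic (measurable_itv _).
  by rewrite setTI; congr measurable; apply/seteqP; split => p; rewrite /= in_itv/= andbT.
have PZ : P [set w | c <= `|F (x + 1) w|] = 0%E.
  have mB : measurable [set y : R | c <= `|y|].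
    have mf : measurable_fun setT (fun y : R => `|y|) by exact: measurableT_comp.
    have := mf measurableT `[c, +oo[%classic (measurable_itv _).
    by rewrite setTI; congr measurable; apply/seteqP; split => p; rewrite /= in_itv/= andbT.
  rewrite -[X in P X]/(F (x + 1) @^-1` [set y : R | c <= `|y|]) (lawE iid)//.
  by rewrite integral0_eq// => y /= /rho_out ->.
have sub : E1 `&` E2 `<=` (E1 `&` G) `|` [set w | c <= `|F (x + 1) w|].
  move=> w [h1 h2]; have [h|h] := leP c `|F (x + 1) w|; [by right|left; split => //].
  move: h2; rewrite /E2 /G /discrepancy/= => h2.
  have := ler_normB (F (x + 1 + 1) w) (F (x + 1) w); lra.
have mEG : measurable (E1 `&` G) by exact: measurableI.
have ind : P (E1 `&` G) = (P E1 * P G)%E.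
  apply: (sigma_of_indep iid _ (s1 x) s2).
  have u1 (a : int) : (a == a + 1) = false by apply/eqP; lia.
  have u2 : (x == x + 1 + 1) = false by apply/eqP; lia.
  by rewrite /= !inE !u1 u2.
rewrite -lee_fin EFinM !fineK ?fin_num_measure//; last exact: measurableI.
apply: (@le_trans _ _ (P ((E1 `&` G) `|` [set w | c <= `|F (x + 1) w|]))).
  by apply: le_measure; rewrite ?inE//; [exact: measurableI|exact: measurableU].
apply: (le_trans (measureU2 _ _ _)) => //.
rewrite [X in (_ + X <= _)%E]PZ adde0 [leLHS]ind muleC; apply: lee_wpmul2r => //.
have := H (x + 1 + 1) t tD; rewrite -lee_fin fineK// fin_num_measure//.
Qed.

Let zt := zeta k.

Lemma zeta_gt0 : 0 < zt.
Proof. by have k1' := k1; rewrite /zt /zeta divr_gt0//; lra. Qed.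

Let k3 : 2 * k + 3 != 0. Proof. by have k1' := k1; rewrite gt_eqF//; lra. Qed.

Lemma onem_zetaE : 1 - zt = (2 * k + 3)^-1.
Proof. by rewrite /zt /zeta; field. Qed.

(** This identity is what fixes [zeta]: it amounts to [(1 - zeta) (2k + 2) = zeta]. *)
Lemma scale_powR n (z : R) : (0 < n)%N -> 0 < z ->
  (z / n%:R `^ (1 - zt)) `^ (2 * k + 2) = z `^ (2 * k + 2) * n%:R `^ (- zt).
Proof.
move=> n0 z0; have nn : 0 < n%:R :> R by rewrite ltr0n.
rewrite -powRN powRM ?powR_ge0 ?ltW// -powRrM; congr (_ * _ `^ _).
by rewrite onem_zetaE /zt /zeta; field.
Qed.

Lemma scale_large (M : R) : \forall n \near \oo, M < n%:R `^ (1 - zt).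
Proof. by apply: powRn_large; have k1' := k1; rewrite onem_zetaE invr_gt0; lra. Qed.

Lemma discrepancy_scaled n x w z : (0 < n)%N ->
  (n%:R `^ (1 - zt) * discrepancy c F x w < z) = (discrepancy c F x w < z / n%:R `^ (1 - zt)).
Proof.
by move=> n0; rewrite ltr_pdivlMr ?powR_gt0 ?ltr0n// mulrC.
Qed.

Lemma scaled_tail_cvg (z th : R) : 0 < z -> 0 < th -> \forall n \near \oo, forall x,
  `|fine (P [set w | n%:R `^ (1 - zt) * discrepancy c F x w < z]) -
    q ^+ 2 * (beta / (k + 1)) * z `^ (2 * k + 2) * n%:R `^ (- zt)| <= th * n%:R `^ (- zt).
Proof.
move=> z0 th0; have zp : 0 < z `^ (2 * k + 2) by exact: powR_gt0.
have [|D D0 H] := @discrepancy_tail_cvg (th / z `^ (2 * k + 2)); first by rewrite divr_gt0.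
apply: filterS2 (nbhs_infty_ge 1) (scale_large (z / D)) => n n0 nD x.
have nn : 0 < n%:R `^ (1 - zt) :> R by apply: powR_gt0; rewrite ltr0n.
have := H x (z / n%:R `^ (1 - zt)); rewrite divr_gt0//= ltr_pdivrMr// mulrC -ltr_pdivrMr//.
move=> /(_ nD); rewrite scale_powR// !mulrA divfK ?gt_eqF//.
by under eq_set do rewrite -discrepancy_scaled//.
Qed.

Lemma scaled_adjacent_cvg (z th : R) : 0 < z -> 0 < th -> \forall n \near \oo, forall x,
  fine (P ([set w | n%:R `^ (1 - zt) * discrepancy c F x w < z] `&`
           [set w | n%:R `^ (1 - zt) * discrepancy c F (x + 1) w < z])) <=
  th * fine (P [set w | n%:R `^ (1 - zt) * discrepancy c F x w < z]).
Proof.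
move=> z0 th0; have [D D0 H] := adjacent_cvg th0.
apply: filterS2 (nbhs_infty_ge 1) (scale_large (z / D)) => n n0 nD x.
have nn : 0 < n%:R `^ (1 - zt) :> R by apply: powR_gt0; rewrite ltr0n.
have := H x (z / n%:R `^ (1 - zt)); rewrite divr_gt0//= ltr_pdivrMr// mulrC -ltr_pdivrMr//.
move=> /(_ nD).
by under eq_set do rewrite -discrepancy_scaled//; under [in X in _ `&` X]eq_set do rewrite -discrepancy_scaled//.
Qed.

End discrepancy_tail.

(** * Counts in triangular arrays *)

(** The sets are disjoint, so at most one indicator is nonzero and both sides equal the
    corresponding [s i], or 1. This identifies the product over sites with the generating function
    of the counts. *)
Lemma subr_sum_indic {R : realType} {T : Type} M (s : nat -> R) (e : nat -> set T) w :
  (forall i j, i != j -> e i `&` e j = set0) ->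
  1 - \sum_(i < M) (1 - s i) * \1_(e i) w = \prod_(i < M) s i ^+ (w \in e i).
Proof.
move=> ed; have [[i0 i0e]|no] := pselect (exists i : 'I_M, e i w).
  have h (i : 'I_M) : i != i0 -> (w \in e i) = false.
    move=> ii; apply/negbTE/negP; rewrite inE => iw.
    have : (e i `&` e i0) w by [].
    by rewrite ed.
  rewrite (bigD1 i0)//= [X in 1 - (_ + X)]big1 ?addr0; last first.
    by move=> i /h ii; rewrite indicE ii mulr0.
  rewrite [RHS](bigD1 i0)//= [X in _ = _ * X]big1 ?mulr1; last first.
    by move=> i /h ->; rewrite expr0.
  by rewrite indicE mem_set//= mulr1 expr1 opprB addrCA subrr addr0.
have h (i : 'I_M) : (w \in e i) = false.
  by apply/negbTE/negP; rewrite inE => iw; apply: no; exists i.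
by rewrite !big1 ?subr0// => i _; rewrite ?indicE h ?mulr0 ?expr0.
Qed.

Section pgf_limit.
Context {R : realType} {d : measure_display} {Om : measurableType d}.
Variables (P : probability Om R) (M : nat) (la : nat -> R) (K : nat -> nat).
Variables (e : nat -> nat -> nat -> set Om) (b : nat -> R).
Hypothesis me : forall n y i, measurable (e n y i).
Hypothesis ed : forall n y i j, i != j -> e n y i `&` e n y j = set0.
Hypothesis indep : forall n x, exists A : set (set Om),
  [/\ A `<=` measurable, setI_closed A, A setT, forall y i, (y < x)%N -> A (e n y i) &
    forall i X, A X -> P (e n x.+1 i `&` X) = (P (e n x.+1 i) * P X)%E].
Hypothesis mean_cvg : forall i : 'I_M,
  (fun n => \sum_(y < (K n).+1) fine (P (e n y i))) @ \oo --> la i.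
Hypothesis Pb : \forall n \near \oo, forall y,
  fine (P (\bigcup_(i in `I_M) e n y i)) <= b n.
Hypothesis Pa : forall th : R, 0 < th -> \forall n \near \oo, forall y,
  (K n).+1%:R *
  fine (P ((\bigcup_(i in `I_M) e n y i) `&` (\bigcup_(i in `I_M) e n y.+1 i))) <= th.
Hypothesis b0 : (fun n => (K n).+1%:R * b n ^+ 2) @ \oo --> 0.

Let N n i w : nat := (\sum_(y < (K n).+1) (w \in e n y i))%N.

Section fixed_s.
Variable s : nat -> R.
Hypothesis s01 : forall i, 0 < s i < 1.

Let h n y w : R := \sum_(i < M) (1 - s i) * \1_(e n y i) w.
Let B n y := \bigcup_(i in `I_M) e n y i.

Let mB n y : measurable (B n y).
Proof. by apply: bigcup_measurable => i _. Qed.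

Let bh n y : bounded_mfun (h n y).
Proof.
apply: bounded_mfun_sum => i _; apply: bounded_mfunM; [exact: bounded_mfun_cst|exact: bounded_mfun_indic].
Qed.

Let h01 n y w : 0 <= h n y w <= 1.
Proof.
apply/andP; split.
  apply: sumr_ge0 => i _; rewrite mulr_ge0// ?subr_ge0 ?indicE//.
  by have /andP[_ /ltW] := s01 i.
rewrite -subr_ge0 (@subr_sum_indic R Om M s (e n y) w (ed n y)); apply: prodr_ge0 => i _.
by apply: exprn_ge0; have /andP[/ltW] := s01 i.
Qed.

Let hB n y w : h n y w <= \1_(B n y) w.
Proof.
rewrite indicE; case: (boolP (w \in B n y)) => [_|wB]; first by have /andP[] := h01 n y w.
rewrite /h big1// => i _; rewrite indicE; case: (boolP (w \in _)) => [|_]; last by rewrite mulr0.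
rewrite inE => we; exfalso; move/negP: wB; apply; rewrite inE; exists i => //=.
Qed.

Let Eh n y : Ex P (h n y) = \sum_(i < M) (1 - s i) * fine (P (e n y i)).
Proof. by rewrite Ex_sum_indic. Qed.

Let Eh01 n y : 0 <= Ex P (h n y) <= 1.
Proof.
apply/andP; split; first by apply: Ex_ge0 => w; have /andP[] := h01 n y w.
rewrite -(Ex_cst P 1); apply: Ex_le => //; first exact: bounded_mfun_cst.
by move=> w; have /andP[] := h01 n y w.
Qed.

Let EhB n y : Ex P (h n y) <= fine (P (B n y)).
Proof. by rewrite -Ex_indic//; apply: Ex_le => //; exact: bounded_mfun_indic. Qed.

Let EhhB n y : Ex P (fun w => h n y w * h n y.+1 w) <= fine (P (B n y `&` B n y.+1)).
Proof.
have mI : measurable (B n y `&` B n y.+1) by exact: measurableI.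
rewrite -Ex_indic//; apply: Ex_le => //; [exact: bounded_mfunM|exact: bounded_mfun_indic|move=> w].
rewrite indicI; have /andP[h1 _] := h01 n y w; have /andP[h2 _] := h01 n y.+1 w.
exact: ler_pM.
Qed.

Let indep_h n x : Ex P (fun w => h n x.+1 w * \prod_(y < x) (1 - h n y w)) =
  Ex P (h n x.+1) * Ex P (fun w => \prod_(y < x) (1 - h n y w)).
Proof.
have [A [Am AI AT Ae AP]] := indep n x.
have bp : bounded_mfun (fun w => \prod_(y < x) (1 - h n y w)).
  by apply: bounded_mfun_prod => y _; apply: bounded_mfunB => //; exact: bounded_mfun_cst.
have -> : (fun w => h n x.+1 w * \prod_(y < x) (1 - h n y w)) =
  (fun w => \sum_(i < M) (1 - s i) * (\1_(e n x.+1 i) w * \prod_(y < x) (1 - h n y w))).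
  by apply/funext => w; rewrite /h mulr_suml; apply: eq_bigr => i _; rewrite mulrA.
rewrite Ex_sum; last first.
  move=> i _; apply: bounded_mfunM; [exact: bounded_mfun_cst|apply: bounded_mfunM => //; exact: bounded_mfun_indic].
rewrite Eh mulr_suml; apply: eq_bigr => i _.
rewrite ExZ; last by apply: bounded_mfunM => //; exact: bounded_mfun_indic.
rewrite -mulrA; congr (_ * _).
apply: (@indep_indic_prod _ _ _ P A M (fun i => 1 - s i) (fun y i => e n y i) x) => //.
  by move=> y j yx; exact: Ae.
by move=> X AX; exact: AP.
Qed.

Lemma pgf_limit_fixed : (fun n => Ex P (fun w => \prod_(i < M) s i ^+ N n i w)) @ \oo -->
  \prod_(i < M) expR (- ((1 - s i) * la i)).
Proof.
pose mn n := \sum_(y < (K n).+1) Ex P (h n y).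
have mnE n : mn n = \sum_(i < M) (1 - s i) * \sum_(y < (K n).+1) fine (P (e n y i)).
  rewrite /mn; under eq_bigr do rewrite Eh.
  by rewrite exchange_big; apply: eq_bigr => i _; rewrite mulr_sumr.
have mn_cvg : mn @ \oo --> \sum_(i < M) (1 - s i) * la i.
  under eq_cvg do rewrite mnE.
  apply: cvg_sumr => i; apply: cvgMr; exact: mean_cvg.
have e_cvg : (fun n => expR (- mn n)) @ \oo --> expR (- \sum_(i < M) (1 - s i) * la i).
  apply: (@continuous_cvg _ _ _ _ _ _ expR); first exact: continuous_expR.
  exact: cvgN.
have prodE : \prod_(i < M) expR (- ((1 - s i) * la i)) = expR (- \sum_(i < M) (1 - s i) * la i).
  by rewrite -sumrN expR_sum.
rewrite prodE; apply/cvgrPdist_le => /= eps eps0.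
(* Four errors: joint hits of neighbours, products of neighbouring means, squared means in
   [prod_exp_le], and the convergence of the total mean. The second and third are both bounded by
   [(K n).+1 * b n ^+ 2]. *)
have eps4 : 0 < eps / 4 by rewrite divr_gt0.
move/cvgrPdist_le: e_cvg => /(_ _ eps4) H1.
move/cvgrPdist_le: b0 => /(_ _ eps4) H3.
apply: filterS (filterI (filterI H1 H3) (filterI (Pa eps4) Pb)) => n.
move=> [[h1 h3] [pa' pb]].
have K0 : 0 < (K n).+1%:R :> R by rewrite ltr0n.
pose a := eps / 4 / (K n).+1%:R.
have h2 : (K n).+1%:R * a <= eps / 4 by rewrite /a mulrC divfK ?gt_eqF.
have pa y : fine (P (B n y `&` B n y.+1)) <= a by rewrite /a ler_pdivlMr// mulrC; exact: pa'.
have -> : (fun w => \prod_(i < M) s i ^+ N n i w) = (fun w => \prod_(y < (K n).+1) (1 - h n y w)).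
  apply/funext => w.
  transitivity (\prod_(y < (K n).+1) \prod_(i < M) s i ^+ (w \in e n y i)).
    by rewrite exchange_big; apply: eq_bigr => i _; rewrite /N expr_sum.
  by apply: eq_bigr => y _; rewrite -(@subr_sum_indic R Om M s (e n y) w (ed n y)).
have D1 := @one_dependent_prod _ _ _ P (h n) (K n) (bh n) (h01 n) (indep_h n).
have D2 := @prod_exp_le _ (fun y => Ex P (h n y)) (K n).+1 (Eh01 n).
have E0 y : 0 <= Ex P (h n y) by have /andP[] := Eh01 n y.
have Eb y : Ex P (h n y) <= b n by apply: le_trans (pb y).
have bn0 : 0 <= b n by apply: le_trans (E0 0%N) (Eb 0%N).
have an0 : 0 <= a by rewrite divr_ge0// ltW.
have S1 : \sum_(y < K n) (Ex P (fun w => h n y w * h n y.+1 w) + Ex P (h n y) * Ex P (h n y.+1))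
    <= (K n).+1%:R * a + (K n).+1%:R * b n ^+ 2.
  apply: (@le_trans _ _ (\sum_(y < K n) (a + b n ^+ 2))).
    apply: ler_sum => y _; apply: lerD; first exact: le_trans (pa y).
    by rewrite expr2; apply: ler_pM.
  rewrite -mulrDr sumr_const card_ord -[leLHS]mulr_natl ler_wpM2r ?ler_nat//.
  by rewrite addr_ge0// sqr_ge0.
have S2 : \sum_(y < (K n).+1) Ex P (h n y) ^+ 2 <= (K n).+1%:R * b n ^+ 2.
  apply: (@le_trans _ _ (\sum_(y < (K n).+1) b n ^+ 2)).
    by apply: ler_sum => y _; rewrite !expr2; apply: ler_pM.
  by rewrite sumr_const card_ord -[leLHS]mulr_natl.
have b2 : 0 <= (K n).+1%:R * b n ^+ 2 by rewrite mulr_ge0// sqr_ge0.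
rewrite sub0r normrN (ger0_norm b2) in h3.
have T1 := le_trans D1 S1; have T2 := le_trans D2 S2.
set X := Ex _ _ in T1 *; set Y := \prod_(y < _) _ in T1 T2; rewrite -/(mn n) in T2.
set Z := expR (- mn n) in T2 h1; set W := expR _ in h1 *.
have := ler_distD Z W X; have := ler_distD Y Z X.
rewrite (distrC Z Y) (distrC Y X) => /= U1 U2; move: h1 h2 h3 T1 T2 U1 U2.
move: (`|W - X|) (`|W - Z|) (`|Z - X|) (`|Y - Z|) (`|X - Y|) (_ * a) (_ * b n ^+ 2).
by move=> *; lra.
Qed.

End fixed_s.

Lemma poisson_counts_cvg (k : nat -> nat) : (forall i, 0 <= la i) ->
  (fun n => fine (P (\bigcap_(i in `I_M) [set w | N n i w = k i]))) @ \oo -->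
  \prod_(i < M) poisson_mass (la i) (k i).
Proof.
move=> la0; apply: pgf_counts_cvg => // [n i|s s01]; last exact: pgf_limit_fixed.
rewrite /N; elim: (K n).+1 => [|m IH].
  by under eq_fun do rewrite big_ord0; exact: measurable_cst.
under eq_fun do rewrite big_ord_recr/=.
apply: measurable_fun_addn => //.
apply: (@measurableT_comp _ _ _ _ _ _ nat_of_bool) => //.
apply: (measurable_fun_bool true); rewrite setTI.
by rewrite [X in measurable X](_ : _ = e n m i)//; apply/seteqP; split => w /=; [move/set_mem|move=> /mem_set].
Qed.

End pgf_limit.

(** * Cell counts of the rescaled point process *)

(** The first [2 * L] values of the enumeration are exactly [- L, ..., L - 1]; increasing [L] by one
    adds one integer at each end. *)
Lemma sum_enum_int {V : nmodType} (phi : int -> V) L :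
  \sum_(j < 2 * L) phi (enum_int j) = \sum_(y < 2 * L) phi (y%:Z - L%:Z).
Proof.
elim: L => [|L IH]; first by rewrite !big_ord0.
have -> : (2 * L.+1 = (2 * L).+2)%N by lia.
rewrite big_ord_recr/= big_ord_recr/= [RHS]big_ord_recl/= [in RHS]big_ord_recr/= {}IH.
rewrite -addrA [RHS]addrC -addrA; congr (_ + _).
  by apply: eq_bigr => y _; congr phi; rewrite /bump; lia.
by congr (_ + _); congr phi; rewrite /enum_int/bump; case: ifP; lia.
Qed.

Lemma enum_int_ge j L : (2 * L <= j)%N -> (L%:Z <= `|enum_int j|).
Proof. by rewrite /enum_int; case: ifP => o; lia. Qed.

(** The count is the ceiling of [w]. *)
Lemma count_lt {R : realType} (w : R) N : 0 <= w <= N%:R ->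
  w <= (\sum_(y < N) (y%:R < w)%R)%N%:R < w + 1.
Proof.
elim: N => [/le_anti <-|N IH /andP[w0 wN]].
  by rewrite big_ord0 lexx add0r ltr01.
rewrite big_ord_recr/=; have [wN'|wN'] := leP w N%:R.
  by rewrite addn0; apply: IH; rewrite w0.
have -> : (\sum_(y < N) (y%:R < w)%R)%N = N.
  transitivity (\sum_(y < N) 1)%N; last by rewrite sum_nat_const card_ord muln1.
  by apply: eq_bigr => y _; rewrite (lt_trans _ wN')// ltr_nat.
by rewrite addn1 wN/= -addn1 natrD ltrD2r.
Qed.

(** The count is a difference of two ceilings, of [b + L] and [a + L]. The bounds on [a] and [b]
    ensure that the window of [2 * L] integers cuts off nothing. *)
Lemma count_sites {R : realType} (a b : R) L : - L%:R <= a -> a <= b -> b <= L%:R ->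
  `|(\sum_(y < 2 * L) (a <= (y%:Z - L%:Z)%:~R < b)%R)%N%:R - (b - a)| <= 1.
Proof.
move=> La ab bL.
have h (y : nat) : ((a <= (y%:Z - L%:Z)%:~R < b)%R + (y%:R < a + L%:R)%R = (y%:R < b + L%:R)%R :> nat)%N.
  rewrite intrD rmorphN/= -!pmulrn -lerBlDr opprK ltrBlDr [(a + _ <= _)%R]leNgt.
  have [h1|h1]/= := ltP y%:R (a + L%:R) => //.
    by rewrite (lt_le_trans h1)// lerD2r.
  by rewrite addn0.
have h1 := @count_lt _ (a + L%:R) (2 * L).
have h2 := @count_lt _ (b + L%:R) (2 * L).
have L2 : (2 * L)%:R = 2 * L%:R :> R by rewrite natrM.
rewrite L2 in h1 h2.
have {}h1 := h1 ltac:(apply/andP; split; lra).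
have {}h2 := h2 ltac:(apply/andP; split; lra).
have E : (\sum_(y < 2 * L) (a <= (y%:Z - L%:Z)%:~R < b)%R + \sum_(y < 2 * L) (y%:R < a + L%:R)%R =
  \sum_(y < 2 * L) (y%:R < b + L%:R)%R)%N.
  by rewrite -big_split/=; apply: eq_bigr.
move: h2; rewrite -E natrD; move: h1 => /andP[+ +] /andP[].
by rewrite ler_norml; move: (_%:R) (_%:R : R) => u v *; apply/andP; split; lra.
Qed.

Section grid_counts.
Context {R : realType} {d : measure_display} {Om : measurableType d}.
Variables (P : probability Om R) (c q k : R) (rho : R -> R) (F : int -> Om -> R).
Hypotheses (c0 : 0 < c) (q0 : 0 < q) (k1 : -1 < k).
Hypothesis rho_even : forall x, rho (- x) = rho x.
Hypothesis rho_cont : {in `]- c, c[, continuous rho}.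
Hypothesis rho_pos : forall x, - c < x < c -> 0 < rho x.
Hypothesis rho_out : forall x, c <= `|x| -> rho x = 0.
Hypothesis rho_lim : (fun x => rho x / (c - x) `^ k) @ c^'- --> q.
Hypothesis iid : iid_with_density P F rho.
Variable m : nat.

Let zt := zeta k.
Let T : R := m.+2%:R.

Definition site n w (x : int) : R * R :=
  (n%:R `^ (- zt) * x%:~R, n%:R `^ (1 - zt) * discrepancy c F x w).

(* Sites [x] with [L n <= |x|] are mapped outside of the cells of the grid. *)
Let L n := (Num.truncn (T * n%:R `^ zt)).+1.

Let e n y l : set Om := [set w | grid m l (site n w (y%:Z - (L n)%:Z))].

Let gridT l (p : R * R) : (l < gridn m)%N -> grid m l p -> `|p.1| <= T /\ p.2 < T.
Proof.
move=> lm /(grid_box lm); rewrite /box rectE => -[/andP[a b] /andP[_ b']]; split => //.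
by rewrite ler_norml a ltW.
Qed.

Let n_gt0 n : (0 < n)%N -> 0 < n%:R `^ zt :> R.
Proof. by move=> n0; apply: powR_gt0; rewrite ltr0n. Qed.

Let zt0 : 0 < zt. Proof. exact: zeta_gt0. Qed.

Let scaled_norm n (x : int) : (0 < n)%N -> (`|n%:R `^ (- zt) * x%:~R| <= T) =
  (`|x%:~R| <= T * n%:R `^ zt).
Proof.
move=> n0; rewrite powRN normrM ger0_norm ?invr_ge0 ?powR_ge0//.
by rewrite mulrC ler_pdivrMr// n_gt0.
Qed.

Lemma mu_n_sum n w (A : set (R * R)) : (0 < n)%N -> (forall p, A p -> `|p.1| <= T) ->
  mu_n c k F n w A = ((\sum_(y < 2 * L n) (site n w (y%:Z - (L n)%:Z) \in A))%N%:R)%:E.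
Proof.
move=> n0 AT; rewrite /mu_n /mu_sum/= /mseries/=.
rewrite (nneseries_split 0 (2 * L n)) ?add0n//.
rewrite [X in (_ + X)%E]eseries0 ?adde0; last first.
  move=> j Lj _; rewrite /dir diracE memNset// => /AT/=.
  rewrite scaled_norm// leNgt => /negP; apply; apply: (lt_le_trans (truncnS_gt _)).
  by rewrite -intr_norm -[leLHS]/((L n)%:Z%:~R) ler_int; exact: enum_int_ge.
rewrite big_mkord.
transitivity (\sum_(j < 2 * L n) (((site n w (enum_int j) \in A)%:R : R)%:E)).
  by apply: eq_bigr => j _; exact: diracE.
rewrite (@sum_enum_int _ (fun x => ((site n w x \in A)%:R)%:E)).
by rewrite natr_sum -sumEFin.
Qed.

Lemma mu_n_grid n w l : (0 < n)%N -> (l < gridn m)%N ->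
  mu_n c k F n w (grid m l) = ((\sum_(y < 2 * L n) (w \in e n y l))%N%:R)%:E.
Proof.
move=> n0 lm; rewrite mu_n_sum//; last by move=> p /(gridT lm)[].
Qed.

Lemma mu_n_box n w : (0 < n)%N -> (mu_n c k F n w (box m) < +oo)%E.
Proof.
move=> n0; rewrite mu_n_sum ?ltry// => p; rewrite /box rectE => -[/andP[h1 h2] _].
have mT : m.+1%:R <= T by rewrite ler_nat.
by rewrite ler_norml; apply/andP; split; move: h1 h2 mT; move: (m.+1%:R) => a; lra.
Qed.

Lemma sigma_of_site n l (x : int) : sigma_of F [:: x; x + 1] [set w | grid m l (site n w x)].
Proof.
have h1 : x \in [:: x; x + 1] by rewrite inE eqxx.
have h2 : x + 1 \in [:: x; x + 1] by rewrite !inE eqxx orbT.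
have mD : measurable [set p : R * R | grid m l
    (n%:R `^ (- zt) * x%:~R, n%:R `^ (1 - zt) * (2 * c - `|p.2 - p.1|))].
  have mf : measurable_fun setT (fun p : R * R =>
      (n%:R `^ (- zt) * x%:~R, n%:R `^ (1 - zt) * (2 * c - `|p.2 - p.1|))).
    apply: measurable_fun_pair => //; apply: measurable_funM => //.
    apply: measurable_funB => //; apply: measurableT_comp => //; exact: measurable_funB.
  by have := mf measurableT _ (@measurable_grid R m l); rewrite setTI.
exact: (@sigma_of_pair _ _ _ F _ _ _ _ h1 h2 mD).
Qed.

Let me n y l : measurable (e n y l).
Proof. exact: (sigma_of_measurable iid (@sigma_of_site n l _)). Qed.

Let ed n y l l' : l != l' -> e n y l `&` e n y l' = set0.
Proof.
move=> ll; rewrite -subset0 => w [/= h1 h2].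
have : (@grid R m l `&` grid m l') (site n w (y%:Z - (L n)%:Z)) by [].
by rewrite grid_disj.
Qed.

(** Up to the shift by [L n], sites before [x] read [F] at positions [0, ..., x], and site [x.+1]
    reads it at [x + 1] and [x + 2]: leaving out site [x] makes the positions disjoint. *)
Let indep n x : exists A : set (set Om),
  [/\ A `<=` measurable, setI_closed A, A setT, forall y l, (y < x)%N -> A (e n y l) &
    forall l X, A X -> P (e n x.+1 l `&` X) = (P (e n x.+1 l) * P X)%E].
Proof.
pose s : seq int := [seq j%:Z - (L n)%:Z | j <- iota 0 x.+1].
exists (sigma_of F s); split.
- exact: sigma_of_measurable iid _.
- exact: sigma_of_setI.
- exact: sigma_of_setT.
- move=> y l yx; apply: (sigma_of_sub _ (@sigma_of_site n l _)) => i.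
  rewrite in_cons mem_seq1 => /orP[/eqP->|/eqP->].
    by apply: (map_f (fun j : nat => j%:Z - (L n)%:Z)); rewrite mem_iota; lia.
  have -> : y%:Z - (L n)%:Z + 1 = y.+1%:Z - (L n)%:Z by lia.
  by apply: (map_f (fun j : nat => j%:Z - (L n)%:Z)); rewrite mem_iota; lia.
- move=> l X AX; apply: (sigma_of_indep iid _ (@sigma_of_site n l _) AX).
  rewrite cat_uniq; apply/and3P; split.
  + by rewrite /= inE andbT; apply/eqP; lia.
  + apply/hasPn => _ /mapP[j + ->]; rewrite mem_iota in_cons mem_seq1 => h.
    by apply/norP; split; apply/eqP; lia.
  + by rewrite map_inj_in_uniq ?iota_uniq// => i j _ _; lia.
Qed.

Lemma measurable_mu_n_grid n l : measurable_fun setT (fun w => mu_n c k F n w (grid m l)).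
Proof.
rewrite /mu_n /mu_sum/= /mseries/=.
apply: ge0_emeasurable_sum => [j w _ _|j _]; first exact: measure_ge0.
rewrite /dir; under eq_fun do rewrite diracE.
apply/measurable_EFinP.
rewrite [X in measurable_fun _ X](_ : _ = \1_[set w | grid m l (site n w (enum_int j))]).
  apply: measurable_indic; exact: (sigma_of_measurable iid (@sigma_of_site n l _)).
by apply/funext => w; rewrite indicE; congr (nat_of_bool _)%:R; apply/idP/idP; rewrite !inE.
Qed.

Let C0 := q ^+ 2 * (betaR (k + 1) (k + 1) / (k + 1)).

(** Width of the cell times the increment of [C0 y^(2k + 2)], the limit of the rescaled tail; it is
    the intensity mass of the cell by [intensity_measure_grid]. *)
Definition grid_mean l : R := m.+1%:R^-1 *
  (C0 * ((grid2 m l + m.+1%:R^-1) `^ (2 * k + 2) - grid2 m l `^ (2 * k + 2))).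

Let C0_ge0 : 0 <= C0.
Proof.
have k1' := k1; rewrite /C0 mulr_ge0 ?sqr_ge0// divr_ge0//; last by lra.
apply: fine_ge0; apply: integral_ge0 => t _.
by rewrite lee_fin mulr_ge0 ?powR_ge0.
Qed.

Let mN0 : 0 < m.+1%:R^-1 :> R. Proof. by rewrite invr_gt0. Qed.

Let mtail z n (x : int) : measurable [set w | n%:R `^ (1 - zt) * discrepancy c F x w < z].
Proof.
have h1 : x \in [:: x; x + 1] by rewrite inE eqxx.
have h2 : x + 1 \in [:: x; x + 1] by rewrite !inE eqxx orbT.
have mD : measurable [set p : R * R | n%:R `^ (1 - zt) * (2 * c - `|p.2 - p.1|) < z].
  have mf : measurable_fun setT (fun p : R * R => n%:R `^ (1 - zt) * (2 * c - `|p.2 - p.1|)).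
    apply: measurable_funM => //.
    apply: measurable_funB => //; apply: measurableT_comp => //; exact: measurable_funB.
  have := mf measurableT `]-oo, z[%classic (measurable_itv _).
  by rewrite setTI; congr measurable; apply/seteqP; split => p; rewrite /= in_itv/=.
exact: (sigma_of_measurable iid (@sigma_of_pair _ _ _ F _ _ _ _ h1 h2 mD)).
Qed.

Lemma grid_mean_ge0 l : 0 <= grid_mean l.
Proof.
have y0 := @grid_pos R m l; have k1' := k1.
have k2 : 0 <= 2 * k + 2 by lra.
rewrite /grid_mean mulr_ge0 ?(ltW mN0)// mulr_ge0// subr_ge0.
by apply: ge0_ler_powR => //; rewrite ?nnegrE ?lerDl ?addr_ge0 ?(ltW y0) ?(ltW mN0).
Qed.

Lemma strip_cvg (y z th : R) : 0 < y -> y < z -> 0 < th -> \forall n \near \oo, forall x,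
  `|fine (P [set w | y <= n%:R `^ (1 - zt) * discrepancy c F x w < z]) -
    C0 * (z `^ (2 * k + 2) - y `^ (2 * k + 2)) * n%:R `^ (- zt)| <= th * n%:R `^ (- zt).
Proof.
move=> y0 yz th0; have th2 : 0 < th / 2 by rewrite divr_gt0.
have z0 : 0 < z by apply: lt_trans yz.
have H1 := scaled_tail_cvg c0 q0 k1 rho_even rho_cont rho_pos rho_out rho_lim iid y0 th2.
have H2 := scaled_tail_cvg c0 q0 k1 rho_even rho_cont rho_pos rho_out rho_lim iid z0 th2.
apply: filterS2 H1 H2 => n h1 h2 x; move: (h1 x) (h2 x) => {h1 h2}.
set A := [set w | _ < y]; set B := [set w | _ < z]; set D := [set w | y <= _ < z].
rewrite -/zt -/C0.
have -> : D = B `\` A.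
  apply/seteqP; split => w.
    by move=> /andP[h1 h2]; split => //; apply/negP; rewrite -leNgt.
  by move=> [h1 /negP h2]; rewrite /D/= leNgt h2.
have AB : A `<=` B by move=> w; rewrite /A/B/= => /lt_trans; apply.
have mA : measurable A by exact: mtail.
have mB : measurable B by exact: mtail.
rewrite measureD ?ltey_eq ?fin_num_measure// setIidr// fineB ?fin_num_measure//.
move: (fine (P A)) (fine (P B)) (n%:R `^ (- zt)) (z `^ _) (y `^ _) => a b u v t.
rewrite !ler_norml => /andP[h1 h2] /andP[h3 h4]; apply/andP; split; nra.
Qed.

Let inv_zt n : (0 < n)%N -> n%:R `^ zt * n%:R `^ (- zt) = 1 :> R.
Proof. by move=> n0; rewrite powRN mulfV// gt_eqF// n_gt0. Qed.

Let small_zt (th : R) : 0 < th -> \forall n \near \oo, n%:R `^ (- zt) < th.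
Proof.
move=> th0; apply: filterS2 (nbhs_infty_ge 1) (powRn_large th^-1 zt0) => n n0 h.
by rewrite powRN invf_plt ?posrE ?n_gt0.
Qed.

Let L_le n : (0 < n)%N -> (2 * L n)%:R * n%:R `^ (- zt) <= 2 * T + 2.
Proof.
move=> n0; have T0 : 0 <= T * n%:R `^ zt by rewrite mulr_ge0 ?powR_ge0.
have /andP[h _] := truncn_itv T0.
have h1 : (n%:R : R) `^ (- zt) <= 1.
  rewrite powRN invf_le1 ?n_gt0// -[leLHS](congr1 (@^~ zt) (powR1 R)).
  by apply: ge0_ler_powR; rewrite ?nnegrE ?ler01 ?ler0n ?ler1n// ltW.
have h2 := inv_zt n0; rewrite /L mulnS natrD natrM.
have {}h : (Num.truncn (T * n%:R `^ zt))%:R * n%:R `^ (- zt) <= T.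
  by apply: le_trans (ler_wpM2r (powR_ge0 _ _) h) _; rewrite -mulrA h2 mulr1.
by rewrite mulrDl -mulrA; lra.
Qed.

Let KL n : (2 * Num.truncn (T * n%:R `^ zt)).+2 = (2 * L n)%N.
Proof. by rewrite /L; lia. Qed.

(** A cell restricts the abscissa, which is deterministic, and the height separately. The sum is
    therefore the number of sites in an interval of length [n^zeta / m.+1], known up to 1, times a
    strip probability close to [V n^(- zeta)] uniformly in the site. *)
Let mean_cvg (l : 'I_(gridn m)) :
  (fun n => \sum_(y < (2 * Num.truncn (T * n%:R `^ zt)).+2) fine (P (e n y l))) @ \oo -->
  grid_mean l.
Proof.
under eq_cvg do rewrite KL.
have Tm := ltr0n R m.+1.
apply/cvgrPdist_le => eps eps0.
set V := C0 * ((grid2 m l + m.+1%:R^-1) `^ (2 * k + 2) - grid2 m l `^ (2 * k + 2)).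
(* The strip error is paid twice, since the number of sites times [n^(- zeta)] is only bounded by 2;
   the remaining third covers the rounding of the number of sites. *)
have th0 : 0 < eps / 3 by rewrite divr_gt0.
have V0 : 0 < eps / 3 / (`|V| + 1) by rewrite divr_gt0// ltr_wpDl.
have y0 := @grid_pos R m l.
have yz : grid2 m l < grid2 m l + m.+1%:R^-1 :> R by rewrite ltrDl.
apply: filterS (filterI (filterI (nbhs_infty_ge 1) (strip_cvg y0 yz th0))
  (filterI (small_zt V0) (small_zt ltr01))) => n [[n0 H] [N1 N2]].
pose al : R := grid1 m l; pose be : R := grid1 m l + m.+1%:R^-1.
set N := n%:R `^ (- zt) in H N1 N2; pose D x := [set w | grid2 m l <= n%:R `^ (1 - zt) * discrepancy c F x w < grid2 m l + m.+1%:R^-1].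
have N0 : 0 <= N by exact: powR_ge0.
have nN := inv_zt n0; rewrite -/N in nN.
pose b (y : nat) := (al * n%:R `^ zt <= (y%:Z - (L n)%:Z)%:~R < be * n%:R `^ zt)%R.
have eE y : fine (P (e n y l)) = (b y)%:R * fine (P (D (y%:Z - (L n)%:Z))).
  have bE : b y = (al <= N * (y%:Z - (L n)%:Z)%:~R < be).
    by rewrite /b /N powRN [_^-1 * _]mulrC ler_pdivlMr ?n_gt0// ltr_pdivrMr ?n_gt0.
  case E : (b y); rewrite ?mul1r ?mul0r.
    congr (fine (P _)); apply/seteqP; split => w; rewrite /e /D /= /grid rectE/=.
      by move=> [].
    by move=> h; split => //; rewrite -bE.
  rewrite [X in P X](_ : _ = set0) ?measure0//; rewrite -subset0 => w.
  by rewrite /e/= /grid rectE/= => -[+ _]; rewrite -/al -/be -bE E.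
pose cnt : R := (\sum_(y < 2 * L n) b y)%N%:R.
have cntE : cnt = \sum_(y < 2 * L n) (b y)%:R by rewrite /cnt natr_sum.
have S1 : `|\sum_(y < 2 * L n) fine (P (e n y l)) - cnt * (V * N)| <= cnt * (eps / 3 * N).
  rewrite cntE !mulr_suml -sumrB; apply: (le_trans (ler_norm_sum _ _ _)).
  apply: ler_sum => y _; rewrite eE -mulrBr normrM ger0_norm//.
  by apply: ler_wpM2l => //; exact: H.
have cle : `|cnt - m.+1%:R^-1 * n%:R `^ zt| <= 1.
  have := @count_sites R (al * n%:R `^ zt) (be * n%:R `^ zt) (L n).
  rewrite -/b -mulrBl [X in _ - X * _](_ : _ = m.+1%:R^-1); last by rewrite /be addrC addKr.
  have yT : grid m l (al, grid2 m l) by rewrite /grid rectE/= !lexx ltrDl ltrDl mN0.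
  have TL : T * n%:R `^ zt <= (L n)%:R by exact: ltW (truncnS_gt _).
  have [aT _] := gridT (ltn_ord l) yT; move: aT; rewrite /= ler_norml => /andP[aT aT'].
  (* The right end is not in the half-open cell, but if it exceeded [T] then so would the abscissa
     of some point of the cell. *)
  have bT : be <= T.
    rewrite leNgt; apply/negP => Tb.
    have : grid m l ((T + be) / 2, grid2 m l).
      rewrite /grid rectE/= !lexx ltrDl mN0 -/al -/be; split => //; apply/andP; split; lra.
    by move=> /(gridT (ltn_ord l))[/=]; rewrite ler_norml => /andP[_]; lra.
  have n1 := n_gt0 n0; apply.
  - rewrite lerNl; apply: le_trans TL; rewrite -mulNr ler_wpM2r ?(ltW n1)//; lra.
  - by rewrite ler_wpM2r ?(ltW n1)// lerDl ltW.
  - by apply: le_trans TL; rewrite ler_wpM2r ?(ltW n1).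
have cN : `|cnt * N - m.+1%:R^-1| <= N.
  have -> : cnt * N - m.+1%:R^-1 = (cnt - m.+1%:R^-1 * n%:R `^ zt) * N.
    by rewrite mulrBl -mulrA nN mulr1.
  by rewrite normrM (ger0_norm N0) ler_piMl.
have d1 : m.+1%:R^-1 <= 1 :> R by rewrite invf_le1// ler1n.
have VN : `|V| * N <= eps / 3.
  rewrite -[leRHS](@divfK _ (`|V| + 1)) ?gt_eqF// ?ltr_wpDl// mulrC.
  by apply: ler_pM => //; rewrite ?lerDl// ltW.
have cNE : cnt * (eps / 3 * N) <= 2 * (eps / 3).
  rewrite mulrCA mulrC ler_wpM2r ?ltW//.
  by move: cN; rewrite ler_norml; move: (_^-1) d1 => dl d1 /andP[_]; lra.
have S2 : `|cnt * (V * N) - m.+1%:R^-1 * V| <= eps / 3.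
  have -> : cnt * (V * N) - m.+1%:R^-1 * V = V * (cnt * N - m.+1%:R^-1).
    by move: (m.+1%:R^-1) => dl; ring.
  rewrite normrM.
  by apply: le_trans VN; rewrite ler_wpM2l.
rewrite distrC -/V /grid_mean.
apply: (le_trans (ler_distD (cnt * (V * N)) _ _)).
apply: (le_trans (lerD S1 S2)); lra.
Qed.

Let T0 : 0 < T. Proof. by rewrite ltr0n. Qed.

(** One more than the limiting constant of the tail at height [T], so that it bounds the rescaled
    tail of every site for large [n]. *)
Let BT : R := C0 * T `^ (2 * k + 2) + 1.

Let BT0 : 0 <= BT. Proof. by rewrite addr_ge0// mulr_ge0// powR_ge0. Qed.

Let B n y := \bigcup_(l in `I_(gridn m)) e n y l.

Let Bsub n y : B n y `<=`
  [set w | n%:R `^ (1 - zt) * discrepancy c F (y%:Z - (L n)%:Z) w < T].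
Proof. by move=> w [l /= lm /(gridT lm)[]]. Qed.

Let mB n y : measurable (B n y).
Proof. by apply: bigcup_measurable => l _; exact: me. Qed.

Let tail_le : \forall n \near \oo, forall x,
  fine (P [set w | n%:R `^ (1 - zt) * discrepancy c F x w < T]) <= BT * n%:R `^ (- zt).
Proof.
have := scaled_tail_cvg c0 q0 k1 rho_even rho_cont rho_pos rho_out rho_lim iid T0 ltr01.
apply: filterS => n H x; have := H x; rewrite -/zt -/C0 ler_norml => /andP[_].
by rewrite /BT mulrDl; move: (fine _) (_ `^ (- _)) => a b; lra.
Qed.

Let Pb : \forall n \near \oo, forall y, fine (P (B n y)) <= BT * n%:R `^ (- zt).
Proof.
apply: filterS tail_le => n H y; apply: le_trans (H (y%:Z - (L n)%:Z)).
by apply: fineP_le => //; exact: Bsub.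
Qed.

Let Pa (th : R) : 0 < th -> \forall n \near \oo, forall y,
  (2 * Num.truncn (T * n%:R `^ zt)).+2%:R * fine (P (B n y `&` B n y.+1)) <= th.
Proof.
(* There are at most [(2T + 2) n^zeta] sites, each with tail at most [BT n^(- zeta)]; the adjacency
   factor has to beat the product of these two constants. *)
move=> th0; have D0 : 0 < (2 * T + 2) * (BT + 1).
  by have T0' := T0; have BT0' := BT0; apply: mulr_gt0; lra.
have th1 : 0 < th / ((2 * T + 2) * (BT + 1)) by rewrite divr_gt0.
have H1 := scaled_adjacent_cvg c0 q0 k1 rho_even rho_cont rho_pos rho_out rho_lim iid T0 th1.
apply: filterS2 (filterI (nbhs_infty_ge 1) tail_le) H1 => n [n0 H2] {}H1 y.
set x : int := y%:Z - (L n)%:Z.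
have xE : y.+1%:Z - (L n)%:Z = x + 1 by rewrite /x -addn1 PoszD addrAC.
rewrite KL.
apply: (@le_trans _ _ ((2 * L n)%:R * (th / ((2 * T + 2) * (BT + 1)) * (BT * n%:R `^ (- zt))))).
  rewrite ler_wpM2l//; apply: le_trans (le_trans (H1 x) _); last first.
    by rewrite ler_wpM2l ?(ltW th1).
  have h1 := @Bsub n y; have h2 := @Bsub n y.+1; rewrite xE in h2.
  by apply: fineP_le; [exact: measurableI|apply: measurableI; exact: mtail|exact: setISS].
rewrite mulrCA mulrA mulrAC.
rewrite -[leRHS](@divfK _ ((2 * T + 2) * (BT + 1))) ?gt_eqF//.
rewrite -!mulrA ler_wpM2l ?(ltW th0)// ler_wpM2l ?invr_ge0 ?(ltW D0)//.
rewrite [leRHS]mulrC; apply: ler_pM; rewrite ?mulr_ge0 ?powR_ge0 ?lerDl//.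
by rewrite mulrC; exact: L_le.
Qed.

Let b0 : (fun n => (2 * Num.truncn (T * n%:R `^ zt)).+2%:R * (BT * n%:R `^ (- zt)) ^+ 2)
  @ \oo --> 0.
Proof.
apply/cvgrPdist_le => eps eps0.
have D0 : 0 < (2 * T + 2) * BT ^+ 2 + 1.
  by rewrite ltr_wpDl// mulr_ge0 ?sqr_ge0//; have := T0; lra.
have h := small_zt (divr_gt0 eps0 D0).
apply: filterS2 (nbhs_infty_ge 1) h => n n0 h.
rewrite sub0r normrN KL ger0_norm ?mulr_ge0 ?sqr_ge0//.
have -> : (2 * L n)%:R * (BT * n%:R `^ (- zt)) ^+ 2 =
  ((2 * L n)%:R * n%:R `^ (- zt)) * BT ^+ 2 * n%:R `^ (- zt) by ring.
apply: (@le_trans _ _ (((2 * T + 2) * BT ^+ 2 + 1) * n%:R `^ (- zt))).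
  rewrite ler_wpM2r ?powR_ge0//; apply: ler_wpDr => //.
  by rewrite ler_wpM2r ?sqr_ge0//; exact: L_le.
by rewrite mulrC -ler_pdivlMr// ltW.
Qed.

Lemma grid_counts_cvg (ka : nat -> nat) :
  (fun n => fine (P (cyl (mu_n c k F n) m ka))) @ \oo -->
  \prod_(l < gridn m) poisson_mass (grid_mean l) (ka l).
Proof.
have H := @poisson_counts_cvg _ _ _ P (gridn m) grid_mean
  (fun n => (2 * Num.truncn (T * n%:R `^ zt)).+1) e _ me ed indep mean_cvg Pb Pa b0 ka grid_mean_ge0.
apply: cvg_trans H; apply: near_eq_cvg; apply: filterS (nbhs_infty_ge 1) => n n0.
rewrite KL; congr (fine (P _)); apply: eq_bigcapr => l lm.
apply/seteqP; split => w /=; rewrite mu_n_grid//.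
  by move=> ->.
by move=> [] /eqP; rewrite eqr_nat => /eqP.
Qed.

End grid_counts.

(** * The Poisson process *)

(** By Tonelli the mass is the width times a one-dimensional integral. Here the two constants meet:
    [p_kappa / (2k + 2)] equals [B / (k + 1)], the constant of the discrepancy tail. *)
Lemma intensity_measure_rect {R : realType} (q k a b y z : R) :
  -1 < k -> a < b -> 0 < y -> y < z ->
  intensity_measure q k (rect a b y z) = ((b - a) * (q ^+ 2 * (betaR (k + 1) (k + 1) / (k + 1)) *
    (z `^ (2 * k + 2) - y `^ (2 * k + 2))))%:E.
Proof.
move=> k1 ab y0 yz; have k0 : k + 1 != 0 by rewrite gt_eqF//; lra.
have k2 : 2 * k + 2 != 0 by rewrite gt_eqF//; lra.
pose r := q ^+ 2 * p_kappa k.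
pose g (t : R) := (r * t `^ (2 * k + 1))%:E.
have mg (D : set R) : measurable_fun D g.
  apply/measurable_EFinP/measurable_funTS; exact: measurable_funM.
have r0 : 0 <= r.
  rewrite mulr_ge0 ?sqr_ge0// mulr_ge0//; apply: fine_ge0; apply: integral_ge0 => t _.
  by rewrite lee_fin mulr_ge0 ?powR_ge0.
have g0 t : (0 <= g t)%E by rewrite lee_fin mulr_ge0 ?powR_ge0.
rewrite /intensity_measure.
under eq_integral => p.
  rewrite inE rectE => -[_ /andP[yp _]].
  rewrite /intensity (lt_le_trans y0 yp).
  over.
rewrite integral_mkcond /leb2.
set h := _ \_ _; have hE (x t : R) : h (x, t) = (if (a <= x < b)%R then (g \_ `[y, z[) t else 0)%E.
  rewrite /h !patchE; case: ifP => [|/negP].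
    by rewrite inE rectE/= => -[-> tz]; rewrite mem_set//= in_itv.
  rewrite inE rectE/= => n; case: ifP => // axb; case: ifP => //.
  by rewrite inE/= in_itv/= => tz; exfalso; apply: n.
rewrite fubini_tonelli1; last 2 first.
- apply/measurable_restrict => //; first exact: measurable_rect.
  rewrite setTI; apply: measurable_funTS.
  apply: (@measurableT_comp _ _ _ _ _ _ g); first exact: mg.
  exact: measurable_snd.
- by move=> [x t]; rewrite hE; case: ifP => // _; rewrite patchE; case: ifP.
have VE : (\int[@lebesgue_measure R]_(t in `[y, z[) g t)%E =
    (q ^+ 2 * (betaR (k + 1) (k + 1) / (k + 1)) * (z `^ (2 * k + 2) - y `^ (2 * k + 2)))%:E.
  rewrite integral_itv_bndo_bndc//.
  rewrite /g; under eq_integral do rewrite EFinM.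
  rewrite ge0_integralZl_EFin//; last 2 first.
  - by move=> t _; rewrite lee_fin powR_ge0.
  - by apply/measurable_EFinP/measurable_funTS; exact: measurable_powR.
  rewrite integral_powR_segment//; last by rewrite gt_eqF//; lra.
  have -> : 2 * k + 1 + 1 = 2 * k + 2 by ring.
  by rewrite -EFinM /r /p_kappa; congr (_%:E); move: (_ `^ _ - _) => v; field; rewrite k0 k2.
set V := q ^+ 2 * _ * _ in VE *.
transitivity (\int[@lebesgue_measure R]_(x in `[a, b[) V%:E)%E.
  rewrite [RHS]integral_mkcond; apply: eq_integral => x _.
  rewrite /fubini_F patchE; under eq_integral do rewrite hE.
  rewrite mem_setE in_itv/=.
  case: (a <= x < b); first by rewrite -integral_mkcond VE.
  by rewrite integral0.
rewrite integral_cst//= lebesgue_measure_itv/= lte_fin ab.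
by rewrite -EFinB -EFinM mulrC.
Qed.

Lemma intensity_measure_grid {R : realType} (q k : R) m l : -1 < k ->
  intensity_measure q k (grid m l) = (grid_mean q k m l)%:E.
Proof.
move=> k1; rewrite /grid intensity_measure_rect//; [|by rewrite ltrDl invr_gt0|exact: grid_pos|
  by rewrite ltrDl invr_gt0].
by rewrite /grid_mean; congr (_ * _)%:E; rewrite addrC addKr.
Qed.

Lemma radonS_boxes {R : realType} (nu : @measR2 R) :
  (forall m, (nu (box m) < +oo)%E) -> radonS nu.
Proof.
move=> nub K cK KS; have [N _ H] := compact_box cK KS.
apply: le_lt_trans (nub N); apply: le_measure; rewrite ?inE; last exact: (H N (leqnn N)).
  exact: measurable_compact.
exact: measurable_rect.
Qed.

Section poisson_process.
Context {R : realType} {d} {Om : measurableType d} (P : probability Om R).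
Variables (mu : Om -> @measR2 R) (Lam : set (R * R) -> \bar R).
Hypothesis pp : is_poisson_process P mu Lam.

Lemma poisson_count A n : measurable A -> A `<=` Sp -> (Lam A < +oo)%E ->
  P [set w | mu w A = (n%:R)%:E] = (poisson_mass (fine (Lam A)) n)%:E.
Proof.
move=> mA AS LA; have [_ _ H] := pp.
have := H 1%N (fun=> A) (fun=> n); rewrite big_ord_recr big_ord0/= mul1e => <-//.
  congr (P _); apply/seteqP; split => w /=; first by move=> h [].
  by move=> /(_ 0%N erefl).
by move=> [|i] [|j].
Qed.

(** The values of [mu] are general measures; that [A] has an integer mass follows from the Poisson
    probabilities of the integers summing to 1, by the exponential series. *)
Lemma poisson_count_nat A : measurable A -> A `<=` Sp -> (Lam A < +oo)%E ->
  {ae P, forall w, exists n, mu w A = (n%:R)%:E}.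
Proof.
move=> mA AS LA; have [_ mmu _] := pp.
pose E n := [set w | mu w A = (n%:R)%:E].
have mE n : measurable (E n).
  by have := mmu A mA measurableT _ (emeasurable_set1 (n%:R)%:E); rewrite setTI.
have mU : measurable (\bigcup_n E n) by exact: bigcup_measurable.
have PU : P (\bigcup_n E n) = 1%E.
  rewrite measure_bigcup//; last first.
    move=> i j _ _ [w [/= h1 h2]]; apply/eqP.
    by rewrite -(eqr_nat R); apply/eqP; move: h1 h2; rewrite /E/= => -> [].
  have PE n : P (E n) = (poisson_mass (fine (Lam A)) n)%:E by exact: poisson_count.
  set la := fine _ in PE.
  transitivity (\sum_(0 <= i <oo | i \in setT) (poisson_mass la i)%:E)%E.
    by apply: eq_eseriesr => i _; exact: PE.
  apply/cvg_lim => //.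
  have -> : (fun n => \sum_(0 <= i < n | i \in setT) (poisson_mass la i)%:E)%E =
     EFin \o (fun n => expR (- la) * series (exp_coeff la) n).
    apply/funext => n; rewrite /= /series/= mulr_sumr -sumEFin.
    apply: eq_big => [i|i _]; first by rewrite in_setT.
    by rewrite /poisson_mass /exp_coeff mulrA.
  apply: cvg_EFin; first by exact: nearW.
  rewrite [X in _ --> X](_ : _ = expR (- la) * expR la); last by rewrite expRN mulVf ?gt_eqF ?expR_gt0.
  by apply: cvgMr; exact: is_cvg_series_exp_coeff.
exists (~` \bigcup_n E n); split; first exact: measurableC.
  by rewrite [LHS]probability_setC// PU subee.
by move=> w /= h [n _ En]; apply: h; exists n.
Qed.

End poisson_process.

Theorem theorem2p5 (R : realType) (d : measure_display) (Om : measurableType d)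
  (P : probability Om R) (c q k : R) (rho : R -> R) (F : int -> Om -> R) :
  0 < c -> 0 < q -> -1 < k ->
  (forall x, rho (- x) = rho x) ->
  {in `]- c, c[, continuous rho} ->
  (forall x, - c < x < c -> 0 < rho x) ->
  (forall x, c <= `|x| -> rho x = 0) ->
  (fun x => rho x / (c - x) `^ k) @ c^'- --> q ->
  iid_with_density P F rho ->
  forall (d' : measure_display) (Om' : measurableType d') (P' : probability Om' R)
    (mu : Om' -> measR2),
    is_poisson_process P' mu (intensity_measure q k) ->
    conv_in_distribution P (mu_n c k F) P' mu.
Proof.
move=> c0 q0 k1 re rc rp ro rl iid d' Om' P' mu pp.
have Lg m l : (intensity_measure q k (grid m l) < +oo)%E.
  by rewrite intensity_measure_grid// ltry.
have [_ mmu Hpp] := pp.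
apply: cvg_in_distribution_counts.
- by move=> n w n0; apply: radonS_boxes => m; exact: mu_n_box.
- by move=> n m l; exact: measurable_mu_n_grid iid _ _ _.
- by move=> m l; apply: mmu; exact: measurable_grid.
(* The cells of all grids are countably many, so one null set suffices; outside it each box is
   covered by finitely many cells of finite mass, which makes [mu w] Radon. *)
- have : {ae P', forall w, forall m l, exists n, mu w (grid m l) = (n%:R)%:E}.
    apply: ae_foralln => m; apply: ae_foralln => l.
    by apply: (poisson_count_nat pp) => //; [exact: measurable_grid|exact: grid_Sp].
  apply: filterS => w H; split; last first.
    move=> m; have [ka kaE] := choice (H m).
    by exists ka => l _.
  apply: radonS_boxes => m.
  apply: (@le_lt_trans _ _ (mu w (\big[setU/set0]_(l < gridn m) grid m l))).
    apply: le_measure; rewrite ?inE; first exact: measurable_rect.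
      by apply: bigsetU_measurable => l _; exact: measurable_grid.
    by move=> p /box_grid[l lm pl]; rewrite -bigcup_mkord; exists l.
  rewrite (measure_bigsetU_ord_cond (mu w)); last 2 first.
  + by move=> *; exact: measurable_grid.
  + by move=> i j _ _ [p [h1 h2]]; apply/val_inj; exact: grid_inj h1 h2.
  by apply: lte_sum_pinfty => l _; have [n E] := H m l; rewrite [ltLHS]E ltry.
- move=> m ka.
  have -> : P' (cyl mu m ka) = (\prod_(l < gridn m)
      (poisson_mass (fine (intensity_measure q k (grid m l))) (ka l))%:E)%E.
    apply: Hpp => [l _|i j _ _]; last exact: grid_disj.
    by split; [exact: measurable_grid|exact: grid_Sp|].
  rewrite prodEFin/=; under eq_bigr do rewrite intensity_measure_grid//.
  exact: grid_counts_cvg iid m ka.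
Qed.
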